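(* Assume that for each $k=1,2$ the hypotheses of Lemma 3 hold with $\alpha_n$ replaced by $\alpha_{k,n}$ (and the corresponding auxiliary quantities $\gamma_{\alpha_{k,n},i,n}$, $e_{\alpha_{k,n},i,n}$). Then $\Gamma_n=E(\boldsymbol T_n\boldsymbol T_n^\top)$ is positive semi-definite with bounded eigenvalues for all large $n$. If in addition the eigenvalues of $\Gamma_n$ are bounded away from zero for all large $n$, then $\Gamma_n^{-1/2}\boldsymbol T_n\to_d N(0,\mathrm I_{2p\times2p})$.
   Context: Two-level setting: $(\boldsymbol x_{i,n},y_{i,n})$, $i=1,\dots,n$, with nonrandom $\boldsymbol x_{i,n}\in\mathbb R^p$. For $k=1,2$ and levels $1-\alpha_{k,n}$, $\alpha_{k,n}\in(0,1)$, $y_{i,n}=\boldsymbol x_{i,n}^\top\boldsymbol\beta_{1-\alpha_{k,n},n}+\gamma_{\alpha_{k,n},i,n}e_{\alpha_{k,n},i,n}$, with nonrandom $0<\gamma_{\alpha_{k,n},i,n}<\infty$, $n^{-1}\sum_i\gamma_{\alpha_{k,n},i,n}=1$, $e_{\alpha_{k,n},i,n}=G_{n,k}(\mathcal F_i)$ for measurable $G_{n,k}$, $\mathcal F_i=(\dots,\epsilon_{i-1},\epsilon_i)$ with common i.i.d. innovations $(\epsilon_j)$, and $\Pr(e_{\alpha_{k,n},i,n}\le0)=1-\alpha_{k,n}$. Lemma 3 hypotheses for a generic level $\alpha_n$ with model $y_{i,n}=\boldsymbol x_{i,n}^\top\boldsymbol\beta_{1-\alpha_n,n}+\gamma_{i,n}e_{i,n}$,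 $e_{i,n}=G_n(\mathcal F_i)$, $F_n(u)=\Pr(e_{i,n}\le u)$, density $f_n$: $\Sigma_n=n^{-1}\sum_i\boldsymbol x_{i,n}\boldsymbol x_{i,n}^\top$ nonsingular for large $n$, $\boldsymbol z_{i,n}=\Sigma_n^{-1/2}\boldsymbol x_{i,n}$, $\tilde\Sigma_n=n^{-1}\sum_i\gamma_{i,n}^{-1}\boldsymbol z_{i,n}\boldsymbol z_{i,n}^\top$, $\tau_n=(n\alpha_n)^{1/2}f_n(0)/\{1-F_n(0)\}$; (A1) $(e_{i,n})\in\mathrm{TAS}_q$ for some $q\ge2$, where, with $\epsilon_0^\star$ an independent copy of $\epsilon_0$, $\mathcal F_k^\star=(\mathcal F_{-1},\epsilon_0^\star,\epsilon_1,\dots,\epsilon_k)$, $e^\star_{k,n}=G_n(\mathcal F_k^\star)$, $\theta_{n,\alpha}(k)=\sup_{a\in(0,\alpha],N\ge n}\Pr\{e^\star_{k,N}\le F_N^{-1}(1-a)\mid e_{k,N}>F_N^{-1}(1-a)\}$, $\mathrm{TAS}_q$ means $\lim_{\alpha\downarrow0}\lim_n\sum_{k\ge0}\{\theta_{n,\alpha}(k)\}^{1/q}<\infty$; (A2) there is $\alpha\in(0,1)$ with $F_n$ continuously differentiable with uniformly bounded strictly positive derivative on $\{F_n^{-1}(1-\alpha),F_n^{-1}(1)\}$ and $\liminf_n|F_n^{-1}(1)-F_n^{-1}(1-\alpha)|>0$; (A3) $\max_i|\boldsymbol z_{i,n}|=o\{(n\alpha_n)^{1/2}\}$; (A4) $c_{\gamma,1}\le\min_i\gamma_{i,n}\le\max_i\gamma_{i,n}\le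 c_{\gamma,2}$ for constants $0<c_{\gamma,1}\le c_{\gamma,2}<\infty$; $\alpha_n\to0$, $n\alpha_n\to\infty$, $\tau_n\to\infty$, $\max_i|\boldsymbol z_{i,n}|=o(\tau_n)$; for every $c<\infty$, $\max_i\sup_{|\boldsymbol\varphi|\le c}|f_n(\gamma_{i,n}^{-1}\tau_n^{-1}\boldsymbol z_{i,n}^\top\boldsymbol\varphi)-f_n(0)|/f_n(0)\to0$; eigenvalues of $\tilde\Sigma_n$ bounded away from zero. Linear form: $\psi_{1-\alpha}(u)=(1-\alpha)-\mathbb 1\{u\le0\}$; $\zeta_{i,n,k}=\{\alpha_{k,n}(1-\alpha_{k,n})\}^{-1/2}\psi_{1-\alpha_{k,n}}(\gamma_{\alpha_{k,n},i,n}e_{\alpha_{k,n},i,n})$, $\boldsymbol\zeta_{i,n}=(\zeta_{i,n,1},\zeta_{i,n,2})^\top$, $\boldsymbol T_n=n^{-1/2}\sum_{i=1}^n\boldsymbol\zeta_{i,n}\otimes\boldsymbol z_{i,n}\in\mathbb R^{2p}$ with $\otimes$ the Kronecker product. *)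

(* Defs.v *)
From HB Require Import structures.
From mathcomp Require Import all_boot all_order all_algebra.
From mathcomp Require Import all_classical all_reals all_analysis.
From Stdlib Require Import ClassicalEpsilon.
Set Implicit Arguments. Unset Strict Implicit. Unset Printing Implicit Defensive.
Import Order.TTheory GRing.Theory Num.Theory.
Import numFieldNormedType.Exports.
Local Open Scope classical_set_scope.
Local Open Scope ring_scope.

Section LinAlg.
Context {R : realType}.

Definition vnorm m (v : 'cV[R]_m) : R := Num.sqrt (\sum_i v i 0 ^+ 2).

Definition posdef m (A : 'M[R]_m) :=
  A^T = A /\ forall v : 'cV[R]_m, v != 0 -> 0 < (v^T *m A *m v) 0 0.
Definition psd m (A : 'M[R]_m) :=
  A^T = A /\ forall v : 'cV[R]_m, 0 <= (v^T *m A *m v) 0 0.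

(* A^{-1/2}: the symmetric positive definite square root of A^{-1}
   (unique when A is symmetric positive definite). *)
Definition invsqrtmx m (A : 'M[R]_m) : 'M[R]_m :=
  epsilon (inhabits 0) (fun B => posdef B /\ B *m B = invmx A).

(* Kronecker product of column vectors: (a (x) b)_{(i,j)} = a_i b_j,
   with row-major (lexicographic) indexing of the pairs (i,j). *)
Definition kron m n (a : 'cV[R]_m) (b : 'cV[R]_n) : 'cV[R]_(m * n) :=
  (mxvec (a *m b^T))^T.

Definition maxi n (u : 'I_n -> R) : R := \big[Num.max/0]_(i < n) u i.

Definition is_o (a b : nat -> R) :=
  forall e : R, 0 < e -> \forall n \near \oo, `|a n| <= e * `|b n|.

Definition Sigma p (x : forall n, 'I_n -> 'cV[R]_p) n : 'M[R]_p :=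
  n%:R^-1 *: \sum_(i < n) (x n i *m (x n i)^T).
Definition zz p (x : forall n, 'I_n -> 'cV[R]_p) n (i : 'I_n) : 'cV[R]_p :=
  invsqrtmx (Sigma x n) *m x n i.
Definition Sigmat p (x : forall n, 'I_n -> 'cV[R]_p)
  (gam : forall n, 'I_n -> R) n : 'M[R]_p :=
  n%:R^-1 *: \sum_(i < n) ((gam n i)^-1 *: (zz x i *m (zz x i)^T)).

(* Integral of f against the standard normal law N(0, I_m) on R^m,
   written as an iterated Lebesgue integral of the product density. *)
Fixpoint gaussI (k : nat) (g : (nat -> R) -> R) : R :=
  match k with
  | 0 => g (fun _ => 0)
  | k'.+1 => \int[@lebesgue_measure R]_(t in setT)
       (normal_pdf 0 1 t * gaussI k' (fun v => g (fun j => if j is j'.+1 then v j' else t)))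
  end.
Definition gaussE m (f : 'cV[R]_m -> R) : R :=
  gaussI m (fun v => f (\col_(i < m) v (nat_of_ord i))).

End LinAlg.

Definition cylinders dE (E : measurableType dE) : set (set (nat -> E)) :=
  [set C | exists (j : nat) (A : set E), measurable A /\ C = [set s | A (s j)]].
Definition seq_measurable_fun dE (E : measurableType dE) {R : realType}
  (G : (nat -> E) -> R) :=
  forall B : set R, measurable B -> smallest (sigma_algebra setT) (@cylinders _ E) (G @^-1` B).

(* F_i = (..., eps_{i-1}, eps_i) encoded as j |-> eps_{i-j} *)
Definition past {Om E : Type} (eps : int -> Om -> E) (i : int) (w : Om) : nat -> E :=
  fun j => eps (i - j%:Z) w.
(* F_k^* = (F_{-1}, eps_0^*, eps_1, ..., eps_k) *)
Definition pastS {Om E : Type} (eps : int -> Om -> E) (epss : Om -> E) (i : int) (w : Om)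
  : nat -> E := fun j => if i - j%:Z == 0 then epss w else eps (i - j%:Z) w.
Definition fam {Om E : Type} (eps : int -> Om -> E) (epss : Om -> E) (o : option int) :=
  match o with None => epss | Some j => eps j end.

Definition quant {R : realType} (F : R -> R) (t : R) : \bar R :=
  ereal_inf (EFin @` [set u | t <= F u]).

Section Prob.
Context {R : realType} d (Om : measurableType d) (P : probability Om R).

Definition prob (A : set Om) : R := fine (P A).
Definition cprob (A B : set Om) : R := prob (A `&` B) / prob B.

Definition mutually_independent dE (E : measurableType dE) (I : eqType)
  (X : I -> Om -> E) :=
  forall J : seq I, uniq J -> forall A : I -> set E, (forall j, measurable (A j)) ->
    prob (\bigcap_(j in [set` J]) (X j @^-1` A j)) = \prod_(j <- J) prob (X j @^-1` A j).

Definition iid dE (E : measurableType dE) (I : eqType) (X : I -> Om -> E) :=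
  [/\ forall j, measurable_fun setT (X j),
      mutually_independent X &
      forall i j (A : set E), measurable A -> prob (X i @^-1` A) = prob (X j @^-1` A)].

Definition cdf (X : Om -> R) (u : R) : R := prob [set w | X w <= u].

Definition theta (e es : nat -> int -> Om -> R) (F : nat -> R -> R) (n : nat) (a : R)
  (k : nat) : R :=
  fine (ereal_sup [set r | exists (b : R) (N : nat), 0 < b <= a /\ (n <= N)%N /\
     r = (cprob [set w | ((es N k%:Z w)%:E <= quant (F N) (1 - b))%E]
                [set w | (quant (F N) (1 - b) < (e N k%:Z w)%:E)%E])%:E]).

Definition TAS (q : R) (e es : nat -> int -> Om -> R) (F : nat -> R -> R) :=
  (lim ((fun a : R => limn (fun n => (\sum_(0 <= k <oo)
        ((theta e es F n a k) `^ q^-1)%:E)%E)) @ 0^'+) < +oo)%E.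

Definition Emx m (T : Om -> 'cV[R]_m) : 'M[R]_m :=
  \matrix_(r, s) (\int[P]_(w in setT) (T w r 0 * T w s 0)).

Definition cvgd_stdnormal m (X : nat -> Om -> 'cV[R]_m) :=
  forall f : 'cV[R]_m -> R, continuous f -> (exists M : R, forall v, `|f v| <= M) ->
    (fun n => \int[P]_(w in setT) f (X n w)) @ \oo --> gaussE f.

(* Hypotheses of Lemma 3, for the process e (e n i = e_{i,n}), its
   perturbed version es (es n k = e^*_{k,n}), level alpha_n, scales gam,
   and density f n of e_{i,n}. *)
Definition lemma3_hyps p (x : forall n, 'I_n -> 'cV[R]_p) (alpha : nat -> R)
  (gam : forall n, 'I_n -> R) (e es : nat -> int -> Om -> R) (f : nat -> R -> R) :=
  let F n := cdf (e n 1) in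
  let z := zz x in
  let tau n := Num.sqrt (n%:R * alpha n) * f n 0 / (1 - F n 0) in
  let zmax n := maxi (fun i : 'I_n => vnorm (z n i)) in
  (forall n u, 0 <= f n u /\
     (F n u)%:E = (\int[@lebesgue_measure R]_(v in [set` `]-oo, u]]) (f n v)%:E)%E) /\
  (\forall n \near \oo, Sigma x n \in unitmx) /\
  (exists q : R, 2 <= q /\ TAS q e es F) /\
  (exists a : R, 0 < a < 1 /\
    (exists C : R, forall n u,
       (quant (F n) (1 - a) < u%:E < quant (F n) 1)%E ->
       is_derive u 1 (F n) (f n u) /\ 0 < f n u <= C) /\
    (forall n, {within [set u | (quant (F n) (1 - a) < u%:E < quant (F n) 1)%E],
                continuous (f n)}) /\
    (0 < limn_einf (fun n => `|quant (F n) 1 - quant (F n) (1 - a)|))%E) /\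
  is_o zmax (fun n => Num.sqrt (n%:R * alpha n)) /\
  (exists c1 c2 : R, 0 < c1 <= c2 /\ forall n (i : 'I_n), c1 <= gam n i <= c2) /\
  alpha @ \oo --> 0 /\
  (fun n => n%:R * alpha n) @ \oo --> +oo /\
  tau @ \oo --> +oo /\
  is_o zmax tau /\
  (forall c : R, forall eps : R, 0 < eps -> \forall n \near \oo,
     forall (i : 'I_n) (phi : 'cV[R]_p), vnorm phi <= c ->
     `|f n ((gam n i)^-1 * (tau n)^-1 * ((z n i)^T *m phi) 0 0) - f n 0| / f n 0
       <= eps) /\
  (exists c : R, 0 < c /\ \forall n \near \oo,
     forall a : R, eigenvalue (Sigmat x gam n) a -> c <= a).

End Prob.

(* Main.v *)
Require Import Defs.
From HB Require Import structures.
From mathcomp Require Import all_boot all_order all_algebra.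
From mathcomp Require Import spectral.
From mathcomp.real_closed Require Import complex.
From mathcomp Require Import all_classical all_reals all_analysis.
From mathcomp Require Import measurable_realfun.
From mathcomp Require Import ring lra zify.
Import Order.TTheory GRing.Theory Num.Theory.
Import numFieldNormedType.Exports.

(** Since [gam > 0], the score [psi (gam e)] equals [1{e > 0} - alpha], so a
    linear form [u . T_n] is a sum over [i] and over the two levels of centred
    indicators of events determined by the past of the innovations.
    - Tail adversarial stability bounds the probability that replacing one
      innovation at lag [l] changes such an indicator by
      [2 alpha theta(l) <= 2 alpha theta(l)^(2/q)]; in [L^2] and after
      normalization this is a perturbation of size [theta(l)^(1/2)], summable
      in [l].
    - Quantizing finitely many innovations and averaging the indicators over the
      rest transports the sum to a finite product space without increasing
      these perturbations.
    - On the product space, truncating the dependence at lag [m] costs the tail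
      of the perturbation series in [L^2], and an [m]-dependent sum [S] has
      [C(t) = E cos(t S + b)] satisfying [C' = - t Var(S) C] up to an error at
      most [20 m^2 eta V] on [[0, 1]], where [eta] bounds the summands and [V]
      is the sum of their variances; hence [C(1)] is close to the Gaussian
      value. The condition on [max |z|] makes [eta] tend to zero.
    - The normalization [n^-1 sum z z^T = I] turns the variance bound into a
      bound on the quadratic form of [Gam]. With eigenvalues bounded below,
      [u = Gam^(-1/2) t] stays bounded and [Var(u . T_n) = |t|^2]; convergence
      of [E cos(t . X + b)] for all [t], [b] gives convergence in law. *)

Set Implicit Arguments. Unset Strict Implicit. Unset Printing Implicit Defensive.
Local Open Scope ring_scope.

(** * Finite product spaces and truncation *)

(** The functions [G k n] vary with [n] and depend on infinitely many innovations, so no limiting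
    process is available and every estimate is made at fixed [n]. The final error bound contains
    neither the number of quantization cells nor, except through partial sums of the perturbation
    series, the number [M] of innovations kept. At fixed [n] the approximation can thus be refined
    without cost; since the sum is bounded there, closeness of the events in probability transfers
    both the variance and the cosine moments. Only afterwards is [m] chosen from the tail of the
    series, and [eta] from [m]. The two levels share their innovations: one finite partition
    quantizes both, and scalar linear forms carry their joint law. The factor [alpha] in the
    switching probability cancels against the normalization [alpha (1 - alpha)], so levels tending
    to zero do not spoil the bounds. Cosines with a phase [b] stand in for characteristic functions
    and keep all integrands real. *)

Section FiniteExpectation.
Context {R : rcfType} {W : finType}.
Variable pi : W -> R.
Implicit Types F G : W -> R.

Definition fexp F : R := \sum_x pi x * F x.

Lemma eq_fexp F G : F =1 G -> fexp F = fexp G.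
Proof. by move=> FG; apply: eq_bigr => x _; rewrite FG. Qed.

Lemma fexpD F G : fexp (fun x => F x + G x) = fexp F + fexp G.
Proof. by rewrite -big_split; apply: eq_bigr => x _; rewrite mulrDr. Qed.

Lemma fexpZ c F : fexp (fun x => c * F x) = c * fexp F.
Proof. by rewrite mulr_sumr; apply: eq_bigr => x _; rewrite mulrCA. Qed.

Lemma fexpB F G : fexp (fun x => F x - G x) = fexp F - fexp G.
Proof. by rewrite -sumrB; apply: eq_bigr => x _; rewrite mulrBr. Qed.

Lemma fexp_sum (I : Type) (r : seq I) (P : pred I) (F : I -> W -> R) :
  fexp (fun x => \sum_(i <- r | P i) F i x) = \sum_(i <- r | P i) fexp (F i).
Proof. by rewrite exchange_big; apply: eq_bigr => x _; rewrite mulr_sumr. Qed.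

Hypothesis pi_ge0 : forall x, 0 <= pi x.

Lemma ler_fexp F G : (forall x, F x <= G x) -> fexp F <= fexp G.
Proof. by move=> FG; apply: ler_sum => x _; apply: ler_wpM2l. Qed.

Lemma fexp_ge0 F : (forall x, 0 <= F x) -> 0 <= fexp F.
Proof. by move=> F0; apply: sumr_ge0 => x _; apply: mulr_ge0. Qed.

Lemma norm_fexp F : `|fexp F| <= fexp (fun x => `|F x|).
Proof.
apply: le_trans (ler_norm_sum _ _ _) _; apply: ler_sum => x _.
by rewrite normrM ger0_norm.
Qed.

(** Lagrange's identity: the defect is half the weighted sum of the squared 2 x 2 minors of the pair
    [F], [G]. The total mass is left free, so unit weights give the Euclidean inequality
    [tdot_CS]. *)
Lemma fexp_CS F G :
  fexp (fun x => F x * G x) ^+ 2 <= fexp (fun x => F x ^+ 2) * fexp (fun x => G x ^+ 2).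
Proof.
rewrite -subr_ge0.
suff -> : fexp (fun x => F x ^+ 2) * fexp (fun x => G x ^+ 2)
    - fexp (fun x => F x * G x) ^+ 2
  = 2^-1 * (\sum_x \sum_y pi x * pi y * (F x * G y - F y * G x) ^+ 2).
  rewrite mulr_ge0 ?invr_ge0 ?ler0n//; apply: sumr_ge0 => x _; apply: sumr_ge0 => y _.
  by rewrite mulr_ge0 ?sqr_ge0// mulr_ge0.
apply: (mulfI (_ : 2 != 0 :> R)); first by rewrite pnatr_eq0.
rewrite mulVKf ?pnatr_eq0// mulrBr mulr_natl mulr2n {2}[_ * fexp _]mulrC.
rewrite /fexp expr2 !big_distrlr/= mulr_sumr -big_split -sumrB/=.
apply: eq_bigr => x _; rewrite mulr_sumr -big_split -sumrB/=.
by apply: eq_bigr => y _; ring.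
Qed.

Definition fnrm F : R := Num.sqrt (fexp (fun x => F x ^+ 2)).

Lemma fnrm_ge0 F : 0 <= fnrm F. Proof. exact: sqrtr_ge0. Qed.

Lemma fnrm_sqr F : fnrm F ^+ 2 = fexp (fun x => F x ^+ 2).
Proof. by rewrite sqr_sqrtr// fexp_ge0// => x; rewrite sqr_ge0. Qed.

Lemma eq_fnrm F G : F =1 G -> fnrm F = fnrm G.
Proof. by move=> FG; congr Num.sqrt; apply: eq_fexp => x; rewrite FG. Qed.

Lemma fexp_CSn F G : `|fexp (fun x => F x * G x)| <= fnrm F * fnrm G.
Proof.
rewrite -(@ler_pXn2r _ 2)// ?nnegrE ?mulr_ge0 ?fnrm_ge0//.
by rewrite real_normK ?num_real// exprMn !fnrm_sqr fexp_CS.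
Qed.

Lemma fnrmD F G : fnrm (fun x => F x + G x) <= fnrm F + fnrm G.
Proof.
rewrite -(@ler_pXn2r _ 2)// ?nnegrE ?addr_ge0 ?fnrm_ge0//.
rewrite fnrm_sqr sqrrD !fnrm_sqr.
rewrite (@eq_fexp _ (fun x => F x ^+ 2 + (2 * (F x * G x) + G x ^+ 2))); last first.
  by move=> x; ring.
rewrite fexpD fexpD fexpZ addrA lerD2r lerD2l -[leRHS]mulr_natl ler_pM2l ?ltr0n//.
by apply: le_trans (fexp_CSn F G); rewrite ler_norm.
Qed.

Lemma fnrm_sum (I : Type) (r : seq I) (P : pred I) (F : I -> W -> R) :
  fnrm (fun x => \sum_(i <- r | P i) F i x) <= \sum_(i <- r | P i) fnrm (F i).
Proof.
elim: r => [|i r IH].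
  rewrite big_nil (@eq_fnrm _ (fun=> 0)); last by move=> x; rewrite big_nil.
  rewrite /fnrm /fexp big1 ?sqrtr0// => x _; by rewrite expr0n/= mulr0.
rewrite big_cons; case: ifP => Pi.
  rewrite (@eq_fnrm _ (fun x => F i x + \sum_(i <- r | P i) F i x)); last first.
    by move=> x; rewrite big_cons Pi.
  by apply: le_trans (fnrmD _ _) _; rewrite lerD2l.
by rewrite (@eq_fnrm _ (fun x => \sum_(i <- r | P i) F i x))// => x; rewrite big_cons Pi.
Qed.

Hypothesis pi1 : \sum_x pi x = 1.

Lemma fexp_cst c : fexp (fun=> c) = c.
Proof. by rewrite /fexp -mulr_suml pi1 mul1r. Qed.

Lemma fexp_sqr_le F : fexp F ^+ 2 <= fexp (fun x => F x ^+ 2).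
Proof.
have := fexp_CS F (fun=> 1).
rewrite (@eq_fexp (fun=> 1 ^+ 2) (fun=> 1)); last by move=> x; rewrite expr1n.
rewrite fexp_cst mulr1; congr (_ ^+ 2 <= _).
by apply: eq_fexp => x; rewrite mulr1.
Qed.

Lemma fexp_norm_le_fnrm F : fexp (fun x => `|F x|) <= fnrm F.
Proof.
rewrite -(@ler_pXn2r _ 2)// ?nnegrE ?fnrm_ge0 ?fexp_ge0// fnrm_sqr.
apply: le_trans (fexp_sqr_le _) _; apply: ler_fexp => x.
by rewrite real_normK ?num_real.
Qed.

End FiniteExpectation.

(** * Resampling coordinates of a product measure *)

Section ProductSpace.
Context {R : rcfType} {I Q : finType}.
Variables (mu : Q -> R).
Local Notation T := {ffun I -> Q}.
Implicit Types (F G : T -> R) (w : T) (J K : {set I}).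

Definition pweight w : R := \prod_r mu (w r).

Definition merge J w' w : T := [ffun r => if r \in J then w' r else w r].

(* Conditional expectation of [F] given the coordinates outside [J]. *)
Definition avg J F w : R := fexp pweight (fun w' => F (merge J w' w)).

(** Measurability with respect to the coordinates outside [J], as a pointwise invariance rather than
    an almost sure one. *)
Definition indep_of J F := forall w w', F (merge J w' w) = F w.

Lemma eq_avg J F G : F =1 G -> avg J F =1 avg J G.
Proof. by move=> FG w; apply: eq_fexp => w'; rewrite FG. Qed.

Lemma pweight_merge J w w' :
  pweight (merge J w' w) * pweight (merge J w w') = pweight w * pweight w'.
Proof.
rewrite /pweight -!big_split/=; apply: eq_bigr => r _; rewrite !ffunE.
by case: ifP => // _; rewrite mulrC.
Qed.

Lemma mergeK J w w' : merge J (merge J w w') (merge J w' w) = w.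
Proof. by apply/ffunP => r; rewrite !ffunE; case: (r \in J). Qed.

(** Exchanging the coordinates in [J] between two independent copies is an involution of pairs that
    preserves the product weight. *)
Lemma fexp_swap J (H : T -> T -> R) :
  fexp pweight (fun w => fexp pweight (fun w' => H (merge J w' w) (merge J w w')))
  = fexp pweight (fun w => fexp pweight (fun w' => H w w')).
Proof.
have E (V : T -> T -> R) : fexp pweight (fun w => fexp pweight (fun w' => V w w'))
   = \sum_(u : T * T) pweight u.1 * pweight u.2 * V u.1 u.2.
  rewrite -(pair_bigA _ (fun w w' => pweight w * pweight w' * V w w')) /=.
  by apply: eq_bigr => w _; rewrite mulr_sumr; apply: eq_bigr => w' _; rewrite mulrA.
rewrite !E [in RHS](reindex_inj (h := fun u : T * T => (merge J u.2 u.1, merge J u.1 u.2))) /=.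
  by apply: eq_bigr => -[w w'] _ /=; rewrite pweight_merge.
move=> [w1 w1'] [w2 w2'] /= [e1 e2].
rewrite -(mergeK J w1 w1') -(mergeK J w2 w2') e1 e2; congr (_, _).
by rewrite -(mergeK J w1' w1) -(mergeK J w2' w2) e1 e2.
Qed.

Lemma indep_avg J F : indep_of J (avg J F).
Proof.
move=> w w'; apply: eq_fexp => w1; congr F; apply/ffunP => r.
by rewrite !ffunE; case: (r \in J).
Qed.

Lemma indep_avgW J K F : indep_of K F -> indep_of K (avg J F).
Proof.
move=> iF w w1; apply: eq_fexp => w'.
rewrite -(iF (merge J w' w) (merge J w' w1)); congr F; apply/ffunP => r.
by rewrite !ffunE; case: (r \in J); case: (r \in K).
Qed.

Lemma indep_sub J K F : K \subset J -> indep_of J F -> indep_of K F.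
Proof.
move=> KJ iF w w'; rewrite -[RHS](iF w (merge K w' w)); congr F; apply/ffunP => r.
rewrite !ffunE; case: ifP => [rK|rK]; first by rewrite (fintype.subsetP KJ).
by case: ifP.
Qed.

Lemma avg_mull J F G w : indep_of J G ->
  avg J (fun w => G w * F w) w = G w * avg J F w.
Proof. by move=> iG; rewrite /avg -fexpZ; apply: eq_fexp => w'; rewrite iG. Qed.

Lemma avgB J F G w : avg J (fun w => F w - G w) w = avg J F w - avg J G w.
Proof. exact: fexpB. Qed.

Hypothesis mu_ge0 : forall q, 0 <= mu q.
Hypothesis mu1 : \sum_q mu q = 1.

Lemma pweight_ge0 w : 0 <= pweight w.
Proof. by apply: prodr_ge0. Qed.

Lemma pweight_sum1 : \sum_w pweight w = 1.
Proof. by rewrite -(bigA_distr_bigA (fun _ : I => mu)) big1. Qed.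

Lemma fexp_avg J F : fexp pweight (avg J F) = fexp pweight F.
Proof.
rewrite /avg (fexp_swap J (fun w w' => F w)).
by apply: eq_fexp => w; rewrite fexp_cst// pweight_sum1.
Qed.

(** Tower property of a product measure: averages over different sets of coordinates commute and
    merge into one. It is what makes the increments of nested truncations martingale differences. *)
Lemma avgU J K F : avg J (avg K F) =1 avg (J :|: K) F.
Proof.
move=> w; rewrite /avg -(fexp_avg K (fun w' => F (merge (J :|: K) w' w))).
apply: eq_fexp => w'; apply: eq_fexp => w''; congr F; apply/ffunP => r.
by rewrite !ffunE inE; case: (r \in J); case: (r \in K).
Qed.

Lemma avg_id J F : indep_of J F -> avg J F =1 F.
Proof.
move=> iF w; rewrite /avg (eq_fexp _ (G := fun=> F w)); last by move=> w'; rewrite iF.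
by rewrite fexp_cst// pweight_sum1.
Qed.

Lemma avg_all J F : indep_of (~: J) F -> avg J F =1 (fun=> fexp pweight F).
Proof.
move=> iF w; apply: eq_fexp => w'; rewrite -(iF w' w); congr F; apply/ffunP => r.
by rewrite !ffunE inE; case: (r \in J).
Qed.

Lemma indep_fexpM J F G : indep_of (~: J) F -> indep_of J G ->
  fexp pweight (fun w => F w * G w) = fexp pweight F * fexp pweight G.
Proof.
move=> iF iG; rewrite -(fexp_avg J) -fexpZ; apply: eq_fexp => w.
rewrite (eq_avg J (G := fun w => G w * F w)) => [|u]; last by rewrite mulrC.
by rewrite avg_mull// (avg_all iF) mulrC.
Qed.

Lemma fnrm_avg J F : fnrm pweight (avg J F) <= fnrm pweight F.
Proof.
rewrite ler_wsqrtr// -(fexp_avg J (fun w => F w ^+ 2)).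
apply: ler_fexp => [|w]; first exact: pweight_ge0.
by apply: fexp_sqr_le; [exact: pweight_ge0|exact: pweight_sum1].
Qed.

Lemma avg_norm_le J F c w : (forall w, `|F w| <= c) -> `|avg J F w| <= c.
Proof.
move=> Fc; apply: le_trans (norm_fexp pweight_ge0 _) _.
rewrite -[leRHS](fexp_cst pweight_sum1).
by apply: ler_fexp => // w'; exact: pweight_ge0.
Qed.

(** Jensen in the resampled copy. The right-hand side is the mean square effect of replacing
    innovations, the form in which stability supplies its bounds. *)
Lemma fnrm_sub_avg J F : fnrm pweight (fun w => F w - avg J F w) ^+ 2 <=
  fexp pweight (fun w => fexp pweight (fun w' => (F w - F (merge J w' w)) ^+ 2)).
Proof.
rewrite fnrm_sqr; last exact: pweight_ge0.
apply: ler_fexp => [|w]; first exact: pweight_ge0.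
rewrite -{1}(fexp_cst pweight_sum1 (F w)) -fexpB.
by apply: fexp_sqr_le; [exact: pweight_ge0|exact: pweight_sum1].
Qed.

End ProductSpace.

(** * Truncation of the memory by martingale differences *)

Section Truncation.
Context {R : rcfType} {Q : finType}.
Variables (mu : Q -> R) (n M : nat).
Hypothesis mu_ge0 : forall q, 0 <= mu q.
Hypothesis mu1 : \sum_q mu q = 1.
Local Notation T := {ffun 'I_(n + M) -> Q}.
Local Notation Ex := (fexp (pweight (I := 'I_(n + M)) mu)).
Local Notation nrm := (fnrm (pweight (I := 'I_(n + M)) mu)).

Definition low (t : nat) : {set 'I_(n + M)} := [set r : 'I_(n + M) | (r < t)%N].

Lemma low_subset s t : (s <= t)%N -> low s \subset low t.
Proof. by move=> st; apply/fintype.subsetP => r; rewrite !inE => /leq_trans; apply. Qed.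

Variable Y : 'I_n -> T -> R.
Hypothesis Ylow : forall i : 'I_n, indep_of (low i) (Y i).
Hypothesis Yhigh : forall i : 'I_n, indep_of (~: low (i + M)) (Y i).

(* [Y i] lives on the coordinates [i, ..., i + M - 1], the most recent ones having
   the largest index; [trunc m i] keeps only the [m] most recent ones. *)
Definition trunc m (i : 'I_n) : T -> R := avg mu (low (i + (M - m))) (Y i).

Lemma trunc_low m (i : 'I_n) : indep_of (low (i + (M - m))) (trunc m i).
Proof. exact: indep_avg. Qed.

Lemma trunc_high m (i : 'I_n) : indep_of (~: low (i + M)) (trunc m i).
Proof. exact: indep_avgW. Qed.

(** For [l < M], the gain from remembering [l + 1] rather than [l] innovations: a martingale
    difference in the single coordinate [i + (M - (l + 1))]. *)
Let D (i : 'I_n) l w := avg mu (low (i + (M - l.+1))) (Y i) w - avg mu (low (i + (M - l))) (Y i) w.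

Lemma sub_trunc m i w : Y i w - trunc m i w = \sum_(m <= l < M) D i l w.
Proof.
have [mM|Mm] := leqP m M; last first.
  rewrite big_geq ?(ltnW Mm)// /trunc (eqP (ltnW Mm)) addn0.
  by rewrite avg_id ?subrr.
rewrite /D (telescope_sumr (fun l => avg mu (low (i + (M - l))) (Y i) w))//.
by rewrite subnn addn0 avg_id.
Qed.

Variables (b : 'I_n -> R) (delta : nat -> R).
Hypothesis b_ge0 : forall i, 0 <= b i.
Hypothesis delta_ge0 : forall l, 0 <= delta l.
Hypothesis dep : forall (i : 'I_n) l (r : 'I_(n + M)), (l < M)%N ->
  r = (i + (M - l.+1))%N :> nat ->
  Ex (fun w => Ex (fun w' => (Y i w - Y i (merge [set r] w' w)) ^+ 2)) <= (b i * delta l) ^+ 2.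

Let lowS (r : 'I_(n + M)) : low r.+1 = low r :|: [set r].
Proof. by apply/setP => s; rewrite !inE ltnS leq_eqVlt orbC. Qed.

Let rank (i : 'I_n) l (lM : (l < M)%N) : (i + (M - l.+1) < n + M)%N.
Proof. have := ltn_ord i; lia. Qed.

Let DE (i : 'I_n) l (lM : (l < M)%N) w : D i l w =
  avg mu (low (Ordinal (rank i lM))) (fun w => Y i w - avg mu [set Ordinal (rank i lM)] (Y i) w) w.
Proof.
rewrite /D (_ : i + (M - l) = (Ordinal (rank i lM)).+1)%N; last by rewrite /=; lia.
by rewrite avgB lowS -avgU.
Qed.

Let nrmD i l : (l < M)%N -> nrm (D i l) <= b i * delta l.
Proof.
move=> lM; rewrite (eq_fnrm _ (DE i lM)).
apply: le_trans (fnrm_avg _ _ _ _) _ => //.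
rewrite -(@ler_pXn2r _ 2)// ?nnegrE ?fnrm_ge0 ?mulr_ge0//.
apply: le_trans (fnrm_sub_avg _ _ _ _) _ => //.
exact: dep.
Qed.

Let D_indep (i : 'I_n) l : indep_of (low (i + (M - l.+1))) (D i l).
Proof.
move=> w w'; congr (_ - _); first exact: indep_avg.
apply: (@indep_sub _ _ _ (low (i + (M - l)))); last exact: indep_avg.
by apply: low_subset; lia.
Qed.

(** Averaging over the coordinate [r] that [D i l] has just revealed annihilates it, while [D j l]
    is unaffected because at equal lag it sees only coordinates strictly above [r]. *)
Let D_ortho (i j : 'I_n) l : (l < M)%N -> (i < j)%N -> Ex (fun w => D i l w * D j l w) = 0.
Proof.
move=> lM ij; pose r := Ordinal (rank i lM).
rewrite -(fexp_avg mu1 [set r]) /fexp big1// => w _.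
rewrite (eq_avg mu _ (G := fun w => D j l w * D i l w)) => [|u]; last by rewrite mulrC.
rewrite avg_mull; last first.
  by apply: indep_sub (@D_indep j l); rewrite finset.sub1set inE /=; lia.
suff -> : avg mu [set r] (D i l) w = 0 by rewrite !mulr0.
rewrite /D avgB !avgU// (_ : i + (M - l) = r.+1)%N; last by rewrite /=; lia.
by rewrite lowS finset.setUCA finset.setUid finset.setUC subrr.
Qed.

Let nrm_sumD l : (l < M)%N ->
  nrm (fun w => \sum_i D i l w) <= Num.sqrt (\sum_i b i ^+ 2) * delta l.
Proof.
move=> lM; rewrite -(@ler_pXn2r _ 2)// ?nnegrE ?fnrm_ge0 ?mulr_ge0 ?sqrtr_ge0//.
rewrite exprMn [X in _ <= X * _]sqr_sqrtr; last by apply: sumr_ge0 => i _; exact: sqr_ge0.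
rewrite fnrm_sqr; last exact: pweight_ge0.
rewrite (eq_fexp _ (G := fun w => \sum_i \sum_j D i l w * D j l w)); last first.
  by move=> w; rewrite expr2 big_distrlr.
rewrite fexp_sum mulr_suml; apply: ler_sum => i _.
rewrite fexp_sum (bigD1 i)//= big1 ?addr0 => [|j ji].
  rewrite (eq_fexp _ (G := fun w => D i l w ^+ 2)) => [|w]; last by rewrite expr2.
  rewrite -fnrm_sqr; last exact: pweight_ge0.
  by rewrite -exprMn ler_pXn2r// ?nnegrE ?fnrm_ge0 ?mulr_ge0// nrmD.
have [ij|ij] := ltnP i j; first exact: D_ortho.
rewrite (eq_fexp _ (G := fun w => D j l w * D i l w)) => [|w]; last by rewrite mulrC.
by apply: D_ortho => //; rewrite ltn_neqAle ij andbT; apply: contra ji => /eqP/val_inj ->.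
Qed.

(* For fixed [l] the martingale differences [D i l] are orthogonal in [i], hence the
   [l^2] norm of [b] rather than its [l^1] norm. *)
Lemma fnrm_sub_trunc m :
  nrm (fun w => \sum_i Y i w - \sum_i trunc m i w) <=
  Num.sqrt (\sum_i b i ^+ 2) * \sum_(m <= l < M) delta l.
Proof.
rewrite (eq_fnrm _ (G := fun w => \sum_(m <= l < M) \sum_i D i l w)); last first.
  by move=> w; rewrite -sumrB exchange_big; apply: eq_bigr => i _; exact: sub_trunc.
apply: le_trans (fnrm_sum _ _ _ _) _; first exact: pweight_ge0.
rewrite mulr_sumr big_nat_cond [leRHS]big_nat_cond; apply: ler_sum => l.
by rewrite andbT => /andP[_ lM]; exact: nrm_sumD.
Qed.

Hypothesis Y0 : forall i, Ex (Y i) = 0.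

Lemma trunc0 i w : trunc 0 i w = 0.
Proof. by rewrite /trunc subn0 avg_all ?Y0. Qed.

Lemma fexp_trunc m i : Ex (trunc m i) = 0.
Proof. by rewrite /trunc fexp_avg. Qed.

(** The truncation bound at [m = 0]: without memory, [trunc] is the mean, which vanishes. *)
Lemma fnrm_sumY : nrm (fun w => \sum_i Y i w) <=
  Num.sqrt (\sum_i b i ^+ 2) * \sum_(l < M) delta l.
Proof.
have := fnrm_sub_trunc 0; rewrite big_mkord; congr (_ <= _); apply: eq_fnrm => w.
by rewrite [X in _ - X]big1 ?subr0// => i _; exact: trunc0.
Qed.

Lemma fnrm_trunc m i : nrm (trunc m i) <= b i * \sum_(l < M) delta l.
Proof.
apply: le_trans (fnrm_avg _ _ _ _) _ => //.
rewrite (eq_fnrm _ (G := fun w => \sum_(0 <= l < M) D i l w)); last first.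
  by move=> w; rewrite -sub_trunc trunc0 subr0.
apply: le_trans (fnrm_sum _ _ _ _) _; first exact: pweight_ge0.
rewrite big_mkord mulr_sumr; apply: ler_sum => l _; exact: nrmD.
Qed.

End Truncation.

(** * A quantitative central limit theorem for m-dependent sums *)

Section Calculus.
Context {R : realType}.
Implicit Types (f df : R -> R) (x y h : R).

Lemma derive_lipschitz f df (K a b : R) :
  (forall x, is_derive x 1 f (df x)) ->
  (forall x, Num.min a b <= x <= Num.max a b -> `|df x| <= K) ->
  `|f b - f a| <= K * `|b - a|.
Proof.
move=> fd dfK.
have cf (c d : R) : {within `[c, d], continuous f}%classic.
  by apply: derivable_within_continuous => x _; have [] := fd x.
have [ab|ba] := leP a b.
  have [c] := MVT_segment ab (fun x _ => fd x) (cf _ _).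
  rewrite in_itv/= => cab ->; rewrite normrM ler_wpM2r// dfK//.
  by rewrite (min_idPl ab) (max_idPr ab).
have [c] := MVT_segment (ltW ba) (fun x _ => fd x) (cf _ _).
rewrite in_itv/= => cab; rewrite -normrN opprB [`|b - a|]distrC => ->.
rewrite normrM ler_wpM2r// dfK//.
by rewrite (min_idPr (ltW ba)) (max_idPl (ltW ba)).
Qed.

Lemma is_derive_cos_affine (s b t : R) :
  is_derive t 1 (fun t => cos (t * s + b)) (- s * sin (t * s + b)).
Proof.
have d1 : is_derive t 1 (fun t : R => t * s + b) s.
  have d0 : is_derive t 1 (fun t : R => t * s) s.
    have := @is_deriveM _ _ id (cst s) t 1 1 0 (is_derive_id _ _) (is_derive_cst _ _ _).
    by rewrite scaler0 add0r [s *: 1]mulr1.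
  have := is_deriveD d0 (is_derive_cst b t 1).
  by rewrite addr0.
have := @is_derive1_comp _ cos (fun t : R => t * s + b) t _ _ (is_derive_cos _) d1.
by rewrite mulrC mulrN mulNr.
Qed.

Lemma cos_lipschitz x y : `|cos x - cos y| <= `|x - y|.
Proof.
rewrite -[leRHS]mul1r; apply: (@derive_lipschitz cos (fun x => - sin x)).
by move=> z _; rewrite normrN sin_max.
Qed.

(** The mean value theorem for [g s = sin (y - s) + s cos y], whose derivative [cos y - cos (y - s)]
    is at most [|s|] in absolute value. This yields the constant 1 instead of the sharp 1/2. *)
Lemma sin_taylor y h : `|sin (y - h) - sin y + h * cos y| <= h ^+ 2.
Proof.
pose g (s : R) := sin (y - s) + s * cos y.
have dg (s : R) : is_derive s 1 g (- cos (y - s) + cos y).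
  apply: is_deriveD.
    have d1 : is_derive s 1 (fun s : R => y - s) (- 1).
      have := @is_deriveB _ _ _ (cst y) id s 1 0 1 (is_derive_cst _ _ _) (is_derive_id _ _).
      by rewrite add0r.
    have := @is_derive1_comp _ sin (fun s : R => y - s) s _ _ (is_derive_sin _) d1.
    by rewrite mulrN1.
  have := @is_deriveM _ _ id (cst (cos y)) s 1 1 0 (is_derive_id _ _) (is_derive_cst _ _ _).
  by rewrite scaler0 add0r [cos y *: 1]mulr1.
have -> : sin (y - h) - sin y + h * cos y = g h - g 0.
  by rewrite /g subr0 mul0r addr0 addrAC.
rewrite -[leRHS]real_normK ?num_real// expr2 -[X in _ * `|X|]subr0.
apply: (@derive_lipschitz g _ _ _ _ dg) => z hz.
rewrite addrC; apply: le_trans (cos_lipschitz _ _) _.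
rewrite opprB addrC subrK.
have [h0|h0] := leP 0 h.
  by move: hz; rewrite (min_idPl h0) (max_idPr h0) => /andP[z0 zh]; rewrite !ger0_norm.
move: hz; rewrite (min_idPr (ltW h0)) (max_idPl (ltW h0)) => /andP[hz z0].
by rewrite !ler0_norm ?(ltW h0)// lerN2.
Qed.

Lemma is_derive_sum_seq (I : Type) (r : seq I) (F dF : I -> R -> R) (t : R) :
  (forall i, is_derive t 1 (F i) (dF i t)) ->
  is_derive t 1 (fun t => \sum_(i <- r) F i t) (\sum_(i <- r) dF i t).
Proof.
move=> dFi; elim: r => [|i r IH].
  rewrite big_nil (_ : (fun _ => _) = cst 0); first exact: is_derive_cst.
  by apply/funext => x; rewrite big_nil.
rewrite big_cons (_ : (fun _ => _) = (F i + fun t => \sum_(i <- r) F i t)).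
  exact: is_deriveD.
by apply/funext => x; rewrite big_cons.
Qed.

End Calculus.

(** * A differential inequality for the cosine transform *)

Section CharacteristicODE.
Context {R : realType} {W : finType}.
Variable pi : W -> R.
Hypothesis pi_ge0 : forall x, 0 <= pi x.
Hypothesis pi1 : \sum_x pi x = 1.
Local Notation Ex := (fexp pi).

(* [C t = Ex (cos (t S + b))] nearly solves [C' = - t s2 C]: bound the derivative of
   [C t * exp (s2 t^2 / 2)]. *)
Lemma cos_ode_bound (S : W -> R) (s2 K b : R) :
  0 <= s2 ->
  (forall t : R, 0 <= t <= 1 ->
    `|Ex (fun x => S x * sin (t * S x + b)) - t * s2 * Ex (fun x => cos (t * S x + b))|
      <= K) ->
  `|Ex (fun x => cos (S x + b)) - cos b * expR (- (s2 / 2))| <= K.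
Proof.
move=> s20 hK.
pose C (t : R) := Ex (fun x => cos (t * S x + b)).
pose dC (t : R) := - Ex (fun x => S x * sin (t * S x + b)).
have dCP (t : R) : is_derive t 1 C (dC t).
  rewrite /C /dC /fexp -sumrN.
  apply: (@is_derive_sum_seq _ _ _ (fun x t => pi x * cos (t * S x + b))
    (fun x t => - (pi x * (S x * sin (t * S x + b))))) => x.
  have := @is_deriveM _ _ (cst (pi x)) (fun t : R => cos (t * S x + b)) t 1 _ _ (is_derive_cst _ _ _) (is_derive_cos_affine _ _ _).
  by rewrite scaler0 addr0 mulNr /= scalerN.
pose e (t : R) := expR (s2 / 2 * t ^+ 2).
have de (t : R) : is_derive t 1 e (s2 * t * e t).
  have d1 : is_derive t 1 (fun t : R => s2 / 2 * t ^+ 2) (s2 * t).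
    have dX := is_deriveX 2 (is_derive_id t (1 : R)).
    have := is_deriveM (is_derive_cst (s2 / 2) t 1) dX.
    have E : (s2 / 2) *: (2%:R * t ^+ 1)%:A = s2 * t.
      by rewrite -[LHS]/(s2 / 2 * (2%:R * t ^+ 1 * 1)); field.
    by rewrite scaler0 addr0 /= E.
  have := @is_derive1_comp _ expR (fun t : R => s2 / 2 * t ^+ 2) t _ _ (is_derive_expR _) d1.
  by rewrite [expR _ * _]mulrC.
have e1 : e 1 = expR (s2 / 2) by rewrite /e expr1n mulr1.
(* The integrating factor never exceeds [e 1] on the unit interval, and the conclusion divides by
   that same [e 1]; hence [K] returns without an exponential constant. *)
have /(@derive_lipschitz _ _ _ (K * e 1) 0 1) : forall t : R,
    is_derive t 1 (C * e) (C t * (s2 * t * e t) + e t * dC t).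
  by move=> t; exact: is_deriveM.
have e0 : e 0 = 1 by rewrite /e expr0n/= mulr0 expR0.
have C0 : C 0 = cos b.
  rewrite /C (eq_fexp _ (G := fun=> cos b)) ?fexp_cst// => x.
  by rewrite mul0r add0r.
rewrite (min_idPl ler01) (max_idPr ler01) => /(_ _)/wrap[].
  move=> t /[dup] t01 /andP[t0 t1].
  rewrite (_ : _ + _ = - (Ex (fun x => S x * sin (t * S x + b)) - t * s2 * C t) * e t); last first.
    by rewrite /dC; ring.
  rewrite normrM normrN ler_pM// ?hK// ger0_norm ?expR_ge0//.
  by rewrite ler_expR ler_wpM2l ?divr_ge0// expr1n expr_le1.
rewrite subr0 normr1 mulr1 -[(C * e) 1]/(C 1 * e 1) -[(C * e) 0]/(C 0 * e 0).
rewrite e0 C0 e1 mulr1 expRN => h.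
rewrite -(ler_pM2r (expR_gt0 (s2 / 2))) -[X in _ * X <= _](ger0_norm (expR_ge0 _)) -normrM.
rewrite mulrBl mulfVK ?gt_eqF ?expR_gt0// mulrC.
move: h; rewrite (_ : C 1 = Ex (fun x => cos (S x + b))) 1?mulrC//.
by apply: eq_fexp => x; rewrite mul1r.
Qed.

End CharacteristicODE.

(** * Local decomposition of an m-dependent sum *)

Section MDependent.
Context {R : realType} {Q : finType}.
Variables (mu : Q -> R) (n M m : nat).
Hypothesis mu_ge0 : forall q, 0 <= mu q.
Hypothesis mu1 : \sum_q mu q = 1.
Local Notation T := {ffun 'I_(n + M) -> Q}.
Local Notation Ex := (fexp (pweight (I := 'I_(n + M)) mu)).
Local Notation low := (@low n M).

Variables (Z : 'I_n -> T -> R) (eta : R).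
Hypothesis Zlow : forall i : 'I_n, indep_of (low (i + (M - m))) (Z i).
Hypothesis Zhigh : forall i : 'I_n, indep_of (~: low (i + M)) (Z i).
Hypothesis Z0 : forall i, Ex (Z i) = 0.
Hypothesis Zeta : forall i w, `|Z i w| <= eta.

Let S w := \sum_i Z i w.

Definition near_idx k (i j : 'I_n) : bool := (i < j + k)%N && (j < i + k)%N.

(** The split [S = S1 + T1] into far and near terms is used at two radii: at [m] the far part is
    independent of [Z i], at [2 m] it is independent of the product [Z i * T1 m i]. *)
Let T1 k i w := \sum_(j | near_idx k i j) Z j w.
Let S1 k i w := \sum_(j | ~~ near_idx k i j) Z j w.

Let S_split k i w : S w = S1 k i w + T1 k i w.
Proof. by rewrite /S (bigID (near_idx k i)) addrC. Qed.

Lemma card_near k i : (#|[pred j | near_idx k i j]| <= k.*2)%N.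
Proof.
rewrite cardE -(size_map val) -(size_iota (i.+1 - k) k.*2); apply: uniq_leq_size.
  by rewrite map_inj_uniq ?enum_uniq//; exact: val_inj.
move=> _ /mapP[j + ->]; rewrite mem_enum inE /near_idx mem_iota /=; lia.
Qed.

Let eta_ge0 (i : 'I_n) : 0 <= eta.
Proof.
have [w _|T0] := pickP (pred_of_simpl (@predT T)); first exact: le_trans (Zeta i w).
have := pweight_sum1 (I := 'I_(n + M)) mu1.
by rewrite big1 => [/esym/eqP|w _]; [rewrite oner_eq0|have := T0 w].
Qed.

Let T1_le k i w : `|T1 k i w| <= (k.*2)%:R * eta.
Proof.
apply: le_trans (ler_norm_sum _ _ _) _.
apply: le_trans (ler_sum _ (fun j _ => Zeta j w)) _.
rewrite sumr_const -[leLHS]mulr_natl ler_wpM2r ?eta_ge0// ler_nat.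
exact: card_near.
Qed.

(** The coordinates that the [Z j] at distance at most [k] from [i] can see. The truncated
    subtraction [i - k] is correct at the left edge because indices start at zero. *)
Let window k (i : 'I_n) := low (i + k + M) :\: low (i - k + (M - m)).

Let Z_window i : indep_of (~: window 0 i) (Z i).
Proof.
move=> w w'; rewrite -[LHS](Zlow _ _ w) -[LHS](Zhigh _ _ w); congr (Z i _).
apply/ffunP => r; rewrite !ffunE !inE addn0 subn0.
by case: (ltnP r (i + M)); case: (ltnP r (i + (M - m))).
Qed.

Let T1_window i : indep_of (~: window m i) (T1 m i).
Proof.
move=> w w'; apply: eq_bigr => j /andP[ij ji].
apply: (indep_sub _ (@Z_window j)); rewrite finset.setCS.
apply/fintype.subsetP => r; rewrite !inE; lia.
Qed.

Let S1_window k i : indep_of (window k i) (S1 (k + m) i).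
Proof.
move=> w w'; apply: eq_bigr => j; rewrite /near_idx negb_and -!leqNgt.
move=> h; apply: (indep_sub _ (@Z_window j)).
by apply/fintype.subsetP => r; rewrite !inE; move: h; lia.
Qed.

Let window_sub i : ~: window m i \subset ~: window 0 i.
Proof. by rewrite finset.setCS; apply/fintype.subsetP => r; rewrite !inE; lia. Qed.

Let V : R := \sum_i Ex (fun w => Z i w ^+ 2).

Let absZT i : R := Ex (fun w => `|Z i w * T1 m i w|).

(** From [2 |a b| <= a^2 + b^2]. By the symmetry of [near_idx], each variance appears at most [2 m]
    times, with weight one half, in either of the two resulting sums. *)
Let sum_absZT : \sum_i absZT i <= (m.*2)%:R * V.
Proof.
have h i : absZT i <= \sum_(j | near_idx m i j)
    (Ex (fun w => Z i w ^+ 2) + Ex (fun w => Z j w ^+ 2)) / 2.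
  under eq_bigr do rewrite -fexpD mulrC -fexpZ.
  rewrite -fexp_sum; apply: ler_fexp => [w|w]; first exact: pweight_ge0.
  rewrite mulr_sumr; apply: le_trans (ler_norm_sum _ _ _) _.
  apply: ler_sum => j _; rewrite -[Z i w ^+ 2]real_normK ?num_real//.
  rewrite -[Z j w ^+ 2]real_normK ?num_real// normrM.
  have := sqr_ge0 (`|Z i w| - `|Z j w|); nra.
apply: le_trans (ler_sum _ (fun i _ => h i)) _.
have half (F : 'I_n -> R) : (forall i, 0 <= F i) ->
    \sum_i \sum_(j | near_idx m i j) F i / 2 <= m%:R * \sum_i F i.
  move=> F0; rewrite mulr_sumr; apply: ler_sum => i _.
  rewrite sumr_const -[leLHS]mulr_natl mulrCA [leRHS]mulrC ler_wpM2l//.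
  rewrite ler_pdivrMr// -natrM ler_nat muln2; exact: card_near.
have Ex2_ge0 (i : 'I_n) : 0 <= Ex (fun w => Z i w ^+ 2).
  by apply: fexp_ge0 => w; [exact: pweight_ge0|exact: sqr_ge0].
rewrite -mul2n natrM -mulrA mulr_natl mulr2n.
under eq_bigr do under eq_bigr do rewrite mulrDl.
under eq_bigr do rewrite big_split.
rewrite big_split /=; apply: lerD; first exact: half.
rewrite (exchange_big_dep xpredT)//=; apply: le_trans (half _ Ex2_ge0).
rewrite le_eqVlt; apply/orP; left; apply/eqP; apply: eq_bigr => i _.
by apply: eq_bigl => j; rewrite /near_idx andbC.
Qed.

Let varS : Ex (fun w => S w ^+ 2) = \sum_i Ex (fun w => Z i w * T1 m i w).
Proof.
transitivity (Ex (fun w => \sum_i (Z i w * S1 m i w + Z i w * T1 m i w))).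
  apply: eq_fexp => w; rewrite expr2 {1}/S mulr_suml; apply: eq_bigr => i _.
  by rewrite (S_split m i) mulrDr.
rewrite fexp_sum; apply: eq_bigr => i _; rewrite fexpD.
by rewrite (indep_fexpM mu1 (@Z_window i) (@S1_window 0 i)) Z0 mul0r add0r.
Qed.

(** The zeroth-order term vanishes since [Z i] is centred and independent of the far part. The
    constant is [2 m + 8 m]: expanding the sine about [S] costs [|T1 m i| <= 2 m eta] ([E1]);
    detaching the cosine from [Z i * T1 m i] replaces [S] by the far part at radius [2 m] and then
    restores it, at [4 m eta] each time ([E3]). *)
Let step (t b : R) (i : 'I_n) : 0 <= t <= 1 ->
  `|Ex (fun w => Z i w * sin (t * S w + b)) -
    t * Ex (fun w => Z i w * T1 m i w) * Ex (fun w => cos (t * S w + b))|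
  <= (10 * m)%:R * eta * absZT i.
Proof.
move=> /andP[t0 t1]; have e0 := eta_ge0 i.
have pw0 := pweight_ge0 (I := 'I_(n + M)) mu_ge0.
have aZT0 : 0 <= absZT i by apply: fexp_ge0.
have indep1 : Ex (fun w => Z i w * sin (t * S1 m i w + b)) = 0.
  rewrite (indep_fexpM mu1 (@Z_window i) (G := fun w => sin (t * S1 m i w + b))).
    by rewrite Z0 mul0r.
  by move=> w w'; rewrite (@S1_window 0 i).
have indep2 : Ex (fun w => Z i w * T1 m i w * cos (t * S1 (m + m) i w + b)) =
    Ex (fun w => Z i w * T1 m i w) * Ex (fun w => cos (t * S1 (m + m) i w + b)).
  apply: (indep_fexpM mu1 (J := window m i)) => w w'; last by rewrite (@S1_window m i).
  by rewrite (indep_sub (@window_sub i) (@Z_window i)) (@T1_window i).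
have E1 : `|Ex (fun w => Z i w * sin (t * S w + b))
    - t * Ex (fun w => Z i w * T1 m i w * cos (t * S w + b))| <= (2 * m)%:R * eta * absZT i.
  rewrite -[X in X - _]subr0 -[X in _ - X - _]indep1 -fexpB -fexpZ -fexpB.
  apply: le_trans (norm_fexp pw0 _) _; rewrite -fexpZ; apply: ler_fexp => // w.
  rewrite (_ : _ - _ = - (Z i w * (sin ((t * S w + b) - t * T1 m i w) - sin (t * S w + b)
     + t * T1 m i w * cos (t * S w + b)))); last first.
    by rewrite (S_split m i w) (_ : _ - t * T1 m i w = t * S1 m i w + b); ring.
  rewrite normrN normrM.
  apply: le_trans (ler_wpM2l (normr_ge0 _) (sin_taylor _ _)) _.
  rewrite -[(_ * T1 _ _ _) ^+ 2]real_normK ?num_real// normrM exprMn.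
  rewrite [X in _ <= _ * X]normrM (ger0_norm t0) expr2.
  have := T1_le m i w; rewrite -mul2n => hT.
  rewrite [leRHS](_ : _ = `|Z i w| * (1 * (`|T1 m i w| * ((2 * m)%:R * eta)))); last by ring.
  rewrite ler_wpM2l// ler_pM ?mulr_ge0 ?sqr_ge0 ?mulr_ile1//.
  by rewrite expr2 ler_wpM2l.
have E2 w : `|cos (t * S w + b) - cos (t * S1 (m + m) i w + b)| <= (4 * m)%:R * eta.
  apply: le_trans (cos_lipschitz _ _) _.
  rewrite (S_split (m + m) i w) (_ : _ - _ = t * T1 (m + m) i w); last by ring.
  rewrite normrM (ger0_norm t0); apply: le_trans (ler_piMl (normr_ge0 _) t1) _.
  by have := T1_le (m + m) i w; rewrite addnn -!mul2n mulnA.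
have E3 : `|Ex (fun w => Z i w * T1 m i w * cos (t * S w + b))
    - Ex (fun w => Z i w * T1 m i w) * Ex (fun w => cos (t * S w + b))| <= (8 * m)%:R * eta * absZT i.
  rewrite (_ : _ - _ =
     (Ex (fun w => Z i w * T1 m i w * cos (t * S w + b)) -
      Ex (fun w => Z i w * T1 m i w * cos (t * S1 (m + m) i w + b)))
    + Ex (fun w => Z i w * T1 m i w) * (Ex (fun w => cos (t * S1 (m + m) i w + b))
     - Ex (fun w => cos (t * S w + b)))); last first.
    by rewrite indep2; ring.
  have -> : (8 * m)%:R * eta * absZT i = (4 * m)%:R * eta * absZT i + (4 * m)%:R * eta * absZT i.
    by rewrite -[(8 * m)%N]/((4 + 4) * m)%N mulnDl natrD; ring.
  apply: le_trans (ler_normD _ _) _; apply: lerD.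
    rewrite -fexpB -fexpZ; apply: le_trans (norm_fexp pw0 _) _; apply: ler_fexp => // w.
    by rewrite -mulrBr normrM mulrC ler_wpM2r.
  rewrite normrM mulrC -fexpB; apply: ler_pM => //; last exact: norm_fexp.
  apply: le_trans (norm_fexp pw0 _) _.
  rewrite -[leRHS](fexp_cst (pweight_sum1 (I := 'I_(n + M)) mu1)); apply: ler_fexp => // w.
  by rewrite distrC.
rewrite (_ : _ - _ = (Ex (fun w => Z i w * sin (t * S w + b))
    - t * Ex (fun w => Z i w * T1 m i w * cos (t * S w + b)))
   + t * (Ex (fun w => Z i w * T1 m i w * cos (t * S w + b))
    - Ex (fun w => Z i w * T1 m i w) * Ex (fun w => cos (t * S w + b)))); last by ring.
rewrite -[(10 * m)%N]/((2 + 8) * m)%N mulnDl natrD 2!mulrDl.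
apply: le_trans (ler_normD _ _) _; apply: lerD => //.
by rewrite normrM (ger0_norm t0); apply: le_trans (ler_piMl (normr_ge0 _) t1) _.
Qed.

(** Summing [step] over [i] reproduces the variance through [varS]; [20 m^2] is [10 m] from [step]
    times [2 m] from [sum_absZT]. *)
Lemma mdep_clt (b : R) :
  `|Ex (fun w => cos (S w + b)) - cos b * expR (- (Ex (fun w => S w ^+ 2) / 2))|
  <= (20 * m ^ 2)%:R * eta * V.
Proof.
have pw0 := pweight_ge0 (I := 'I_(n + M)) mu_ge0.
have pw1 := pweight_sum1 (I := 'I_(n + M)) mu1.
apply: (@cos_ode_bound _ _ _ pw1 S (Ex (fun w => S w ^+ 2))) => [|t t01].
  by apply: fexp_ge0 => // w; exact: sqr_ge0.
rewrite (eq_fexp _ (G := fun w => \sum_i Z i w * sin (t * S w + b))); last first.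
  by move=> w; rewrite -mulr_suml.
have distr (F : 'I_n -> R) (c : R) : t * (\sum_i F i) * c = \sum_i t * F i * c.
  by rewrite mulr_sumr mulr_suml.
rewrite fexp_sum varS distr -sumrB.
apply: le_trans (ler_norm_sum _ _ _) _.
apply: le_trans (ler_sum _ (fun i _ => step b i t01)) _.
rewrite -mulr_sumr.
(* The sign of [eta] is known only once some index exists; with none, [V] vanishes. *)
have [n0|[j]] : ('I_n -> False) \/ inhabited 'I_n.
  by case: (n) => [|n']; [left; case|right; constructor; exact: ord0].
  by rewrite /V !big1 ?mulr0// => i; have := n0 i.
apply: le_trans (ler_wpM2l _ sum_absZT) _; first by rewrite mulr_ge0 ?(eta_ge0 j).
rewrite le_eqVlt; apply/orP; left; apply/eqP.
by rewrite -mul2n !natrM; ring.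
Qed.

End MDependent.

Lemma expRN_lipschitz (R : realType) (x y : R) : 0 <= x -> 0 <= y ->
  `|expR (- x) - expR (- y)| <= `|x - y|.
Proof.
move=> x0 y0; rewrite -[leRHS]mul1r.
have d1 (z : R) : is_derive z 1 (fun z : R => expR (- z)) (- expR (- z)).
  have := @is_derive1_comp _ expR (fun z : R => - z) z _ _ (is_derive_expR _)
    (is_deriveN (is_derive_id z (1 : R))).
  by rewrite mulrN1.
apply: (@derive_lipschitz _ (fun z => expR (- z)) _ _ _ _ d1) => z /andP[zm _].
rewrite normrN ger0_norm ?expR_ge0// -[leRHS]expR0 ler_expR oppr_le0.
by apply: le_trans zm; rewrite le_min x0 y0.
Qed.

(** * From m-dependent to weakly dependent sums *)

Section WeaklyDependent.
Context {R : realType} {Q : finType}.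
Variables (mu : Q -> R) (n M : nat).
Hypothesis mu_ge0 : forall q, 0 <= mu q.
Hypothesis mu1 : \sum_q mu q = 1.
Local Notation T := {ffun 'I_(n + M) -> Q}.
Local Notation Ex := (fexp (pweight (I := 'I_(n + M)) mu)).
Local Notation nrm := (fnrm (pweight (I := 'I_(n + M)) mu)).
Local Notation low := (@low n M).
Variable Y : 'I_n -> T -> R.
Hypothesis Ylow : forall i : 'I_n, indep_of (low i) (Y i).
Hypothesis Yhigh : forall i : 'I_n, indep_of (~: low (i + M)) (Y i).
Hypothesis Y0 : forall i, Ex (Y i) = 0.
Variables (b : 'I_n -> R) (delta : nat -> R) (eta : R).
Hypothesis Yeta : forall i w, `|Y i w| <= eta.
Hypothesis b_ge0 : forall i, 0 <= b i.
Hypothesis delta_ge0 : forall l, 0 <= delta l.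
Hypothesis dep : forall (i : 'I_n) l (r : 'I_(n + M)), (l < M)%N ->
  r = (i + (M - l.+1))%N :> nat ->
  Ex (fun w => Ex (fun w' => (Y i w - Y i (merge [set r]%SET w' w)) ^+ 2)) <= (b i * delta l) ^+ 2.

Let S w := \sum_i Y i w.
Let B : R := Num.sqrt (\sum_i b i ^+ 2).

(** The three summands bound, in order, the change of the cosine under truncation, the change of the
    variance (Cauchy-Schwarz on [(S - Sm) (S + Sm)]), and the m-dependent error for [Sm]. [M] occurs
    only in partial sums of [delta]. *)
Lemma weakdep_clt m (c : R) :
  `|Ex (fun w => cos (S w + c)) - cos c * expR (- (Ex (fun w => S w ^+ 2) / 2))|
  <= B * \sum_(m <= l < M) delta l
   + 2 * B ^+ 2 * (\sum_(l < M) delta l) * (\sum_(m <= l < M) delta l)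
   + (20 * m ^ 2)%:R * eta * (B * \sum_(l < M) delta l) ^+ 2.
Proof.
have pw0 := pweight_ge0 (I := 'I_(n + M)) mu_ge0.
have pw1 := pweight_sum1 (I := 'I_(n + M)) mu1.
pose Sm w := \sum_i trunc mu Y m i w.
set Dm := \sum_(m <= l < M) delta l; set D := \sum_(l < M) delta l.
have D0 : 0 <= D by exact: sumr_ge0.
have Dm0 : 0 <= Dm by exact: sumr_ge0.
have DmD : Dm <= D.
  rewrite /D -(big_mkord xpredT delta) /Dm.
  have [mM|Mm] := leqP m M; last by rewrite [leLHS]big_geq ?(ltnW Mm)//; exact: sumr_ge0.
  by rewrite [leRHS](big_cat_nat (leq0n m) mM)//= lerDr; exact: sumr_ge0.
have B0 : 0 <= B by exact: sqrtr_ge0.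
have nd : nrm (fun w => S w - Sm w) <= B * Dm.
  exact: (fnrm_sub_trunc mu_ge0 mu1 Ylow).
have nS : nrm S <= B * D by exact: fnrm_sumY.
(* The triangle inequality gives the factor 3; it is rounded to 4, so that halving the variance
   leaves the constant 2. *)
have nSm : nrm (fun w => S w + Sm w) <= 4 * (B * D).
  rewrite (eq_fnrm _ (G := fun w => S w + (S w + (Sm w - S w)))); last first.
    by move=> w; rewrite [X in _ = _ + X]addrCA subrr addr0.
  have nd' : nrm (fun w => Sm w - S w) <= B * D.
    apply: le_trans (ler_wpM2l B0 DmD).
    apply: le_trans nd; rewrite le_eqVlt; apply/orP; left; apply/eqP.
    by congr Num.sqrt; apply: eq_fexp => w; rewrite -sqrrN opprB.
  apply: le_trans (fnrmD pw0 _ _) _.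
  apply: le_trans (lerD nS (le_trans (fnrmD pw0 _ _) (lerD nS nd'))) _.
  rewrite -[4]/(3 + 1)%:R natrD mulrDl mul1r -[3]/(1 + 1 + 1)%:R !natrD !mulrDl !mul1r.
  by rewrite addrA lerDl mulr_ge0.
have eta0 : 0 <= eta \/ forall i : 'I_n, False.
  case: (n) Y Yeta => [|n'] Y' Y'e; first by right; case.
  have [w _|T0] := pickP (pred_of_simpl (@predT {ffun 'I_(n'.+1 + M) -> Q})).
    by left; apply: le_trans (Y'e ord0 w).
  have := pweight_sum1 (I := 'I_(n'.+1 + M)) mu1.
  by rewrite big1 => [/esym/eqP|w _]; [rewrite oner_eq0|have := T0 w].
have E1 : `|Ex (fun w => cos (S w + c)) - Ex (fun w => cos (Sm w + c))| <= B * Dm.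
  rewrite -fexpB; apply: le_trans (norm_fexp pw0 _) _.
  apply: le_trans (le_trans (fexp_norm_le_fnrm pw0 pw1 _) nd).
  apply: ler_fexp => // w; apply: le_trans (cos_lipschitz _ _) _.
  by rewrite opprD addrACA subrr addr0.
have s2 F : 0 <= Ex (fun w => F w ^+ 2) / 2.
  by rewrite divr_ge0// fexp_ge0// => w; exact: sqr_ge0.
have E2 : `|expR (- (Ex (fun w => Sm w ^+ 2) / 2)) - expR (- (Ex (fun w => S w ^+ 2) / 2))|
    <= 2 * B ^+ 2 * D * Dm.
  apply: le_trans (expRN_lipschitz _ _) _ => //.
  rewrite -mulrBl -fexpB normrM [`|2^-1|]ger0_norm// ler_pdivrMr//.
  rewrite (eq_fexp _ (G := fun w => (-1) * ((S w - Sm w) * (S w + Sm w)))) => [|w]; last by ring.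
  rewrite fexpZ mulN1r normrN; apply: le_trans (fexp_CSn pw0 _ _) _.
  have := ler_pM (fnrm_ge0 _ _) (fnrm_ge0 _ _) nd nSm; rewrite -/Dm.
  by congr (_ <= _); ring.
have E3 : `|Ex (fun w => cos (Sm w + c)) - cos c * expR (- (Ex (fun w => Sm w ^+ 2) / 2))|
    <= (20 * m ^ 2)%:R * eta * (B * D) ^+ 2.
  apply: (le_trans (mdep_clt (m := m) (eta := eta) mu_ge0 mu1 _ _ _ _ c)).
  - by move=> i; exact: trunc_low.
  - by move=> i; exact: trunc_high.
  - by move=> i; exact: fexp_trunc.
  - by move=> i w; apply: (avg_norm_le mu_ge0 mu1).
  case: eta0 => [eta0|n0]; last first.
    have b0 : \sum_i b i ^+ 2 = 0 by rewrite big1// => i; have := n0 i.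
    by rewrite /B b0 sqrtr0 mul0r expr0n/= mulr0 big1 ?mulr0// => i; have := n0 i.
  rewrite ler_wpM2l ?mulr_ge0// exprMn sqr_sqrtr; last first.
    by apply: sumr_ge0 => i _; exact: sqr_ge0.
  rewrite mulr_suml; apply: ler_sum => i _; rewrite -fnrm_sqr// -exprMn.
  rewrite ler_pXn2r// ?nnegrE ?fnrm_ge0 ?mulr_ge0//.
  exact: fnrm_trunc.
rewrite (_ : _ - _ = (Ex (fun w => cos (S w + c)) - Ex (fun w => cos (Sm w + c)))
  + cos c * (expR (- (Ex (fun w => Sm w ^+ 2) / 2)) - expR (- (Ex (fun w => S w ^+ 2) / 2)))
  + (Ex (fun w => cos (Sm w + c)) - cos c * expR (- (Ex (fun w => Sm w ^+ 2) / 2)))); last first.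
  by ring.
apply: le_trans (ler_normD _ _) _; apply: lerD => //.
apply: le_trans (ler_normD _ _) _; apply: lerD => //.
rewrite normrM; apply: le_trans E2; apply: ler_piMl => //.
exact: cos_max.
Qed.

End WeaklyDependent.

(** * Symmetric matrices *)

Section Spectral.
Local Open Scope complex_scope.
Local Open Scope sesquilinear_scope.
Context {R : rcfType}.
Local Notation C := R[i].
Local Notation toC := (real_complex R).

(** Newton's scheme, adding one node at a time. Since the values come from a function [h], repeated
    nodes are consistent. *)
Lemma poly_interpolation (m : nat) (d : 'I_m -> R) (h : R -> R) :
  exists q : {poly R}, forall i, q.[d i] = h (d i).
Proof.
suff [q hq] : exists q : {poly R}, forall x, x \in codom d -> q.[x] = h x.
  by exists q => i; apply: hq; exact: codom_f.
elim: (codom d) => [|a s [q hq]]; first by exists 0.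
have [ins|nins] := boolP (a \in s).
  by exists q => x; rewrite inE => /orP[/eqP ->|]; exact: hq.
pose w := \prod_(b <- s) ('X - b%:P).
have wa : w.[a] != 0 by rewrite -[_ == 0]/(root w a) root_prod_XsubC.
exists (q + ((h a - q.[a]) / w.[a]) *: w) => x.
rewrite inE hornerD hornerZ => /orP[/eqP ->|xs].
  by rewrite divfK// addrC subrK.
have /eqP -> : root w x by rewrite root_prod_XsubC.
by rewrite mulr0 addr0 hq.
Qed.

(** Squared modulus of the [i]-th coordinate of [v] in the spectral basis, written with real and
    imaginary parts so that it stays in [R]. *)
Definition sqmod (m : nat) (P : 'M[C]_m) (v : 'cV[R]_m) (i : 'I_m) : R :=
  let w := (P *m map_mx toC v) i 0 in complex.Re w ^+ 2 + complex.Im w ^+ 2.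

(** The complexified matrix is Hermitian, hence unitarily diagonalizable with real eigenvalues. They
    are eigenvalues of [A] itself because roots of the characteristic polynomial descend along the
    embedding of [R] into [R[i]]. *)
Lemma symmetric_spectral (m : nat) (A : 'M[R]_m) : A^T = A ->
  exists (P : 'M[C]_m) (d : 'I_m -> R),
    [/\ P \is unitarymx, map_mx toC A = P^t* *m diag_mx (\row_i (d i)%:C) *m P
      & forall i, eigenvalue A (d i)].
Proof.
move=> symA; pose AC := map_mx toC A.
have rA : AC \is a realmx by apply/mxOverP => i j; rewrite mxE; by rewrite complex_real.
have hA : AC \is hermsymmx.
  by apply: realsym_hermsym => //; apply/is_hermitianmxP; rewrite expr0 scale1r map_mx_id// /AC map_trmx symA.
have uP := spectral_unitarymx AC.
have /orthomx_spectralP eA := hermitian_normalmx hA.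
have rd := hermitian_spectral_diag_real hA.
exists (spectralmx AC), (fun i => complex.Re (spectral_diag AC 0 i)).
have dE : \row_i (complex.Re (spectral_diag AC 0 i))%:C = spectral_diag AC.
  apply/rowP => i; rewrite mxE RRe_real//.
  by move/mxOverP: rd; exact.
rewrite dE -invmx_unitary//; split => // i.
rewrite eigenvalue_root_char -(fmorph_root toC) map_char_poly -eigenvalue_root_char.
apply/eigenvalueP; exists (row i (spectralmx AC)).
  rewrite -/AC {2}eA -row_mul !mulmxA mulmxV ?spectral_unit// mul1mx.
  rewrite mul_diag_mx; apply/rowP => j; rewrite !mxE; congr (_ * _).
  by symmetry; apply: RRe_real; move/mxOverP: rd; exact.
apply/negP => /eqP r0; have := spectral_unit AC.
rewrite unitmxE unitfE (expand_det_row _ i) big1 ?eqxx// => j _.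
by move/rowP/(_ j): r0; rewrite !mxE => ->; rewrite mul0r.
Qed.

Lemma spectral_quadratic (m : nat) (P : 'M[C]_m) (B : 'M[R]_m) (q : 'I_m -> R) (v : 'cV[R]_m) :
  map_mx toC B = P^t* *m diag_mx (\row_i (q i)%:C) *m P ->
  (v^T *m B *m v) 0 0 = \sum_i q i * sqmod P v i.
Proof.
move=> eB; apply: (@complexI R).
transitivity ((map_mx toC (v^T *m B *m v)) 0 0); first by rewrite [RHS]mxE.
rewrite !map_mxM/= eB -map_trmx.
set w := map_mx toC v.
have cw : w^T = w^t*.
  apply/matrixP => i j; rewrite !mxE conj_Creal//; apply/complex_realP; by exists (v j i).
have -> : w^T *m (P^t* *m diag_mx (\row_i (q i)%:C) *m P) *m w =
   (P *m w)^t* *m diag_mx (\row_i (q i)%:C) *m (P *m w).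
  by move: (diag_mx _) => D; rewrite trmx_mul map_mxM -cw !mulmxA.
rewrite mxE rmorph_sum /=; apply: eq_bigr => i _.
rewrite mul_mx_diag !mxE /sqmod -/w.
set z := (P *m w) i 0.
have -> : \sum_j P i j * w j 0 = z by rewrite /z mxE.
rewrite [LHS](_ : _ = (q i)%:C * (z * z^*)); last by ring.
by rewrite -normCK rmorphM /= add_Re2_Im2.
Qed.

End Spectral.

Section PosDef.
Context {R : realType}.
Local Notation toC := (real_complex R).
Local Open Scope complex_scope.
Local Open Scope sesquilinear_scope.

Lemma sqmod_ge0 m (P : 'M[R[i]]_m) (v : 'cV[R]_m) i : 0 <= sqmod P v i.
Proof. by rewrite addr_ge0// sqr_ge0. Qed.

Lemma sum_sqmod m (P : 'M[R[i]]_m) (v : 'cV[R]_m) : P \is unitarymx ->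
  \sum_i sqmod P v i = (v^T *m v) 0 0.
Proof.
move=> uP; rewrite -[v^T in RHS]mulmx1.
rewrite (spectral_quadratic (P := P) (q := fun=> 1)).
  by apply: eq_bigr => i _; rewrite mul1r.
have -> : \row_(i < m) (1 : R)%:C = const_mx 1 by apply/rowP => i; rewrite !mxE.
by rewrite diag_const_mx mulmx1 -invmx_unitary// mulVmx ?unitarymx_unit// map_mx1.
Qed.

Lemma eigenvalue_lower_bound m (A : 'M[R]_m) (c : R) (v : 'cV[R]_m) : A^T = A ->
  (forall a, eigenvalue A a -> c <= a) -> c * (v^T *m v) 0 0 <= (v^T *m A *m v) 0 0.
Proof.
move=> /symmetric_spectral[P [q [uP eA eig]]] h.
rewrite (spectral_quadratic v eA) -(sum_sqmod v uP) mulr_sumr.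
by apply: ler_sum => i _; rewrite ler_wpM2r ?sqmod_ge0// h.
Qed.

Lemma dot_gt0 m (v : 'cV[R]_m) : v != 0 -> 0 < (v^T *m v) 0 0.
Proof.
move=> v0; have [i vi] : exists i, v i 0 != 0.
  apply/existsP; apply: contraNT v0; rewrite negb_exists => /forallP h.
  by apply/eqP/colP => i; rewrite mxE; apply/eqP; have := h i; rewrite negbK.
rewrite mxE (bigD1 i)//= ltr_pwDl//.
  by rewrite mxE -expr2 exprn_even_gt0.
by apply: sumr_ge0 => j _; rewrite mxE -expr2 sqr_ge0.
Qed.

Lemma posdef_eigenvalue_gt0 m (A : 'M[R]_m) a : posdef A -> eigenvalue A a -> 0 < a.
Proof.
move=> [sA pA] /eigenvalueP[v vA v0].
have vT0 : v^T != 0 by rewrite trmx_eq0.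
have := pA _ vT0; rewrite trmxK vA -scalemxAl mxE.
have := dot_gt0 vT0; rewrite trmxK => h.
by rewrite pmulr_lgt0.
Qed.

(* The square root is the value at [A] of a polynomial interpolating the real square root
   on the spectrum. *)
Lemma posdef_sqrt m (A : 'M[R]_m) : posdef A -> exists B, posdef B /\ B *m B = A.
Proof.
move=> pA; have [sA _] := pA.
(* Evaluating polynomials at a matrix needs the ring of matrices of positive size; the empty matrix
   is its own root. *)
case: m A pA sA => [|m] A pA sA.
  by exists A; split => //; apply/matrixP => -[].
have [P [dd [uP eA eig]]] := symmetric_spectral sA.
have [q hq] := poly_interpolation dd Num.sqrt.
have d0 i : 0 < dd i by exact: posdef_eigenvalue_gt0 (eig i).
have PP : P *m P^t* = 1%:M by exact/unitarymxP.
have PP' : P^t* *m P = 1%:M by rewrite -invmx_unitary// mulVmx ?unitarymx_unit.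
have conjX (p : {poly R}) : map_mx toC (horner_mx A p)
    = P^t* *m diag_mx (\row_i (p.[dd i])%:C) *m P.
  elim/poly_ind: p => [|p c IH].
    have -> : \row_i ((0 : {poly R}).[dd i])%:C = 0.
      by apply/rowP => i; rewrite !mxE horner0.
    by rewrite !rmorph0 linear0 mulmx0 mul0mx.
  rewrite rmorphD rmorphM /= horner_mx_X horner_mx_C.
  rewrite map_mxD map_mxM/= IH eA map_scalar_mx.
  have -> : diag_mx (\row_i ((p * 'X + c%:P).[dd i])%:C) =
      diag_mx (\row_i (p.[dd i])%:C) *m diag_mx (\row_i (dd i)%:C) + (c%:C)%:M.
    apply/matrixP => i j; rewrite mul_diag_mx !mxE !hornerE.
    by case: eqVneq => _; rewrite ?mulr1n ?mulr0n ?mulr0 ?addr0// rmorphD rmorphM.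
  move: (diag_mx _) (diag_mx _) => D1 D2.
  rewrite mulmxDr mulmxDl mul_mx_scalar -scalemxAl PP' scalemx1.
  by congr (_ + _); rewrite !mulmxA -[_ *m P *m P^t*]mulmxA PP mulmx1.
have pos i : 0 < Num.sqrt (dd i) by rewrite sqrtr_gt0.
have eB := conjX q.
have rowE : \row_i (q.[dd i])%:C = \row_i (Num.sqrt (dd i))%:C.
  by apply/rowP => i; rewrite !mxE hq.
rewrite rowE in eB.
exists (horner_mx A q); split; last first.
  have inj : injective (fun X : 'M[R]_(m.+1) => map_mx toC X).
    by move=> X Y /matrixP h; apply/matrixP => i j; have := h i j; rewrite !mxE => /complexI.
  apply: inj; rewrite map_mxM/= eB eA.
  have -> : diag_mx (\row_i (dd i)%:C) =
      diag_mx (\row_i (Num.sqrt (dd i))%:C) *m diag_mx (\row_i (Num.sqrt (dd i))%:C).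
    rewrite mulmx_diag; congr diag_mx; apply/rowP => i; rewrite !mxE -rmorphM/=.
    by rewrite -expr2 sqr_sqrtr// ltW.
  move: (diag_mx _) => D.
  by rewrite !mulmxA -[_ *m P *m P^t*]mulmxA PP mulmx1.
split.
  elim/poly_ind: (q) => [|p c IH]; first by rewrite rmorph0 trmx0.
  rewrite rmorphD rmorphM /= horner_mx_X horner_mx_C linearD /= tr_scalar_mx.
  congr (_ + _); rewrite -[RHS]/(horner_mx A p *m A) trmx_mul IH sA.
  by have := comm_horner_mx p (comm_mx_refl A).
move=> v v0; rewrite (spectral_quadratic v eB).
have := dot_gt0 v0; rewrite -(sum_sqmod v uP) => h.
rewrite lt_def sumr_ge0 ?andbT => [|i _]; last by rewrite mulr_ge0 ?sqmod_ge0// ltW.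
apply: contraTneq h => /psumr_eq0P h0; rewrite big1 ?ltxx// => i _.
have := h0 (fun i _ => mulr_ge0 (ltW (pos i)) (sqmod_ge0 P v i)) i isT.
by move=> /eqP; rewrite mulf_eq0 gt_eqF//= => /eqP.
Qed.

Lemma posdef_unitmx m (A : 'M[R]_m) : posdef A -> A \in unitmx.
Proof.
move=> [sA pA]; rewrite -row_free_unit -kermx_eq0; apply/rowV0P => v /sub_kermxP vA.
apply/eqP/negPn/negP => v0.
have := pA v^T; rewrite trmx_eq0 => /(_ v0).
by rewrite trmxK vA mul0mx mxE ltxx.
Qed.

Lemma posdef_invmx m (A : 'M[R]_m) : posdef A -> posdef (invmx A).
Proof.
move=> pA; have uA := posdef_unitmx pA; have [sA pA'] := pA; split.
  by rewrite trmx_inv sA.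
move=> v v0; have := pA' (invmx A *m v); rewrite trmx_mul trmx_inv sA.
rewrite !mulmxA mulmxKV//; apply; apply: contra v0 => /eqP h.
by rewrite -[v](mulKVmx uA) h mulmx0.
Qed.

Lemma invsqrtmxP m (A : 'M[R]_m) : posdef A ->
  posdef (invsqrtmx A) /\ invsqrtmx A *m invsqrtmx A = invmx A.
Proof.
move=> /posdef_invmx/posdef_sqrt h.
exact: (ClassicalEpsilon.epsilon_spec (inhabits 0) _ h).
Qed.

Lemma invsqrtmx_conj m (A : 'M[R]_m) : posdef A -> invsqrtmx A *m A *m invsqrtmx A = 1%:M.
Proof.
move=> pA; have [_ h] := invsqrtmxP pA; have uA := posdef_unitmx pA.
by apply: mulmx1C; rewrite mulmxA h mulVmx.
Qed.

End PosDef.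

Local Open Scope classical_set_scope.
Local Open Scope ring_scope.

(** * Finitely valued random variables *)

Section FinitelyValued.
Context {R : realType} d (Om : measurableType d) (P : probability Om R).

(* Restricting to finitely valued variables makes every expectation a finite sum, so
   that no integrability question arises. *)
Definition finval (A : Type) (f : Om -> A) : Prop :=
  exists (W : finType) (tau : Om -> W) (F : W -> A),
    (forall x, measurable (tau @^-1` [set x])) /\ f = F \o tau.

Lemma finval_comp (A B : Type) (h : A -> B) (f : Om -> A) :
  finval f -> finval (fun w => h (f w)).
Proof. by move=> [W [tau [F [mt ->]]]]; exists W, tau, (h \o F). Qed.

Lemma finval_pair (A B : Type) (f : Om -> A) (g : Om -> B) :
  finval f -> finval g -> finval (fun w => (f w, g w)).
Proof.
move=> [W [tau [F [mt ->]]]] [W' [tau' [F' [mt' ->]]]].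
exists (W * W')%type, (fun w => (tau w, tau' w)), (fun x => (F x.1, F' x.2)); split => //.
move=> [x x']; rewrite (_ : _ @^-1` _ = tau @^-1` [set x] `&` tau' @^-1` [set x']).
  exact: measurableI.
by apply/seteqP; split => w /=; [case=> -> ->|case=> -> ->].
Qed.

Lemma finval_cst (A : Type) (a : A) : finval (fun=> a).
Proof.
exists unit, (fun=> tt), (fun=> a); split => // -[].
by rewrite (_ : _ @^-1` _ = setT)//; apply/seteqP; split.
Qed.

Lemma finval_asbool (A : set Om) : measurable A -> finval (fun w => `[< A w >]).
Proof.
move=> mA; exists bool, (fun w => `[< A w >]), id; split => // -[].
  rewrite (_ : _ @^-1` _ = A)//; apply/seteqP; split => w /=.
    by move=> /asboolP.
  by move=> Aw; exact/asboolP.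
rewrite (_ : _ @^-1` _ = ~` A); first exact: measurableC.
apply/seteqP; split => w /=; first by move=> /negbT/asboolPn.
by move=> nA; apply/negbTE/asboolPn.
Qed.

Definition EP (f : Om -> R) : R := \int[P]_(w in setT) f w.

Lemma finval_bounded (f : Om -> R) : finval f -> exists M, forall w, `|f w| <= M.
Proof.
move=> [W [tau [F [_ ->]]]]; exists (\sum_x `|F x|) => w /=.
by rewrite (bigD1 (tau w))//= lerDl sumr_ge0.
Qed.

Lemma finval_preimage (A : Type) (f : Om -> A) (B : set A) :
  finval f -> measurable (f @^-1` B).
Proof.
move=> [W [tau [F [mt ->]]]].
rewrite (_ : _ @^-1` _ = \bigcup_(x in [set x | B (F x)]) tau @^-1` [set x]).
  by apply: fin_bigcup_measurable => // x _.
by apply/seteqP; split => w /=; [exists (tau w)|move=> [x Bx /= ->]].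
Qed.

Lemma finval_measurable (f : Om -> R) : finval f -> measurable_fun setT f.
Proof. by move=> ff _ B _; rewrite setTI; exact: finval_preimage. Qed.

Lemma finval_integrable (f : Om -> R) : finval f -> P.-integrable setT (EFin \o f).
Proof.
move=> ff; have [M fM] := finval_bounded ff.
apply: (le_integrable measurableT (g := EFin \o cst M)).
- by apply/measurable_EFinP; exact: finval_measurable.
- by move=> w _ /=; rewrite lee_fin; apply: le_trans (fM w) (ler_norm _).
exact: finite_measure_integrable_cst.
Qed.

Lemma EP_D f g : finval f -> finval g -> EP (fun w => f w + g w) = EP f + EP g.
Proof. by move=> ff fg; apply: RintegralD => //; exact: finval_integrable. Qed.

Lemma EP_B f g : finval f -> finval g -> EP (fun w => f w - g w) = EP f - EP g.
Proof. by move=> ff fg; apply: RintegralB => //; exact: finval_integrable. Qed.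

Lemma EP_Z c f : finval f -> EP (fun w => c * f w) = c * EP f.
Proof. by move=> ff; apply: RintegralZl => //; exact: finval_integrable. Qed.

Lemma EP_cst c : EP (fun=> c) = c.
Proof.
rewrite /EP Rintegral_cst// -[RHS]mulr1; congr (c * _).
exact: (congr1 fine (probability_setT P)).
Qed.

Lemma finval_op2 (A B C : Type) (h : A -> B -> C) f g :
  finval f -> finval g -> finval (fun w => h (f w) (g w)).
Proof. by move=> ff fg; exact: (finval_comp (fun x => h x.1 x.2) (finval_pair ff fg)). Qed.

Lemma finval_ffun (I : finType) (A : Type) (a0 : A) (f : I -> Om -> A) :
  (forall i, finval (f i)) -> finval (fun w => [ffun i => f i w]).
Proof.
move=> ff.
have fs (s : seq I) : finval (fun w => [seq f i w | i <- s]).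
  elim: s => [|i s IH]; first exact: finval_cst.
  exact: (finval_op2 (fun x l => x :: l) (ff i) IH).
(* Going through lists lets the induction run over [enum I]; the default [a0] is never read, every
   rank being in range. *)
rewrite (_ : (fun _ => _) =
    fun w => [ffun i => nth a0 [seq f j w | j <- enum I] (enum_rank i)]).
  exact: (finval_comp (fun l => [ffun i => nth a0 l (enum_rank i)]) (fs (enum I))).
apply/funext => w; apply/ffunP => i; rewrite !ffunE.
by rewrite (nth_map i) -?cardE ?ltn_ord// nth_enum_rank.
Qed.

Lemma finval_sum (I : Type) (r : seq I) (Q : pred I) (f : I -> Om -> R) :
  (forall i, finval (f i)) -> finval (fun w => \sum_(i <- r | Q i) f i w).
Proof.
move=> ff; elim: r => [|i r IH].
  rewrite (_ : (fun _ => _) = fun=> 0); first exact: finval_cst.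
  by apply/funext => w; rewrite big_nil.
rewrite (_ : (fun _ => _) = fun w => if Q i then f i w + \sum_(i <- r | Q i) f i w
    else \sum_(i <- r | Q i) f i w); last by apply/funext => w; rewrite big_cons.
by case: (Q i) => //; exact: (finval_op2 +%R).
Qed.

Lemma EP_sum (I : Type) (r : seq I) (Q : pred I) (f : I -> Om -> R) :
  (forall i, finval (f i)) ->
  EP (fun w => \sum_(i <- r | Q i) f i w) = \sum_(i <- r | Q i) EP (f i).
Proof.
move=> ff; elim: r => [|i r IH].
  rewrite big_nil -[RHS](EP_cst 0); congr EP.
  by apply/funext => w; rewrite big_nil.
rewrite big_cons -IH; case: ifPn => Qi.
  rewrite -EP_D//; last exact: finval_sum.
  by congr EP; apply/funext => w; rewrite big_cons Qi.
by congr EP; apply/funext => w; rewrite big_cons (negbTE Qi).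
Qed.

Lemma EP_le f g : finval f -> finval g -> (forall w, f w <= g w) -> EP f <= EP g.
Proof. by move=> ff fg h; apply: le_Rintegral => //; exact: finval_integrable. Qed.

Lemma EP_norm f : finval f -> `|EP f| <= EP (fun w => `|f w|).
Proof. by move=> ff; apply: le_normr_Rintegral => //; exact: finval_integrable. Qed.

Lemma EP_asbool (A : set Om) : measurable A -> EP (fun w => (`[< A w >])%:R) = prob P A.
Proof.
move=> mA; rewrite /EP /Rintegral /prob -[in RHS](setIT A) -integral_indic//; exact/measurableT.
Qed.

Lemma EP_finite (W : finType) (tau : Om -> W) (F : W -> R) :
  (forall x, measurable (tau @^-1` [set x])) ->
  EP (fun w => F (tau w)) = \sum_x F x * prob P (tau @^-1` [set x]).
Proof.
move=> mt.
rewrite (_ : (fun _ => _) = fun w => \sum_x F x * (`[< (tau @^-1` [set x]) w >])%:R).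
  rewrite EP_sum => [|x]; last first.
    by apply: (finval_comp (fun b : bool => F x * b%:R)); exact: finval_asbool.
  apply: eq_bigr => x _; rewrite EP_Z ?EP_asbool//.
  by apply: (finval_comp (fun b : bool => b%:R)); exact: finval_asbool.
apply/funext => w; rewrite (bigD1 (tau w))//= big1 ?addr0 => [|x xw].
  by rewrite asboolT// mulr1.
by rewrite asboolF ?mulr0// => h; rewrite h eqxx in xw.
Qed.

End FinitelyValued.

(** * From the innovations to a finite product space *)

Section ProbBasics.
Context {R : realType} d (Om : measurableType d) (P : probability Om R).
Implicit Types A B C : set Om.

Lemma prob_ge0 A : 0 <= prob P A.
Proof. by rewrite fine_ge0. Qed.

Lemma probE A : measurable A -> (prob P A)%:E = P A.
Proof. by move=> mA; rewrite fineK// fin_num_measure. Qed.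

Lemma prob_le A B : measurable A -> measurable B -> A `<=` B -> prob P A <= prob P B.
Proof.
by move=> mA mB AB; rewrite -lee_fin !probE//; apply: le_measure; rewrite ?inE.
Qed.

Lemma prob_le1 A : measurable A -> prob P A <= 1.
Proof. by move=> mA; rewrite -lee_fin probE// probability_le1. Qed.

Lemma prob_setT : prob P setT = 1.
Proof. by rewrite /prob probability_setT. Qed.

Lemma prob_set0 : prob P set0 = 0.
Proof. by rewrite /prob measure0. Qed.

Lemma prob_leU A B C : measurable A -> measurable B -> measurable C ->
  A `<=` B `|` C -> prob P A <= prob P B + prob P C.
Proof.
move=> mA mB mC ABC; apply: le_trans (prob_le mA (measurableU _ _ mB mC) ABC) _.
rewrite -lee_fin EFinD !probE//; last exact: measurableU.
exact: measureU2.
Qed.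

Lemma prob_dist A B C : measurable A -> measurable B -> measurable C ->
  (forall w, ~ C w -> (A w <-> B w)) -> `|prob P A - prob P B| <= prob P C.
Proof.
move=> mA mB mC h; rewrite ler_norml; apply/andP; split.
  rewrite lerNl opprB lerBlDl; apply: prob_leU => // w Bw.
  by have [Cw|/h] := pselect (C w); [right|left; tauto].
rewrite lerBlDl; apply: prob_leU => // w Aw.
by have [Cw|/h] := pselect (C w); [right|left; tauto].
Qed.

Lemma prob_partition (W : finType) (tau : Om -> W) A : measurable A ->
  (forall x, measurable (tau @^-1` [set x])) ->
  prob P A = \sum_x prob P (A `&` tau @^-1` [set x]).
Proof.
move=> mA mt.
have mI x : measurable (A `&` tau @^-1` [set x]) by exact: measurableI.
rewrite -EP_asbool// (_ : (fun _ => _) =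
    fun w => \sum_x (`[< (A `&` tau @^-1` [set x]) w >])%:R).
  rewrite EP_sum => [|x]; first by apply: eq_bigr => x _; rewrite EP_asbool.
  by apply: (finval_comp (fun b : bool => b%:R)); exact: finval_asbool.
apply/funext => w; rewrite (bigD1 (tau w))//= big1 ?addr0 => [|x xw].
  by congr (_%:R); congr nat_of_bool; apply: asbool_equiv_eq; split=> [Aw|[]//]; split.
by rewrite asboolF// => -[_ h]; rewrite h eqxx in xw.
Qed.

End ProbBasics.

(** * Finite-dimensional approximation of events of the past *)

Section Cylinders.
Context {R : realType} d (Om : measurableType d) (P : probability Om R).
Context dE (E : measurableType dE) (I : eqType) (xi : I -> Om -> E).
Hypothesis iid_xi : iid P xi.

Definition scyl : set (set (nat -> E)) := smallest (sigma_algebra setT) (@cylinders _ E).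

Lemma scyl_set0 : scyl set0.
Proof. by move=> G [[h _ _] _]. Qed.

Lemma scylC B : scyl B -> scyl (~` B).
Proof. by move=> sB G [sG cG]; have [_ h _] := sG; rewrite -setTD; apply: h; exact: sB. Qed.

Lemma scyl_bigcup (F : nat -> set (nat -> E)) : (forall i, scyl (F i)) -> scyl (\bigcup_i F i).
Proof. by move=> sF G [sG cG]; have [_ _ h] := sG; apply: h => i; exact: sF. Qed.

Lemma scylU A B : scyl A -> scyl B -> scyl (A `|` B).
Proof.
move=> sA sB; rewrite -bigcup2E; apply: scyl_bigcup => -[|[|i]] //=.
exact: scyl_set0.
Qed.

Lemma scylI A B : scyl A -> scyl B -> scyl (A `&` B).
Proof. by move=> sA sB; rewrite -[A `&` B]setCK setCI; apply: scylC; apply: scylU; apply: scylC. Qed.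

Lemma scyl_cyl (j : nat) (A : set E) : measurable A -> scyl [set s | A (s j)].
Proof. by move=> mA G [sG cG]; apply: cG; exists j, A. Qed.

(* A reindexing of the innovations; it covers both [past] and [pastS]. *)
Definition traj (io : nat -> I) (w : Om) : nat -> E := fun j => xi (io j) w.

Lemma measurable_xi (i : I) (A : set E) : measurable A -> measurable (xi i @^-1` A).
Proof. by move=> mA; have [m _ _] := iid_xi; rewrite -[_ @^-1` _]setTI; exact: m. Qed.

Lemma measurable_traj io B : scyl B -> measurable (traj io @^-1` B).
Proof.
move=> sB; apply: (sB [set B | measurable (traj io @^-1` B)]); split.
  split => /= [|A mA|F mF].
  - by rewrite preimage_set0.
  - by rewrite setTD preimage_setC; exact: measurableC.
  - by rewrite preimage_bigcup; exact: bigcup_measurable.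
by move=> _ [j [A [mA ->]]] /=; exact: (measurable_xi (io j) mA).
Qed.

Lemma indep_fin (K : finType) (ka : K -> I) (B : K -> set E) : injective ka ->
  (forall k, measurable (B k)) ->
  prob P [set w | forall k, B k (xi (ka k) w)] = \prod_k prob P (xi (ka k) @^-1` B k).
Proof.
move=> inj mB; have [_ ind _] := iid_xi.
(* Independence is stated for families of sets indexed by all of [I]; off the image of [ka] the
   family [B] is extended by the whole space. *)
pose A i := if [pick k | ka k == i] is Some k then B k else setT.
have AE k : A (ka k) = B k.
  rewrite /A; case: pickP => [k' /eqP/inj -> //|/(_ k)]; by rewrite eqxx.
have mA i : measurable (A i) by rewrite /A; case: pickP.
have us : uniq [seq ka k | k <- enum K] by rewrite map_inj_uniq ?enum_uniq.
have := ind _ us A mA; rewrite big_map big_enum /=.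
under [RHS]eq_bigr do rewrite AE.
move=> <-; congr (prob P _); apply/seteqP; split => w /= h.
  by move=> i /= /mapP[k _ ->] /=; rewrite AE.
by move=> k; have := h (ka k); rewrite /= AE; apply; apply: map_f; rewrite mem_enum.
Qed.

Section Quantized.
Context {Q : finType} (c : E -> Q).
Hypothesis mc : forall q, measurable (c @^-1` [set q]).
Variable i0 : I.

Definition qmass (q : Q) : R := prob P (xi i0 @^-1` (c @^-1` [set q])).

Lemma qmass_ge0 q : 0 <= qmass q. Proof. exact: prob_ge0. Qed.

Lemma qmassE i q : prob P [set w | c (xi i w) = q] = qmass q.
Proof. by have [_ _ id] := iid_xi; exact: (id i i0 _ (mc q)). Qed.

Lemma qmass_sum1 : \sum_q qmass q = 1.
Proof.
rewrite -(prob_setT P) (@prob_partition _ _ _ _ _ (fun w => c (xi i0 w)))//.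
  by apply: eq_bigr => q _; rewrite setTI.
by move=> q; exact: (measurable_xi i0 (mc q)).
Qed.

Lemma finval_q i : finval (fun w => c (xi i w)).
Proof. by exists Q, (fun w => c (xi i w)), id; split => // q; exact: (measurable_xi i (mc q)). Qed.

Lemma prob_cells (K : finType) (ka : K -> I) (q : {ffun K -> Q}) : injective ka ->
  prob P [set w | [ffun k => c (xi (ka k) w)] = q] = \prod_k qmass (q k).
Proof.
move=> inj; under [RHS]eq_bigr => k _ do rewrite -(qmassE (ka k)).
rewrite -(indep_fin inj (fun k => mc (q k))); congr (prob P _); apply/seteqP; split => w /=.
  by move=> <- k; rewrite ffunE.
by move=> h; apply/ffunP => k; rewrite ffunE.
Qed.

End Quantized.

(* [B] depends only on which sets of [L] contain each of the first [M] coordinates. *)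
Definition findet (M : nat) (L : seq (set E)) (B : set (nat -> E)) :=
  forall s s' : nat -> E,
  (forall j, (j < M)%N -> forall l, (l < size L)%N -> (nth set0 L l (s j) <-> nth set0 L l (s' j))) ->
  B s -> B s'.

Lemma findet_widen M M' L L1 L2 B : (M <= M')%N -> findet M L B -> findet M' (L1 ++ L ++ L2) B.
Proof.
move=> MM' fB s s' h; apply: fB => j jM l lL.
have := h j (leq_trans jM MM') (size L1 + l)%N.
have -> : nth set0 (L1 ++ L ++ L2) (size L1 + l) = nth set0 L l.
  by rewrite nth_cat ltnNge leq_addr /= addKn nth_cat lL.
apply.
by rewrite !size_cat ltn_add2l ltn_addr.
Qed.

Definition mseq (L : seq (set E)) := forall l, (l < size L)%N -> measurable (nth set0 L l).

Lemma mseq_cat L1 L2 : mseq L1 -> mseq L2 -> mseq (L1 ++ L2).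
Proof.
move=> m1 m2 l; rewrite size_cat nth_cat; case: (ltnP l (size L1)) => [l1 _|l1 l2]; first exact: (m1 _ l1).
by apply: (m2 (l - size L1)%N); rewrite ltn_subLR.
Qed.

(* One approximating [B'] serves both reindexings. *)
Definition approximable (io io' : nat -> I) (B : set (nat -> E)) :=
  forall dlt : R, 0 < dlt -> exists M L B',
  [/\ mseq L, findet M L B', scyl B',
      prob P [set w | ~ (B (traj io w) <-> B' (traj io w))] <= dlt &
      prob P [set w | ~ (B (traj io' w) <-> B' (traj io' w))] <= dlt].

Lemma measurable_xor A B : measurable A -> measurable B ->
  measurable [set w : Om | ~ (A w <-> B w)].
Proof.
move=> mA mB; rewrite (_ : [set w | _] = (A `\` B) `|` (B `\` A)).
  by apply: measurableU; exact: measurableD.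
apply/seteqP; split => w /=; last by tauto.
by move=> h; have [Aw|Aw] := pselect (A w); [left|right]; split=> //; tauto.
Qed.

Lemma measurable_traj_xor io A B : scyl A -> scyl B ->
  measurable [set w : Om | ~ (A (traj io w) <-> B (traj io w))].
Proof. by move=> sA sB; apply: measurable_xor; exact: measurable_traj. Qed.

(** Good sets: the approximable members of [scyl] form a sigma-algebra containing the cylinders. A
    countable union is first cut to a finite one, by continuity of [P] along the decreasing
    discrepancy sets; the cut and the approximation of the finite union each use half of the
    tolerance. *)
Lemma scyl_approximable io io' B : scyl B -> approximable io io' B.
Proof.
move=> sB; suff : (scyl `&` approximable io io') B by case.
(* Keeping [scyl] in the invariant is what makes every discrepancy set measurable. *)
apply: (sB (scyl `&` approximable io io')); split; last first.
  move=> _ [j [A [mA ->]]]; split; first exact: scyl_cyl.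
  move=> dlt d0; exists j.+1, [:: A], [set s | A (s j)]; split.
  - by case.
  - by move=> s s' /(_ j (ltnSn j) 0%N isT) /= h /h.
  - exact: scyl_cyl.
  - by rewrite (_ : [set w | _] = set0) ?prob_set0 ?ltW//; apply/seteqP; split => w //=; tauto.
  - by rewrite (_ : [set w | _] = set0) ?prob_set0 ?ltW//; apply/seteqP; split => w //=; tauto.
have a0 : approximable io io' set0.
  move=> dlt d0; exists 0%N, [::], set0; split => //.
  - exact: scyl_set0.
  - by rewrite (_ : [set w | _] = set0) ?prob_set0 ?ltW//; apply/seteqP; split => w //=; tauto.
  - by rewrite (_ : [set w | _] = set0) ?prob_set0 ?ltW//; apply/seteqP; split => w //=; tauto.
have aU A C : scyl A -> scyl C -> approximable io io' A -> approximable io io' C ->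
    approximable io io' (A `|` C).
  move=> sA sC aA aC dlt d0; have d20 : 0 < dlt / 2 by rewrite divr_gt0.
  have [M1 [L1 [A' [mL1 fA sA' A1 A2]]]] := aA _ d20.
  have [M2 [L2 [C' [mL2 fC sC' C1 C2]]]] := aC _ d20.
  exists (maxn M1 M2), (L1 ++ L2), (A' `|` C'); split.
  - exact: mseq_cat.
  - have fA' : findet (maxn M1 M2) (L1 ++ L2) A'.
      by have := findet_widen (L1 := [::]) (L2 := L2) (leq_maxl M1 M2) fA.
    have fC' : findet (maxn M1 M2) (L1 ++ L2) C'.
      by have := findet_widen (L1 := L1) (L2 := [::]) (leq_maxr M1 M2) fC; rewrite cats0.
    by move=> s s' h [/(fA' _ _ h)|/(fC' _ _ h)]; [left|right].
  - exact: scylU.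
  - rewrite [leRHS](splitr dlt); apply: le_trans (lerD A1 C1).
    apply: prob_leU; try (apply: measurable_traj_xor => //; exact: scylU).
    by move=> w /=; tauto.
  - rewrite [leRHS](splitr dlt); apply: le_trans (lerD A2 C2).
    apply: prob_leU; try (apply: measurable_traj_xor => //; exact: scylU).
    by move=> w /=; tauto.
split.
- by split; [exact: scyl_set0|exact: a0].
- move=> A [sA aA]; rewrite setTD; split; first exact: scylC.
  move=> dlt d0; have [M [L [A' [mL fA sA' A1 A2]]]] := aA _ d0.
  exists M, L, (~` A'); split => //.
  + move=> s s' h nA As'; apply: nA; apply: fA As' => j jM l lL.
    by have := h j jM l lL; tauto.
  + exact: scylC.
  + apply: le_trans A1; apply: prob_le.
    * by apply: measurable_traj_xor => //; exact: scylC.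
    * exact: measurable_traj_xor.
    * by move=> w /=; tauto.
  + apply: le_trans A2; apply: prob_le.
    * by apply: measurable_traj_xor => //; exact: scylC.
    * exact: measurable_traj_xor.
    * by move=> w /=; tauto.
move=> F hF; have sF i : scyl (F i) by have [] := hF i.
split; first exact: scyl_bigcup.
move=> dlt d0; have d20 : 0 < dlt / 2 by rewrite divr_gt0.
pose U n := \big[setU/set0]_(i < n) F i.
have sU n : scyl (U n).
  by rewrite /U; elim/big_ind : _ => //; [exact: scyl_set0|exact: scylU].
have aUn n : approximable io io' (U n).
  elim: n => [|n IH]; first by rewrite /U big_ord0.
  rewrite /U big_ord_recr /=; apply: aU => //; last by have [] := hF n.
  exact: sU.
have tail j : \forall n \near \oo,
    prob P [set w | ~ ((\bigcup_i F i) (traj j w) <-> U n (traj j w))] <= dlt / 2.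
  pose D n := [set w | ~ ((\bigcup_i F i) (traj j w) <-> U n (traj j w))].
  have mD n : measurable (D n) by apply: measurable_traj_xor => //; exact: scyl_bigcup.
  have D0 : \bigcap_n D n = set0.
    apply/seteqP; split => w //= h.
    have [[k _ Fk]|nF] := pselect ((\bigcup_i F i) (traj j w)).
      apply: (h k.+1 Logic.I); split => _; last by exists k.
      by rewrite /U big_ord_recr /=; right.
    by apply: (h 0%N Logic.I); split => //; rewrite /U big_ord0.
  have Dni : {homo D : n m / (n <= m)%N >-> (m <= n)%O}.
    move=> n m' nm; apply/subsetPset => w /= h h'; apply: h; split => [|Uw].
      move=> /h'; exact: (subset_bigsetU nm).
    exact: bigsetU_bigcup Uw.
  have := @nonincreasing_cvg_mu _ _ _ P D _ mD _ Dni.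
  rewrite D0 measure0 => /(_ _ _)/fine_cvg/cvgrPdist_le/(_ _ d20) h.
  apply: filterS (h _ _) => [n| |].
  - by rewrite sub0r normrN ger0_norm ?fine_ge0.
  - by apply: le_lt_trans (probability_le1 _ _) (ltry _).
  - exact: measurable0.
near \oo => n.
have [M [L [B' [mL fB sB' B1 B2]]]] := aUn n _ d20.
exists M, L, B'; split => //.
- rewrite [leRHS](splitr dlt); apply: le_trans (lerD (_ : prob P [set w | ~ ((\bigcup_i F i) (traj io w) <-> U n (traj io w))] <= dlt / 2) B1).
    apply: prob_leU; try (apply: measurable_traj_xor => //; exact: scyl_bigcup).
    by move=> w /=; tauto.
  by near: n; exact: tail.
- rewrite [leRHS](splitr dlt); apply: le_trans (lerD (_ : prob P [set w | ~ ((\bigcup_i F i) (traj io' w) <-> U n (traj io' w))] <= dlt / 2) B2).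
    apply: prob_leU; try (apply: measurable_traj_xor => //; exact: scyl_bigcup).
    by move=> w /=; tauto.
  by near: n; exact: tail.
Unshelve. all: by end_near. Qed.

End Cylinders.

(** * Stationarity and independence along reindexings *)

Section Law.
Context {R : realType} d (Om : measurableType d) (P : probability Om R).
Context dE (E : measurableType dE) (I : eqType) (xi : I -> Om -> E).
Hypothesis iid_xi : iid P xi.
Local Notation traj := (traj xi).

Definition quantize (L : seq (set E)) (x : E) : {ffun 'I_(size L) -> bool} :=
  [ffun l : 'I_(size L) => `[< nth set0 L l x >]].

Lemma measurable_quantize L q : mseq L -> measurable (quantize L @^-1` [set q]).
Proof.
move=> mL; rewrite (_ : _ @^-1` _ =
    \bigcap_(l in [set: 'I_(size L)]) [set x | `[< nth set0 L l x >] = q l]).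
  apply: fin_bigcap_measurable; first exact: finite_finset.
  move=> l _; case: (q l).
    rewrite (_ : [set x | _] = nth set0 L l); first exact: (mL _ (ltn_ord l)).
    by apply/seteqP; split => x /= /asboolP.
  rewrite (_ : [set x | _] = ~` nth set0 L l).
    by apply: measurableC; exact: (mL _ (ltn_ord l)).
  apply/seteqP; split => x /=; first by move=> /negbT/asboolPn.
  by move=> h; apply/negbTE/asboolPn.
apply/seteqP; split => x /=; first by move=> <- l _ /=; rewrite ffunE.
by move=> h; apply/ffunP => l; rewrite ffunE; exact: h.
Qed.

Lemma findet_quantize M L B (s s' : nat -> E) : findet M L B ->
  (forall j, (j < M)%N -> quantize L (s j) = quantize L (s' j)) -> B s -> B s'.
Proof.
move=> fB h; apply: fB => j jM l lL.
have := congr1 (fun f : {ffun _ -> _} => f (Ordinal lL)) (h j jM).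
by rewrite !ffunE /= => e; split => /asboolP; [rewrite e|rewrite -e] => /asboolP.
Qed.

Definition cellset (Q : finType) (c : E -> Q) M (q : {ffun 'I_M -> Q}) : set (nat -> E) :=
  [set s | [ffun j : 'I_M => c (s j)] = q].

(** The order of the quantifiers matters: one [v] serves every injective reindexing and every
    unvisited [y], which yields stationarity and independence together. The argument [I] provides a
    reference index for the cell masses. *)
Lemma findet_law M L B : mseq L -> findet M L B -> I ->
  exists v : R, forall (io : nat -> I) y A, injective io -> (forall j, io j != y) ->
    measurable A -> prob P [set w | B (traj io w) /\ A (xi y w)] = v * prob P (xi y @^-1` A).
Proof.
move=> mL fB i0; pose Q := {ffun 'I_(size L) -> bool} : finType; pose c : E -> Q := quantize L.
have mc q : measurable (c @^-1` [set q]) by exact: measurable_quantize.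
(* [B] is a union of cells, so meeting a cell and containing it are the same; [S] marks these
   cells. *)
pose S (q : {ffun 'I_M -> Q}) := exists2 s, B s & cellset c q s.
exists (\sum_q (`[< S q >])%:R * \prod_j qmass P xi c i0 (q j)) => io y A inj yio mA.
pose tau (w : Om) : {ffun 'I_M -> Q} * bool := ([ffun j : 'I_M => c (xi (io j) w)], `[< A (xi y w) >]).
have ftau : finval tau.
  apply: finval_pair; last exact: (finval_asbool (measurable_xi iid_xi y mA)).
  by apply: (finval_ffun [ffun=> false]) => j; exact: (finval_q iid_xi mc).
have BS w : B (traj io w) <-> S (tau w).1.
  split => [Bw|[s Bs]]; first by exists (traj io w).
  rewrite /cellset /= => e; apply: findet_quantize fB _ Bs => j jM.
  have := congr1 (fun f : {ffun 'I_M -> Q} => f (Ordinal jM)) e.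
  by rewrite !ffunE.
have mB1 : measurable (traj io @^-1` B).
  rewrite (_ : _ @^-1` _ = tau @^-1` [set x | S x.1]); first exact: finval_preimage.
  by apply/seteqP; split => w /= /BS.
have mB : measurable [set w | B (traj io w) /\ A (xi y w)].
  exact: (measurableI _ _ mB1 (measurable_xi iid_xi y mA)).
rewrite -EP_asbool//.
rewrite (_ : (fun _ => _) = fun w => (`[< S (tau w).1 >] && (tau w).2)%:R); last first.
  apply/funext => w; congr (_%:R); congr nat_of_bool; rewrite -asbool_and /=.
  by apply: asbool_equiv_eq; split => -[] /BS.
rewrite (EP_finite P (fun x => (`[< S x.1 >] && x.2)%:R)); last first.
  by move=> x; exact: finval_preimage.
rewrite (eq_bigr (fun x => (`[< S x.1 >] && x.2)%:R * prob P (tau @^-1` [set (x.1, x.2)]))); last first.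
  by case.
rewrite -(pair_bigA _ (fun q b => (`[< S q >] && b)%:R * prob P (tau @^-1` [set (q, b)]))) /=.
rewrite mulr_suml; apply: eq_bigr => q _.
rewrite (bigD1 true)//= big1 ?addr0 => [|b]; last by case: b => //; rewrite andbF mul0r.
rewrite andbT -mulrA; congr (_ * _).
(* The extra index [inl tt] carries [y], so that a single use of [indep_fin] treats it together with
   the trajectory. *)
pose ka (k : unit + 'I_M) : I := match k with inl _ => y | inr j => io j end.
pose BB (k : unit + 'I_M) : set E := match k with inl _ => A | inr j => c @^-1` [set q j] end.
have ika : injective ka.
  move=> [[]|j] [[]|j'] //= => [/eqP|/eqP|/inj/val_inj -> //]; last by rewrite (negbTE (yio _)).
  by rewrite eq_sym (negbTE (yio _)).
have mBB k : measurable (BB k) by case: k => [u|j] //=.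
have := indep_fin iid_xi ika mBB.
rewrite big_sumType /= (big_pred1 tt) => [|[]//]; rewrite mulrC => e.
rewrite (eq_bigr (fun j : 'I_M => prob P (xi (io j) @^-1` (c @^-1` [set q j])))); last first.
  by move=> j _; rewrite -(qmassE iid_xi mc i0 (io j)).
rewrite -e; congr (prob P _); apply/seteqP; split => w /=.
  by move=> [qe /asboolP Aw] [u|j] //=; rewrite -qe ffunE.
move=> h; congr (_, _); last by apply/asboolP; exact: (h (inl tt)).
by apply/ffunP => j; rewrite ffunE; exact: (h (inr j)).
Qed.

(** Exact for a finitely determined approximant, by [findet_law]; replacing [B] by it costs [e / 2]
    on each side, for arbitrary [e]. *)
Lemma traj_law (io io' : nat -> I) y y' B A : injective io -> injective io' ->
  (forall j, io j != y) -> (forall j, io' j != y') -> scyl B -> measurable A ->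
  prob P [set w | B (traj io w) /\ A (xi y w)] =
  prob P (traj io' @^-1` B) * prob P (xi y @^-1` A).
Proof.
move=> inj inj' yio yio' sB mA; apply/eqP; rewrite -subr_eq0 -normr_le0.
apply/ler_addgt0Pr => e e0; rewrite add0r.
have e20 : 0 < e / 2 by rewrite divr_gt0.
have [M [L [B' [mL fB sB' B1 B2]]]] := scyl_approximable iid_xi io io' sB e20.
have [v hv] := findet_law mL fB y.
have mtr j C : scyl C -> measurable (traj j @^-1` C) by move=> sC; exact: (measurable_traj iid_xi).
have mx : measurable (xi y @^-1` A) by exact: (measurable_xi iid_xi).
have v' : prob P (traj io' @^-1` B') = v.
  have := hv io' y' setT inj' yio' measurableT.
  rewrite preimage_setT prob_setT mulr1 => <-; congr (prob P _).
  by apply/seteqP; split => w //= -[].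
have d1 : `|prob P [set w | B (traj io w) /\ A (xi y w)]
    - prob P [set w | B' (traj io w) /\ A (xi y w)]| <= e / 2.
  apply: le_trans B1; apply: prob_dist.
  - exact: measurableI (mtr _ _ sB) mx.
  - exact: measurableI (mtr _ _ sB') mx.
  - exact: (measurable_traj_xor iid_xi).
  - by move=> w /= /contrapT h; split=> -[/h ? ?]; split.
have d2 : `|prob P (traj io' @^-1` B) - prob P (traj io' @^-1` B')| <= e / 2.
  apply: le_trans B2; apply: prob_dist; try exact: mtr.
  - exact: (measurable_traj_xor iid_xi).
  - by move=> w /= /contrapT.
rewrite (_ : _ - _ = (prob P [set w | B (traj io w) /\ A (xi y w)]
    - prob P [set w | B' (traj io w) /\ A (xi y w)])
  - (prob P (traj io' @^-1` B) - prob P (traj io' @^-1` B')) * prob P (xi y @^-1` A)); last first.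
  by rewrite (hv io y A)// v'; ring.
apply: le_trans (ler_normB _ _) _; rewrite [leRHS](splitr e); apply: lerD => //.
rewrite normrM [`|prob P (xi y @^-1` A)|]ger0_norm ?prob_ge0//.
by apply: le_trans (ler_piMr (normr_ge0 _) (prob_le1 P mx)) d2.
Qed.

End Law.

(** * Conditional probabilities on cells and their perturbation *)

Section CellAverage.
Context {R : realType} d (Om : measurableType d) (P : probability Om R).
Context dE (E : measurableType dE) (eps : int -> Om -> E) (epss : Om -> E).
Local Notation xi := (fam eps epss).
Hypothesis iid_xi : iid P xi.

(** Both pasts are injective reindexings of one i.i.d. family indexed by [option int]. [io_past]
    avoids [None] and [io_star] avoids [Some 0], so in each case the innovation left out is
    independent of the trajectory. *)
Definition io_past (i : int) (j : nat) : option int := Some (i - j%:Z).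
Definition io_star (i : int) (j : nat) : option int :=
  if i - j%:Z == 0 then None else Some (i - j%:Z).

Lemma traj_past i w : traj xi (io_past i) w = past eps i w.
Proof. by []. Qed.

Lemma traj_star i w : traj xi (io_star i) w = pastS eps epss i w.
Proof. by apply/funext => j; rewrite /traj /io_star /pastS; case: eqP. Qed.

Lemma io_past_inj i : injective (io_past i).
Proof. by move=> j j' [] h; lia. Qed.

Lemma io_star_inj i : injective (io_star i).
Proof. by move=> j j'; rewrite /io_star; case: eqP => h; case: eqP => h' //; [|case]; lia. Qed.

Lemma io_past_neq i j : io_past i j != None. Proof. by []. Qed.

Lemma io_star_neq i j : io_star i j != Some 0.
Proof. by rewrite /io_star; case: ifPn. Qed.

Context {Q : finType} (c : E -> Q).
Hypothesis mc : forall q, measurable (c @^-1` [set q]).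
Variable M : nat.

Local Notation T := {ffun 'I_M -> Q}.
Definition qm : Q -> R := qmass P xi c (Some 0).
Definition cellmass (q : T) : R := \prod_j qm (q j).

Lemma qm_ge0 q : 0 <= qm q. Proof. exact: qmass_ge0. Qed.
Lemma qm_sum1 : \sum_q qm q = 1. Proof. exact: (qmass_sum1 iid_xi mc). Qed.
Lemma cellmass_ge0 q : 0 <= cellmass q.
Proof. by apply: prodr_ge0 => j _; exact: qm_ge0. Qed.

Lemma scyl_cellset (q : T) : scyl (cellset c q).
Proof.
pose F (j : nat) : set (nat -> E) :=
  if insub j is Some j' then ~` [set s | (c @^-1` [set q j']) (s j)] else set0.
rewrite (_ : cellset c q = ~` \bigcup_j F j).
  apply: scylC; apply: scyl_bigcup => j; rewrite /F; case: insubP => [j' _ _|_].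
    by apply: scylC; apply: scyl_cyl; exact: mc.
  exact: scyl_set0.
apply/seteqP; split => s /=.
  move=> qe [j _]; rewrite /F; case: insubP => [j' _ jj'|//] /=.
  by rewrite -qe ffunE -jj'.
move=> h; apply/ffunP => j; rewrite ffunE; apply: contrapT => h'.
by apply: h; exists (j : nat) => //; rewrite /F valK.
Qed.

Lemma prob_cellset io (q : T) : injective io ->
  prob P (traj xi io @^-1` cellset c q) = cellmass q.
Proof.
move=> inj; rewrite /cellmass /qm -(prob_cells iid_xi mc (Some 0) (ka := fun j : 'I_M => io j)).
  by congr (prob P _).
by move=> j j' /inj/val_inj.
Qed.

Variable B : set (nat -> E).
Hypothesis sB : scyl B.

Definition joint (q : T) : R := prob P (traj xi (io_past 0) @^-1` (B `&` cellset c q)).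
(* Conditional probability of [B] given the quantized last [M] innovations, with value
   [0] on null cells. *)
Definition cellavg (q : T) : R := joint q / cellmass q.

Let mtr io C : scyl C -> measurable (traj xi io @^-1` C).
Proof. by move=> sC; exact: (measurable_traj iid_xi). Qed.

Lemma joint_ge0 q : 0 <= joint q. Proof. exact: prob_ge0. Qed.

Lemma joint_le q : joint q <= cellmass q.
Proof.
rewrite -(prob_cellset q (@io_past_inj 0)); apply: prob_le.
- by apply: mtr; apply: scylI => //; exact: scyl_cellset.
- by apply: mtr; exact: scyl_cellset.
- by move=> w [].
Qed.

Lemma cellavgM q : cellmass q * cellavg q = joint q.
Proof.
have [m0|m0] := eqVneq (cellmass q) 0; last by rewrite mulrC divfK.
by rewrite m0 mul0r; apply/esym/eqP; rewrite eq_le joint_ge0 -m0 joint_le.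
Qed.

Lemma cellavg01 q : 0 <= cellavg q <= 1.
Proof.
have := cellmass_ge0 q; rewrite le_eqVlt => /predU1P[m0|m0].
  by rewrite /cellavg -m0 invr0 mulr0 lexx ler01.
apply/andP; split; first by rewrite divr_ge0 ?joint_ge0 ?cellmass_ge0.
by rewrite /cellavg ler_pdivrMr// mul1r joint_le.
Qed.

Lemma finval_cell io : finval (fun w => [ffun j : 'I_M => c (traj xi io w j)]).
Proof.
have [q0 _|Q0] := pickP (pred_of_simpl (@predT Q)).
  by apply: (finval_ffun q0) => j; exact: (finval_q iid_xi mc).
have := qm_sum1; rewrite big1 => [/esym/eqP|q _]; first by rewrite oner_eq0.
by have := Q0 q.
Qed.

Lemma sum_cellavg : \sum_q cellmass q * cellavg q = prob P (traj xi (io_past 0) @^-1` B).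
Proof.
under eq_bigr do rewrite cellavgM.
rewrite [RHS](prob_partition P (mtr _ sB) (tau := fun w => [ffun j : 'I_M => c (traj xi (io_past 0) w j)])) //.
by move=> q; exact: (finval_preimage _ (finval_cell _)).
Qed.

(** On a cell of mass [v] with conditional probability [h], the left side is [2 v h (1 - h)], at
    most twice the smaller of the two parts [v h] and [v (1 - h)]. As [B'] is constant on the cell,
    one of these parts lies wholly in the discrepancy of [B] and [B']. *)
Lemma cellavg_approx io y (B' : set (nat -> E)) : injective io -> (forall j, io j != y) ->
  scyl B' -> (forall (q : T) s s', cellset c q s -> cellset c q s' -> B' s -> B' s') ->
  EP P (fun w => `|(`[< B (traj xi io w) >])%:R - cellavg [ffun j : 'I_M => c (traj xi io w j)]|)
  <= 2 * prob P [set w | ~ (B (traj xi (io_past 0) w) <-> B' (traj xi (io_past 0) w))].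
Proof.
move=> inj yio sB' fB'.
pose cl io w : T := [ffun j : 'I_M => c (traj xi io w j)].
pose tau w := (cl io w, `[< B (traj xi io w) >]).
have ft : finval tau by exact: (finval_pair (finval_cell io) (finval_asbool (mtr io sB))).
have sI (q : T) : scyl (B `&` cellset c q) by apply: scylI => //; exact: scyl_cellset.
have sD (q : T) : scyl (cellset c q `\` B).
  by rewrite setDE; apply: scylI; [exact: scyl_cellset|exact: scylC].
have law C : scyl C -> prob P (traj xi io @^-1` C) = prob P (traj xi (io_past 0) @^-1` C).
  move=> sC; have := traj_law iid_xi inj (@io_past_inj 0) yio (@io_past_neq 0) sC measurableT.
  rewrite preimage_setT prob_setT mulr1 => <-; congr (prob P _).
  by apply/seteqP; split => w //= -[].
have Jt (q : T) : prob P (tau @^-1` [set (q, true)]) = joint q.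
  rewrite /joint -law//; congr (prob P _); apply/seteqP; split => w /=.
    by move=> [<- /asboolP].
  by move=> [Bw <-]; rewrite /tau; congr (_, _); exact/asboolP.
have Jf (q : T) : prob P (tau @^-1` [set (q, false)]) = cellmass q - joint q.
  suff -> : cellmass q = joint q + prob P (tau @^-1` [set (q, false)]) by rewrite addrC addKr.
  rewrite -(prob_cellset q inj) -(Jt q).
  rewrite (prob_partition P (mtr io (scyl_cellset q)) (tau := fun w => `[< B (traj xi io w) >])).
    rewrite big_bool /=; congr (_ + _); congr (prob P _); apply/seteqP; split => w /=.
    - by move=> [cw bw]; rewrite /tau bw /cl; congr (_, _).
    - by move=> [cw bw].
    - by move=> [cw bw]; rewrite /tau bw /cl; congr (_, _).
    - by move=> [cw bw].
  by move=> b; exact: (finval_preimage _ (finval_asbool (mtr io sB))).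
rewrite (EP_finite P (fun x : T * bool => `|x.2%:R - cellavg x.1|) (tau := tau)); last first.
  by move=> x; exact: finval_preimage.
rewrite (eq_bigr (fun x : T * bool => `|x.2%:R - cellavg x.1| * prob P (tau @^-1` [set (x.1, x.2)]))); last by case.
rewrite -(pair_bigA _ (fun q (b : bool) => `|b%:R - cellavg q| * prob P (tau @^-1` [set (q, b)]))) /=.
pose X q := prob P ([set w | ~ (B (traj xi (io_past 0) w) <-> B' (traj xi (io_past 0) w))]
    `&` (cl (io_past 0)) @^-1` [set q]).
have mcl q : measurable (cl (io_past 0) @^-1` [set q]).
  exact: (finval_preimage _ (finval_cell _)).
have mX : measurable [set w | ~ (B (traj xi (io_past 0) w) <-> B' (traj xi (io_past 0) w))].
  exact: (measurable_traj_xor iid_xi).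
rewrite [in leRHS](prob_partition P mX mcl) mulr_sumr; apply: ler_sum => q _.
rewrite big_bool /= Jt Jf.
have /andP[h0 h1] := cellavg01 q.
have J0 := joint_ge0 q; have Jm := joint_le q; have hJ := cellavgM q.
rewrite ger0_norm ?subr_ge0// sub0r normrN ger0_norm//.
have [[s [cs Bs]]|nB] := pselect (exists s, cellset c q s /\ B' s).
  have : cellmass q - joint q <= X q.
    rewrite -Jf (_ : _ @^-1` _ = traj xi io @^-1` (cellset c q `\` B)).
      rewrite law//; apply: prob_le; [exact: mtr|exact: measurableI|].
      move=> w [cw nBw]; split => //= h; apply: nBw; apply/h.
      by apply: fB' Bs; [exact: cs|exact: cw].
    apply/seteqP; split => w /=.
      by move=> [<- /negbT/asboolPn].
    by move=> [<- nBw]; congr (_, _); apply/negbTE/asboolPn.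
  rewrite /X; nra.
have : joint q <= X q.
  apply: prob_le; [exact: mtr|exact: measurableI|].
  move=> w [Bw cw]; split => //= h; apply: nB; exists (traj xi (io_past 0) w); split => //.
  exact/h.
rewrite /X; nra.
Qed.

Definition upd (q : T) (l : 'I_M) (x : Q) : T := [ffun j => if j == l then x else q j].

(** At time [l] the innovation of time 0 occupies lag [l], where the starred past carries [epss]
    instead. By [ev], the past in cell [q] with [epss] in [x] is the same event as the starred past
    in cell [upd q l x] with [eps 0] in [q l]. Intersecting it with [B] of either past and using
    independence, the two averages differ, after weighting, by at most the probability of
    disagreement inside that event. *)
Lemma cellavg_perturb (l : 'I_M) :
  \sum_q \sum_x cellmass q * qm x * (cellavg q - cellavg (upd q l x)) ^+ 2 <=
  prob P [set w | ~ (B (past eps (l : nat)%:Z w) <-> B (pastS eps epss (l : nat)%:Z w))].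
Proof.
pose ll : int := (l : nat)%:Z.
pose tau w := ([ffun j : 'I_M => c (traj xi (io_past ll) w j)], c (xi None w)).
have ft : finval tau by exact: (finval_pair (finval_cell _) (finval_q iid_xi mc None)).
pose D := [set w | ~ (B (traj xi (io_past ll) w) <-> B (traj xi (io_star ll) w))].
have mD : measurable D by apply: measurable_xor; exact: mtr.
have -> : [set w | ~ (B (past eps ll w) <-> B (pastS eps epss ll w))] = D.
  by apply/seteqP; split => w /=; rewrite /D /= traj_star.
rewrite (prob_partition P mD (fun x => finval_preimage [set x] ft)).
rewrite (eq_bigr (fun x => prob P (D `&` tau @^-1` [set (x.1, x.2)]))); last by case.
rewrite -(pair_bigA _ (fun q x => prob P (D `&` tau @^-1` [set (q, x)]))) /=.
apply: ler_sum => q _; apply: ler_sum => x _.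
set q1 := upd q l x.
have sI (q2 : T) : scyl (B `&` cellset c q2) by apply: scylI => //; exact: scyl_cellset.
have A1 : prob P [set w | (B `&` cellset c q) (traj xi (io_past ll) w) /\ (c @^-1` [set x]) (xi None w)]
    = joint q * qm x.
  rewrite (traj_law iid_xi (@io_past_inj ll) (@io_past_inj 0) (@io_past_neq ll) (@io_past_neq 0) (sI q) (mc x)).
  by rewrite /qm -(qmassE iid_xi mc (Some 0) None x).
have A2 : prob P [set w | (B `&` cellset c q1) (traj xi (io_star ll) w) /\ (c @^-1` [set q l]) (xi (Some 0) w)]
    = joint q1 * qm (q l).
  by rewrite (traj_law iid_xi (@io_star_inj ll) (@io_past_inj 0) (@io_star_neq ll) (@io_past_neq 0) (sI q1) (mc (q l))).
have mass : cellmass q * qm x = cellmass q1 * qm (q l).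
  rewrite /cellmass (bigD1 l)//= [in RHS](bigD1 l)//= {1}/q1 ffunE eqxx.
  rewrite mulrAC [RHS]mulrAC [qm x * qm (q l)]mulrC; congr (_ * _).
  by apply: eq_bigr => j jl; rewrite /q1 ffunE (negbTE jl).
have ev w : cellset c q (traj xi (io_past ll) w) /\ c (xi None w) = x <->
    cellset c q1 (traj xi (io_star ll) w) /\ c (xi (Some 0) w) = q l.
  have st (j : 'I_M) : traj xi (io_star ll) w j =
      if j == l then xi None w else traj xi (io_past ll) w j.
    rewrite /traj /io_star /io_past; have -> : (ll - (j : nat)%:Z == 0) = (j == l).
      by apply/eqP/eqP => [h|->]; [apply: val_inj => /=; rewrite /ll in h; lia|rewrite /ll; lia].
    by case: eqP.
  have p0 : traj xi (io_past ll) w l = xi (Some 0) w.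
    by rewrite /traj /io_past /ll subrr.
  split => -[/ffunP h e]; split.
  - apply/ffunP => j; rewrite /q1 !ffunE st; case: eqP => // _.
    by have := h j; rewrite ffunE.
  - by rewrite -p0; have := h l; rewrite ffunE.
  - apply/ffunP => j; have := h j; rewrite /q1 !ffunE st; case: eqP => // -> _.
    by rewrite p0.
  - by have := h l; rewrite /q1 !ffunE st eqxx.
have mxi i A : measurable A -> measurable (xi i @^-1` A).
  by move=> mA; exact: (measurable_xi iid_xi).
have W0 : 0 <= cellmass q * qm x by rewrite mulr_ge0 ?cellmass_ge0 ?qm_ge0.
have e1 : cellmass q * qm x * cellavg q = joint q * qm x.
  by rewrite mulrAC cellavgM.
have e2 : cellmass q * qm x * cellavg q1 = joint q1 * qm (q l).
  by rewrite mass mulrAC cellavgM.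
have main : `|cellmass q * qm x * (cellavg q - cellavg q1)| <= prob P (D `&` tau @^-1` [set (q, x)]).
  rewrite mulrBr e1 e2 -A1 -A2; apply: prob_dist.
  - exact: (measurableI _ _ (mtr _ (sI q)) (mxi None _ (mc x))).
  - exact: (measurableI _ _ (mtr _ (sI q1)) (mxi (Some 0) _ (mc (q l)))).
  - by apply: measurableI => //; exact: finval_preimage.
  move=> w nDC; have h : cellset c q (traj xi (io_past ll) w) /\ c (xi None w) = x ->
      (B (traj xi (io_past ll) w) <-> B (traj xi (io_star ll) w)).
    move=> [c1 c2]; apply: contrapT => nB; apply: nDC; split => //=.
    by rewrite /tau c2; congr (_, _).
  have := ev w; rewrite /=; tauto.
(* Both averages lie in the unit interval, so the square of their difference is below its absolute
   value. *)
apply: le_trans main; rewrite normrM (ger0_norm W0) ler_wpM2l//.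
rewrite -real_normK ?num_real// expr2 ler_piMr//.
have /andP[a0 a1] := cellavg01 q; have /andP[b0 b1] := cellavg01 q1.
by rewrite ler_norml; apply/andP; split; lra.
Qed.

End CellAverage.

Lemma le_of_approx (R : realType) (x y C : R) :
  0 <= C -> (forall e, 0 < e -> x <= y + C * e) -> x <= y.
Proof.
move=> C0 h; apply/ler_addgt0Pr => e e0.
apply: le_trans (h (e / (C + 1)) _) _; first by rewrite divr_gt0// ltr_wpDl.
rewrite lerD2l mulrA ler_pdivrMr ?ltr_wpDl// mulrC ler_pM2l// lerDl.
by [].
Qed.

Section Window.
Context {R : realType} d (Om : measurableType d) (P : probability Om R).
Context dE (E : measurableType dE) (eps : int -> Om -> E) (epss : Om -> E).
Local Notation xi := (fam eps epss).
Hypothesis iid_xi : iid P xi.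
Context {Q : finType} (c : E -> Q).
Hypothesis mc : forall q, measurable (c @^-1` [set q]).
Variables (n M : nat).
Local Notation T := {ffun 'I_(n + M) -> Q}.
Local Notation Ex := (fexp (pweight (I := 'I_(n + M)) (qm P eps epss c))).

Fact widx_subproof (i : 'I_n) (l : 'I_M) : (i + (M - l.+1) < n + M)%N.
Proof. by have := ltn_ord i; have := ltn_ord l; lia. Qed.

(** Lags run backwards and coordinates forwards in time, hence the reversal. *)
Definition widx (i : 'I_n) (l : 'I_M) : 'I_(n + M) := Ordinal (widx_subproof i l).

Lemma widx_inj i : injective (widx i).
Proof.
move=> l l' /(congr1 val) /= h; apply: val_inj => /=.
by have := ltn_ord l; have := ltn_ord l'; lia.
Qed.

Definition win (i : 'I_n) (w : T) : {ffun 'I_M -> Q} := [ffun l => w (widx i l)].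

(* Coordinate [r] carries the innovation of time [r - M + 2], so that the past of time
   [i + 1] occupies the coordinates [i, ..., i + M - 1]. *)
Definition rtime (r : 'I_(n + M)) : int := (r : nat)%:Z - M%:Z + 2.

Lemma rtime_inj : injective (fun r => Some (rtime r)).
Proof. by move=> r r' [] h; apply: val_inj => /=; move: h; rewrite /rtime; lia. Qed.

Definition wvec (w : Om) : T := [ffun r => c (eps (rtime r) w)].

Lemma win_wvec i w : win i (wvec w) = [ffun l : 'I_M => c (past eps (i.+1)%:Z w l)].
Proof.
apply/ffunP => l; rewrite !ffunE /past; congr (c (eps _ w)).
by rewrite /rtime /=; have := ltn_ord l; lia.
Qed.

Lemma win_merge i l (w w' : T) :
  win i (merge [set widx i l]%SET w' w) = upd (win i w) l (w' (widx i l)).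
Proof.
apply/ffunP => j; rewrite !ffunE inE.
by case: (eqVneq j l) => [->|jl]; rewrite ?eqxx // (inj_eq (@widx_inj i)) (negbTE jl).
Qed.

Lemma finval_wvec : finval wvec.
Proof.
have [q0 _|Q0] := pickP (pred_of_simpl (@predT Q)).
  by apply: (finval_ffun q0) => r; exact: (finval_q iid_xi mc (Some (rtime r))).
have := qm_sum1 iid_xi mc; rewrite big1 => [/esym/eqP|q _]; first by rewrite oner_eq0.
by have := Q0 q.
Qed.

Lemma EP_wvec (F : T -> R) : EP P (fun w => F (wvec w)) = Ex F.
Proof.
rewrite (EP_finite P F (fun x => finval_preimage [set x] finval_wvec)).
apply: eq_bigr => q _; rewrite mulrC; congr (_ * _).
rewrite /pweight /qm -(prob_cells iid_xi mc (Some 0) q rtime_inj).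
by congr (prob P _).
Qed.

Lemma fexp_win i (G : {ffun 'I_M -> Q} -> R) :
  Ex (fun w => G (win i w)) = \sum_q cellmass P eps epss c q * G q.
Proof.
rewrite -EP_wvec; pose tau w : {ffun 'I_M -> Q} := win i (wvec w).
have ft : finval tau by exact: (finval_comp (win i) finval_wvec).
rewrite (EP_finite P G (fun x => finval_preimage [set x] ft)).
apply: eq_bigr => q _; rewrite mulrC; congr (_ * _).
rewrite -(prob_cellset iid_xi mc q (@io_past_inj (i.+1)%:Z)).
by congr (prob P _); apply/seteqP; split => w /=; rewrite /tau win_wvec.
Qed.

Lemma fexp_coord (r : 'I_(n + M)) (g : Q -> R) :
  Ex (fun w => g (w r)) = \sum_q qm P eps epss c q * g q.
Proof.
rewrite -(EP_wvec (fun w => g (w r))).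
have -> : (fun w => g (wvec w r)) = fun w => g (c (xi (Some (rtime r)) w)).
  by apply/funext => w; rewrite ffunE.
rewrite (EP_finite P g (tau := fun w => c (xi (Some (rtime r)) w))); last first.
  by move=> q; exact: (finval_preimage [set q] (finval_q iid_xi mc _)).
apply: eq_bigr => q _; rewrite mulrC; congr (_ * _).
exact: (qmassE iid_xi mc (Some 0) (Some (rtime r))).
Qed.

End Window.

(** * Weighted sums of indicators of two events of the past *)

Section WeightedIndicators.
Context {R : realType} d (Om : measurableType d) (P : probability Om R).
Context dE (E : measurableType dE) (eps : int -> Om -> E) (epss : Om -> E).
Local Notation xi := (fam eps epss).
Hypothesis iid_xi : iid P xi.
Variables (n : nat) (B : 'I_2 -> set (nat -> E)) (a : 'I_n -> 'I_2 -> R).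
Hypothesis sB : forall k, scyl (B k).
Variables (al : 'I_2 -> R) (dd : 'I_2 -> nat -> R).
Hypothesis alE : forall k, prob P (past eps 0 @^-1` B k) = al k.
Hypothesis ddP : forall k l,
  prob P [set w | ~ (B k (past eps l%:Z w) <-> B k (pastS eps epss l%:Z w))] <= dd k l.
Variables (b : 'I_n -> R) (delta : nat -> R) (eta : R).
Hypothesis b_ge0 : forall i, 0 <= b i.
Hypothesis delta_ge0 : forall l, 0 <= delta l.
Hypothesis ab : forall i l, \sum_k 2 * a i k ^+ 2 * dd k l <= (b i * delta l) ^+ 2.
Hypothesis a_eta : forall i, \sum_k `|a i k| <= eta.

Definition wsum (w : Om) : R :=
  \sum_i \sum_k a i k * ((`[< B k (past eps (i.+1)%:Z w) >])%:R - al k).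

Lemma al01 k : 0 <= al k <= 1.
Proof.
rewrite -alE prob_ge0 prob_le1//.
exact: (measurable_traj iid_xi (io_past 0) (sB k)).
Qed.

Lemma finval_past (i : int) k : finval (fun w => `[< B k (past eps i w) >]).
Proof. exact: (finval_asbool (measurable_traj iid_xi (io_past i) (sB k))). Qed.

Lemma finval_wsum : finval wsum.
Proof.
apply: finval_sum => i; apply: finval_sum => k.
exact: (finval_comp (fun v : bool => a i k * (v%:R - al k)) (finval_past _ k)).
Qed.

Section Approx.
Context {Q : finType} (c : E -> Q) (M : nat).
Hypothesis mc : forall q, measurable (c @^-1` [set q]).
Local Notation T := {ffun 'I_(n + M) -> Q}.
Local Notation Ex := (fexp (pweight (I := 'I_(n + M)) (qm P eps epss c))).
Local Notation h := (fun k (q : {ffun 'I_M -> Q}) => cellavg P eps epss c (B k) q).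

Definition wY (i : 'I_n) (w : T) : R := \sum_k a i k * (h k (win i w) - al k).

Lemma wY_low (i : 'I_n) : indep_of (@low n M i) (wY i).
Proof.
move=> w w'; apply: eq_bigr => k _; congr (_ * (cellavg _ _ _ _ _ _ - _)).
apply/ffunP => l; rewrite !ffunE inE /=.
by rewrite ltnNge leq_addr.
Qed.

Lemma wY_high (i : 'I_n) : indep_of (~: @low n M (i + M))%SET (wY i).
Proof.
move=> w w'; apply: eq_bigr => k _; congr (_ * (cellavg _ _ _ _ _ _ - _)).
apply/ffunP => l; rewrite !ffunE !inE /=.
by have -> : (i + (M - l.+1) < i + M)%N by have := ltn_ord l; lia.
Qed.

Lemma wY_mean i : Ex (wY i) = 0.
Proof.
rewrite /wY fexp_sum big1// => k _; rewrite fexpZ fexpB.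
rewrite (fexp_win iid_xi mc i (h k)) (sum_cellavg iid_xi mc M (sB k)).
rewrite (fexp_cst (pweight_sum1 (qm_sum1 iid_xi mc))).
by rewrite -alE subrr mulr0.
Qed.

Lemma wY_eta i w : `|wY i w| <= eta.
Proof.
apply: le_trans (a_eta i); apply: le_trans (ler_norm_sum _ _ _) _.
apply: ler_sum => k _; rewrite normrM ler_piMr//.
have /andP[h0 h1] := cellavg01 iid_xi mc (sB k) (win i w).
have /andP[a0 a1] := al01 k.
by rewrite ler_norml; apply/andP; split; lra.
Qed.

Lemma wY_dep (i : 'I_n) l (r : 'I_(n + M)) : (l < M)%N -> r = (i + (M - l.+1))%N :> nat ->
  Ex (fun w => Ex (fun w' => (wY i w - wY i (merge [set r]%SET w' w)) ^+ 2)) <= (b i * delta l) ^+ 2.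
Proof.
move=> lM er; pose ll := Ordinal lM.
have -> : r = widx i ll by apply: val_inj.
apply: le_trans (ab i l).
have pw0 := pweight_ge0 (I := 'I_(n + M)) (qm_ge0 P eps epss c).
pose G k (w w' : T) := (h k (win i w) - h k (upd (win i w) ll (w' (widx i ll)))) ^+ 2.
apply: (@le_trans _ _ (Ex (fun w => Ex (fun w' => \sum_k 2 * a i k ^+ 2 * G k w w')))).
  apply: ler_fexp => // w; apply: ler_fexp => // w'.
  rewrite /wY -sumrB win_merge !big_ord_recl !big_ord0 !addr0 /G.
  set x := h ord0 _; set y := h (lift _ _) _.
  set x' := h ord0 _; set y' := h (lift _ _) _.
  set a0 := a i ord0; set a1 := a i (lift _ _).
  rewrite [X in X ^+ 2](_ : _ = a0 * (x - x') + a1 * (y - y')); last by rewrite !mulrBr; ring.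
  (* Two levels: [(u + v)^2 <= 2 u^2 + 2 v^2], the origin of the factor 2 in [ab]. *)
  have := sqr_ge0 (a0 * (x - x') - a1 * (y - y')); nra.
rewrite (eq_fexp _ (G := fun w => \sum_k 2 * a i k ^+ 2 * Ex (G k w))); last first.
  by move=> w; rewrite fexp_sum; apply: eq_bigr => k _; rewrite fexpZ.
rewrite fexp_sum; apply: ler_sum => k _; rewrite fexpZ; apply: ler_wpM2l.
  by apply: mulr_ge0 => //; exact: sqr_ge0.
apply: le_trans (ddP k l).
apply: le_trans (cellavg_perturb iid_xi mc (sB k) ll).
rewrite (eq_fexp _ (G := fun w => \sum_x qm P eps epss c x *
   (h k (win i w) - h k (upd (win i w) ll x)) ^+ 2)); last first.
  move=> w; rewrite -(fexp_coord iid_xi mc (widx i ll)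
    (fun x => (h k (win i w) - h k (upd (win i w) ll x)) ^+ 2)).
  by [].
rewrite (fexp_win iid_xi mc i (fun q => \sum_x qm P eps epss c x *
   (h k q - h k (upd q ll x)) ^+ 2)).
apply: ler_sum => q _; rewrite mulr_sumr; apply: ler_sum => x _.
by rewrite mulrA.
Qed.

Definition wapprox (w : Om) : R := \sum_i wY i (wvec eps c n M w).

Lemma wapprox_dist (e : R) (B' : 'I_2 -> set (nat -> E)) : (forall k, scyl (B' k)) ->
  (forall k (q : {ffun 'I_M -> Q}) s s', cellset c q s -> cellset c q s' -> B' k s -> B' k s') ->
  (forall k, prob P [set w | ~ (B k (traj xi (io_past 0) w) <-> B' k (traj xi (io_past 0) w))] <= e) ->
  EP P (fun w => `|wsum w - wapprox w|) <= 2 * (\sum_i \sum_k `|a i k|) * e.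
Proof.
move=> sB' fB' Be.
pose V i k w := `|(`[< B k (past eps (i.+1)%:Z w) >])%:R
  - h k [ffun l : 'I_M => c (past eps (i.+1)%:Z w l)]| : R.
have fV (i : 'I_n) k : finval (V i k).
  have f2 := finval_pair (finval_past (i.+1)%:Z k) (finval_comp (win i) (finval_wvec iid_xi mc n M)).
  have := finval_comp (fun v => `|(v.1 : bool)%:R - h k v.2| : R) f2.
  by congr finval; apply/funext => w; rewrite /V win_wvec.
have fD : finval (fun w => `|wsum w - wapprox w|).
  have fa : finval wapprox.
    exact: (finval_comp (fun v => \sum_i wY i v) (finval_wvec iid_xi mc n M)).
  exact: (finval_op2 (fun x y => `|x - y|) finval_wsum fa).
apply: (@le_trans _ _ (EP P (fun w => \sum_i \sum_k `|a i k| * V i k w))).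
  apply: EP_le => //.
    apply: finval_sum => i; apply: finval_sum => k.
    exact: (finval_comp (fun v => `|a i k| * v) (fV i k)).
  move=> w; rewrite /wsum /wapprox -sumrB; apply: le_trans (ler_norm_sum _ _ _) _.
  apply: ler_sum => i _; rewrite /wY -sumrB; apply: le_trans (ler_norm_sum _ _ _) _.
  apply: ler_sum => k _; rewrite -mulrBr normrM /V win_wvec.
  by rewrite opprB addrA subrK.
rewrite EP_sum => [|i]; last first.
  by apply: finval_sum => k; exact: (finval_comp (fun v => `|a i k| * v) (fV i k)).
rewrite mulr_sumr mulr_suml; apply: ler_sum => i _.
rewrite EP_sum => [|k]; last exact: (finval_comp (fun v => `|a i k| * v) (fV i k)).
rewrite mulr_sumr mulr_suml; apply: ler_sum => k _.
rewrite EP_Z; last exact: fV.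
rewrite mulrC [leRHS]mulrAC ler_wpM2r//.
apply: le_trans (cellavg_approx iid_xi mc (sB k) (@io_past_inj (i.+1)%:Z)
  (io_past_neq (i.+1)%:Z) (sB' k) (fB' k)) _.
by rewrite ler_wpM2l.
Qed.

Lemma EP_wapprox (F : R -> R) : EP P (fun w => F (wapprox w)) = Ex (fun w => F (\sum_i wY i w)).
Proof. exact: (EP_wvec iid_xi mc (fun v => F (\sum_i wY i v))). Qed.

End Approx.

Let B2 : R := Num.sqrt (\sum_i b i ^+ 2).
Variables (m : nat) (D Dm : R).
Hypothesis sumD : forall M, \sum_(l < M) delta l <= D.
Hypothesis sumDm : forall M, \sum_(m <= l < M) delta l <= Dm.

(** The bounds hold on the product space with constants free of the tolerance [e]. Both sums stay
    below [A], so a mean absolute error [2 A e] becomes [4 A^2 e] in the second moment, and [e]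
    tends to zero with [n] fixed. *)
Lemma wsum_clt (c0 : R) :
  EP P (fun w => wsum w ^+ 2) <= (B2 * D) ^+ 2 /\
  `|EP P (fun w => cos (wsum w + c0)) - cos c0 * expR (- (EP P (fun w => wsum w ^+ 2) / 2))|
  <= B2 * Dm + 2 * B2 ^+ 2 * D * Dm + (20 * m ^ 2)%:R * eta * (B2 * D) ^+ 2.
Proof.
pose A := \sum_i \sum_k `|a i k|.
have A0 : 0 <= A by apply: sumr_ge0 => i _; apply: sumr_ge0 => k _.
have D0 : 0 <= D by have := sumD 0; rewrite big_ord0.
have Dm0 : 0 <= Dm by have := sumDm 0; rewrite big_geq.
have B20 : 0 <= B2 by exact: sqrtr_ge0.
have wS w : `|wsum w| <= A.
  apply: le_trans (ler_norm_sum _ _ _) _; apply: ler_sum => i _.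
  apply: le_trans (ler_norm_sum _ _ _) _; apply: ler_sum => k _.
  have /andP[a0 a1] := al01 k; rewrite normrM ler_piMr//.
  by case: asbool; rewrite /= ?mulr0n ler_norml; apply/andP; split; lra.
have ff (F : R -> R) : finval (fun w => F (wsum w)) by exact: (finval_comp F finval_wsum).
have eta_or : 0 <= eta \/ B2 = 0.
  have [n0|n0] := posnP n.
    right; rewrite /B2 big1 ?sqrtr0// => i _; exfalso.
    by have := ltn_ord i; rewrite {2}n0.
  by left; apply: le_trans (a_eta (Ordinal n0)); apply: sumr_ge0.
have key (e : R) : 0 < e -> exists S' : Om -> R,
   [/\ forall F : R -> R, finval (fun w => F (S' w)),
       EP P (fun w => `|wsum w - S' w|) <= 2 * A * e, (forall w, `|S' w| <= A),
       EP P (fun w => S' w ^+ 2) <= (B2 * D) ^+ 2 &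
     `|EP P (fun w => cos (S' w + c0)) - cos c0 * expR (- (EP P (fun w => S' w ^+ 2) / 2))|
  <= B2 * Dm + 2 * B2 ^+ 2 * D * Dm + (20 * m ^ 2)%:R * eta * (B2 * D) ^+ 2].
  move=> e0.
  (* A single reindexing is of interest here, so it is passed twice. *)
  have ap k := scyl_approximable iid_xi (io_past 0) (io_past 0) (sB k) e0.
  have [M0 [L0 [B0' [mL0 f0 s0 _ p0]]]] := ap ord0.
  have [M1 [L1 [B1' [mL1 f1 s1 _ p1]]]] := ap (lift ord0 ord0).
  (* A common depth and a common list of test sets quantize both levels at once. *)
  pose M := maxn M0 M1; pose L := L0 ++ L1.
  have mL : mseq L by exact: mseq_cat.
  have f0' : findet M L B0' by exact: (findet_widen (L1 := [::]) (L2 := L1) (leq_maxl M0 M1) f0).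
  have f1' : findet M L B1'.
    by have := findet_widen (L1 := L0) (L2 := [::]) (leq_maxr M0 M1) f1; rewrite cats0.
  pose Q := {ffun 'I_(size L) -> bool} : finType; pose c : E -> Q := quantize L.
  have mc q : measurable (c @^-1` [set q]) by exact: measurable_quantize.
  pose B' (k : 'I_2) := if k == ord0 then B0' else B1'.
  have sB' k : scyl (B' k) by rewrite /B'; case: ifP.
  have fB' k (q : {ffun 'I_M -> Q}) s s' : cellset c q s -> cellset c q s' -> B' k s -> B' k s'.
    move=> qs qs'; have fd : findet M L (B' k) by rewrite /B'; case: ifP.
    apply: findet_quantize fd _ => j jM.
    have := congr1 (fun f : {ffun 'I_M -> Q} => f (Ordinal jM)) (etrans qs (esym qs')).
    by rewrite !ffunE.
  have Be k : prob P [set w | ~ (B k (traj xi (io_past 0) w) <-> B' k (traj xi (io_past 0) w))] <= e.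
    rewrite /B'; case: (eqVneq k ord0) => [-> //|k0].
    by have -> : k = lift ord0 ord0 by apply: val_inj; case: k k0 => -[|[|k]].
  pose pw0 := qm_ge0 P eps epss c; pose pw1 := qm_sum1 iid_xi mc.
  have SE : (fun w => wapprox c M w) = fun w => \sum_i wY c (M := M) i (wvec eps c n M w) by [].
  exists (wapprox c M); split.
  - move=> F; exact: (finval_comp (fun v => F (\sum_i wY c i v)) (finval_wvec iid_xi mc n M)).
  - exact: (wapprox_dist mc sB' fB' Be).
  - move=> w; apply: le_trans (ler_norm_sum _ _ _) _; apply: ler_sum => i _.
    apply: le_trans (ler_norm_sum _ _ _) _; apply: ler_sum => k _.
    have /andP[a0 a1] := al01 k; rewrite normrM ler_piMr//.
    have /andP[h0 h1] := cellavg01 iid_xi mc (sB k) (win i (wvec eps c n M w)).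
    by rewrite ler_norml; apply/andP; split; lra.
  - rewrite (EP_wapprox M mc (fun x => x ^+ 2)) -fnrm_sqr; last exact: pweight_ge0.
    rewrite ler_pXn2r ?nnegrE ?fnrm_ge0 ?mulr_ge0//.
    apply: le_trans (fnrm_sumY pw0 pw1 (@wY_low Q c M) (@wY_high Q c M)
      b_ge0 delta_ge0 (@wY_dep Q c M mc) (@wY_mean Q c M mc)) _.
    by rewrite ler_wpM2l.
  - rewrite (EP_wapprox M mc (fun x => x ^+ 2)) (EP_wapprox M mc (fun x => cos (x + c0))).
    apply: le_trans (weakdep_clt pw0 pw1 (@wY_low Q c M) (@wY_high Q c M) (@wY_mean Q c M mc)
      (@wY_eta Q c M mc) b_ge0 delta_ge0 (@wY_dep Q c M mc) m c0) _.
    have sD0 : 0 <= \sum_(l < M) delta l by apply: sumr_ge0.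
    have sDm0 : 0 <= \sum_(m <= l < M) delta l by apply: sumr_ge0.
    apply: lerD; first apply: lerD; first by rewrite ler_wpM2l.
      rewrite -[leLHS]mulrA -[leRHS]mulrA; apply: ler_wpM2l; last exact: ler_pM.
      by apply: mulr_ge0 => //; exact: sqr_ge0.
    rewrite -/B2; case: eta_or => [eta0|b20]; last by rewrite b20 !mul0r.
    apply: ler_wpM2l; first by apply: mulr_ge0; [exact: ler0n|exact: eta0].
    by rewrite ler_pXn2r ?nnegrE ?mulr_ge0// ler_wpM2l.
have CA0 : 0 <= 4 * A ^+ 2 + 2 * A by rewrite addr_ge0// mulr_ge0// sqr_ge0.
have E2 (S' : Om -> R) e : (forall F : R -> R, finval (fun w => F (S' w))) ->
    EP P (fun w => `|wsum w - S' w|) <= 2 * A * e -> (forall w, `|S' w| <= A) ->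
    `|EP P (fun w => wsum w ^+ 2) - EP P (fun w => S' w ^+ 2)| <= 4 * A ^+ 2 * e.
  move=> fS' dS' S'A; have f2 (F : R -> R -> R) : finval (fun w => F (wsum w) (S' w)).
    exact: (finval_op2 F finval_wsum (fS' id)).
  rewrite -EP_B; last 2 first.
  - exact: (ff (fun x => x ^+ 2)).
  - exact: (fS' (fun x => x ^+ 2)).
  apply: le_trans (EP_norm _ (f2 (fun x y => x ^+ 2 - y ^+ 2))) _.
  apply: (@le_trans _ _ (EP P (fun w => (2 * A) * `|wsum w - S' w|))).
    apply: EP_le; [exact: (f2 (fun x y => `|x ^+ 2 - y ^+ 2|))|
      exact: (f2 (fun x y => (2 * A) * `|x - y|))|] => w.
    rewrite subr_sqr normrM mulrC ler_wpM2r//.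
    apply: le_trans (ler_normD _ _) _; have := wS w; have := S'A w; lra.
  rewrite EP_Z; last exact: (f2 (fun x y => `|x - y|)).
  apply: le_trans (ler_wpM2l _ dS') _; first by rewrite mulr_ge0.
  by rewrite le_eqVlt; apply/orP; left; apply/eqP; ring.
split; apply: (le_of_approx CA0) => e e0;
  have [S' [fS' dS' S'A S'1 S'2]] := key e e0; have h2 := E2 S' e fS' dS' S'A.
  have : EP P (fun w => wsum w ^+ 2) - EP P (fun w => S' w ^+ 2) <= 4 * A ^+ 2 * e.
    exact: le_trans (ler_norm _) h2.
  rewrite lerBlDr => h; apply: le_trans h _; rewrite addrC; apply: lerD => //.
  by rewrite [leRHS]mulrDl lerDl; apply: mulr_ge0 => //; [apply: mulr_ge0|exact: ltW].
have f2 (F : R -> R -> R) : finval (fun w => F (wsum w) (S' w)).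
  exact: (finval_op2 F finval_wsum (fS' id)).
have h1 : `|EP P (fun w => cos (wsum w + c0)) - EP P (fun w => cos (S' w + c0))| <= 2 * A * e.
  rewrite -EP_B; last 2 first.
  - exact: (ff (fun x => cos (x + c0))).
  - exact: (fS' (fun x => cos (x + c0))).
  apply: le_trans (EP_norm _ (f2 (fun x y => cos (x + c0) - cos (y + c0)))) _.
  apply: le_trans dS'; apply: EP_le; [exact: (f2 (fun x y => `|cos (x + c0) - cos (y + c0)|))|
      exact: (f2 (fun x y => `|x - y|))|] => w.
  by apply: le_trans (cos_lipschitz _ _) _; rewrite opprD addrACA subrr addr0.
have h3 : `|expR (- (EP P (fun w => S' w ^+ 2) / 2)) - expR (- (EP P (fun w => wsum w ^+ 2) / 2))|
    <= 4 * A ^+ 2 * e.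
  have nn (X : Om -> R) : 0 <= EP P (fun w => X w ^+ 2) / 2.
    by rewrite divr_ge0//; apply: Rintegral_ge0 => w _; exact: sqr_ge0.
  apply: le_trans (expRN_lipschitz (nn _) (nn _)) _.
  rewrite -mulrBl normrM [`|2^-1|]ger0_norm// distrC; apply: le_trans h2.
  by rewrite ler_piMr// invf_le1// ler1n.
rewrite (_ : _ - _ = (EP P (fun w => cos (wsum w + c0)) - EP P (fun w => cos (S' w + c0)))
  + cos c0 * (expR (- (EP P (fun w => S' w ^+ 2) / 2)) - expR (- (EP P (fun w => wsum w ^+ 2) / 2)))
  + (EP P (fun w => cos (S' w + c0)) - cos c0 * expR (- (EP P (fun w => S' w ^+ 2) / 2)))); last by ring.
apply: le_trans (ler_normD _ _) _; rewrite addrC; apply: lerD => //.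
apply: le_trans (ler_normD _ _) _; rewrite [leRHS]mulrDl addrC; apply: lerD => //.
rewrite normrM; apply: le_trans h3; apply: ler_piMl => //; exact: cos_max.
Qed.

End WeightedIndicators.

(** * Gaussian integrals and the continuity theorem *)

Lemma Rintegral_dominated_cvg (R : realType) (d : measure_display) (T : measurableType d)
    (mu : {measure set T -> \bar R}) (D : set T) (f_ : nat -> T -> R) (f g : T -> R) :
  measurable D ->
  (forall n, measurable_fun D (f_ n)) -> measurable_fun D f ->
  (forall x, D x -> f_ ^~ x @ \oo --> f x) ->
  mu.-integrable D (EFin \o g) ->
  (forall n x, D x -> `|f_ n x| <= g x) ->
  (fun n => \int[mu]_(x in D) f_ n x) @ \oo --> \int[mu]_(x in D) f x.
Proof.
move=> mD mf_ mf ff ig fg.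
have [|||||fi _ h] := @dominated_convergence _ _ _ mu D mD
    (fun n x => (f_ n x)%:E) (fun x => (f x)%:E) (EFin \o g).
- by move=> n; apply/measurable_EFinP.
- exact/measurable_EFinP.
- by apply: aeW => x Dx; apply: cvg_EFin; [exact: nearW|exact: ff].
- exact: ig.
- by apply: aeW => x n Dx; rewrite lee_fin fg.
apply: fine_cvg; rewrite fineK//.
exact: integrable_fin_num.
Qed.

Section Gaussian.
Context {R : realType}.
Notation mu := (@lebesgue_measure R).
Notation phi := (normal_pdf (0 : R) 1).

Lemma normal_pdf01E (t : R) : phi t = normal_peak 1 * expR (- (t ^+ 2 / 2)).
Proof.
rewrite normal_pdfE ?oner_eq0// /normal_fun subr0 expr1n.
by rewrite mulNr.
Qed.

Lemma is_derive_normal_pdf01 (t : R) : is_derive t 1 phi (- (t * phi t)).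
Proof.
have -> : phi = fun t => normal_peak 1 * expR (- (t ^+ 2 / 2)).
  by apply/funext => u; exact: normal_pdf01E.
have dX : is_derive t 1 (fun t : R => t ^+ 2 / 2) t.
  have := is_deriveM (is_deriveX 2 (is_derive_id t (1 : R))) (is_derive_cst (2^-1 : R) t 1).
  have E : 2^-1 *: (2%:R * t ^+ 1)%:A = t.
    by rewrite -[LHS]/(2^-1 * (2%:R * t ^+ 1 * 1)); field.
  by rewrite scaler0 add0r /= E.
have dE := @is_derive1_comp _ expR (fun t : R => - (t ^+ 2 / 2)) t _ _ (is_derive_expR _) (is_deriveN dX).
have := is_deriveM (is_derive_cst (normal_peak 1 : R) t 1) dE.
rewrite scaler0 addr0 /=; congr (is_derive _ _ _ _).
by rewrite -[LHS]/(_ * (_ * _)); ring.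
Qed.

Let phi_ge0 (t : R) : 0 <= phi t. Proof. exact: normal_pdf_ge0. Qed.

(** Half of the exponent absorbs the factor, as [|t| <= 1 + t^2 / 4 <= exp (t^2 / 4)]; the other
    half is the density of variance 2 up to normalization, which is integrable. *)
Let abs_phi_le (t : R) : `|t * phi t| <=
  (normal_peak 1 / normal_peak (Num.sqrt 2)) * normal_pdf 0 (Num.sqrt 2) t.
Proof.
have s2 : Num.sqrt 2 != 0 :> R by rewrite sqrtr_eq0 -ltNge.
rewrite normal_pdf01E normal_pdfE//.
rewrite mulrA divfK ?gt_eqF ?normal_peak_gt0//.
rewrite normrM [`|_ * expR _|]ger0_norm ?mulr_ge0 ?normal_peak_ge0 ?expR_ge0//.
rewrite mulrCA ler_wpM2l ?normal_peak_ge0// /normal_fun subr0 sqr_sqrtr//.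
rewrite (_ : - (t ^+ 2 / 2) = (- t ^+ 2 / (2 *+ 2)) + (- t ^+ 2 / (2 *+ 2))); last by field.
rewrite expRD mulrA ler_piMl ?expR_ge0//.
rewrite -ler_pdivlMr ?expR_gt0// div1r -expRN.
apply: le_trans (expR_ge1Dx _).
rewrite -[t ^+ 2]real_normK ?num_real//.
have := sqr_ge0 (`|t| - 2); lra.
Qed.

Lemma integrable_id_normal : mu.-integrable setT (EFin \o (fun t => `|t * phi t|)).
Proof.
have ig := @integrableZl _ _ R mu setT measurableT (normal_peak 1 / normal_peak (Num.sqrt 2))
   _ (integrable_normal_pdf 0 (Num.sqrt 2)).
apply: (le_integrable measurableT _ _ ig).
- apply/measurable_EFinP; apply: measurableT_comp => //; apply: measurable_funM => //.
  exact: measurable_normal_pdf.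
- move=> t _ /=; rewrite lee_fin normr_id; apply: le_trans (abs_phi_le t) _.
  exact: ler_norm.
Qed.

Lemma integrable_normal_mul (g : R -> R) (M : R) : measurable_fun setT g ->
  (forall t, `|g t| <= M) -> mu.-integrable setT (EFin \o (fun t => phi t * g t)).
Proof.
move=> mg gM.
have ig := @integrableZl _ _ R mu setT measurableT M _ (integrable_normal_pdf 0 1).
apply: (le_integrable measurableT _ _ ig).
- apply/measurable_EFinP; apply: measurable_funM => //; exact: measurable_normal_pdf.
- move=> t _ /=; rewrite lee_fin !normrM mulrC ler_pM//.
  exact: le_trans (gM t) (ler_norm _).
Qed.

Lemma Rintegral_normal_cst (c : R) : \int[mu]_(t in setT) (phi t * c) = c.
Proof.
rewrite RintegralZr//; last exact: integrable_normal_pdf.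
by rewrite /Rintegral integral_normal_pdf /= mul1r.
Qed.

Let continuous_cos_affine (a b : R) : continuous (fun t : R => cos (a * t + b)).
Proof.
move=> t; have -> : (fun t : R => cos (a * t + b)) = (fun t : R => cos (t * a + b)).
  by apply/funext => u; rewrite mulrC.
apply/differentiable_continuous/derivable1_diffP.
by have [] := is_derive_cos_affine a b t.
Qed.

Lemma measurable_cos_affine (a b : R) : measurable_fun setT (fun t : R => cos (a * t + b)).
Proof.
exact: continuous_measurable_fun.
Qed.

Let sin_cos (x : R) : sin x = cos (x - pi / 2).
Proof. by rewrite cosBpihalf. Qed.

Let measurable_sin_affine (a b : R) : measurable_fun setT (fun t : R => sin (a * t + b)).
Proof.
apply: eq_measurable_fun (measurable_cos_affine a (b - pi / 2)) => t _.
by rewrite sin_cos addrA.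
Qed.

(** The fundamental theorem of calculus on [[-n, n]], with dominated convergence to pass to the
    line. *)
Lemma Rintegral_derive_eq0 (H h : R -> R) :
  (forall t : R, is_derive t 1 H (h t)) -> continuous h ->
  mu.-integrable setT (EFin \o h) ->
  (fun n : nat => H n%:R) @ \oo --> (0 : R) -> (fun n : nat => H (- n%:R)) @ \oo --> (0 : R) ->
  \int[mu]_(t in setT) h t = 0.
Proof.
move=> dH ch ih H1 H2.
pose In n : R := \int[mu]_(t in setT) ((h \_ `[- n%:R, n%:R]) t).
have mh : measurable_fun setT h by exact: continuous_measurable_fun.
have c1 : In @ \oo --> \int[mu]_(t in setT) h t.
  apply: (@Rintegral_dominated_cvg _ _ _ mu setT (fun n : nat => h \_ `[- n%:R, n%:R]) h
    (fun t => `|h t|) measurableT) => //.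
  - by move=> n; apply/(measurable_restrictT _ _).1 => //; exact: measurable_funTS.
  - move=> t _; apply: cvg_near_cst.
    near=> n; rewrite patchE mem_set//= in_itv/= -ler_norml.
    near: n; exact: nbhs_infty_ger.
  - have := integrable_norm ih; exact: eq_integrable.
  - move=> n t _; rewrite patchE; case: ifP => // _; by rewrite normr0.
have c2 : In @ \oo --> (0 : R).
  have : (fun n : nat => H n%:R - H (- n%:R)) @ \oo --> (0 : R).
    by rewrite -[X in _ --> X]subr0; exact: cvgB.
  apply: cvg_trans; apply: near_eq_cvg; near=> n.
  rewrite /In -Rintegral_mkcond /Rintegral (@continuous_FTC2 _ h H)//.
  - rewrite -subr_gt0 opprK -natrD ltr0n addn_gt0 orbb.
    by near: n; exact: nbhs_infty_gt.
  - by apply: continuous_subspaceT.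
  - have cH t : H u @[u --> t] --> H t.
      apply/differentiable_continuous/derivable1_diffP.
      by have [] := dH t.
    split; first by move=> t _; have [] := dH t.
      by apply: cvg_at_right_filter.
    by apply: cvg_at_left_filter.
  - by move=> t _; rewrite derive1E; have [_ ->] := dH t.
by rewrite -(cvg_lim (@Rhausdorff R) c1) (cvg_lim (@Rhausdorff R) c2).
Unshelve. all: by end_near. Qed.

(** [exp (n^2 / 2) >= 1 + n^2 / 2 >= (n + 1) / 2]; this crude harmonic rate is enough for boundary
    terms to vanish. *)
Let phi_bound (g : R -> R) (n : nat) : (forall t, `|g t| <= 1) ->
  `|phi n%:R * g n%:R| <= (2 * normal_peak 1) * harmonic n /\
  `|phi (- n%:R) * g (- n%:R)| <= (2 * normal_peak 1) * harmonic n.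
Proof.
move=> g1.
have h (t : R) : t ^+ 2 = n%:R ^+ 2 -> `|phi t * g t| <= (2 * normal_peak 1) * harmonic n.
  move=> tn; rewrite normrM (ger0_norm (phi_ge0 t)).
  apply: le_trans (ler_piMr (phi_ge0 t) (g1 t)) _.
  rewrite normal_pdf01E tn -[leRHS]mulrA [leRHS]mulrCA ler_wpM2l ?normal_peak_ge0// expRN.
  rewrite /harmonic /= (_ : 2 * _ = (n.+1%:R / 2)^-1); last by rewrite invfM invrK mulrC.
  rewrite lef_pV2 ?posrE ?expR_gt0 ?divr_gt0//.
  apply: le_trans (expR_ge1Dx _); rewrite -natr1.
  have := sqr_ge0 (n%:R - 2^-1 : R); nra.
by split; apply: h; rewrite ?sqrrN.
Qed.

Let phi_cvg0 (g : R -> R) : (forall t, `|g t| <= 1) ->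
  (fun n : nat => phi n%:R * g n%:R) @ \oo --> (0 : R) /\
  (fun n : nat => phi (- n%:R) * g (- n%:R)) @ \oo --> (0 : R).
Proof.
move=> g1.
have c0 : (fun n : nat => (2 * normal_peak 1) * harmonic n) @ \oo --> (0 : R).
  rewrite -(mulr0 (2 * normal_peak 1 : R)); apply: cvgM; first exact: cvg_cst.
  exact: cvg_harmonic.
split; apply: norm_cvg0; apply: (squeeze_cvgr _ (cvg_cst 0) c0);
  by apply: nearW => n; rewrite normr_ge0/=; have [] := phi_bound n g1.
Qed.

(** Differentiating in [a] under the integral and integrating by parts gives [I' = - a I], because
    [- t phi t] is the derivative of [phi]; then [I a * exp (a^2 / 2)] is constant. *)
Lemma gauss_cos (a b : R) :
  \int[mu]_(t in setT) (phi t * cos (a * t + b)) = cos b * expR (- (a ^+ 2 / 2)).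
Proof.
pose f (a t : R) := phi t * cos (a * t + b).
pose I (a : R) := \int[mu]_(t in setT) f a t.
have df (a0 t : R) : is_derive a0 1 (f ^~ t) (- (t * phi t) * sin (a0 * t + b)).
  have := is_deriveM (is_derive_cst (phi t) a0 1) (is_derive_cos_affine t b a0).
  rewrite scaler0 addr0 /=; congr (is_derive _ _ _ _).
  by rewrite -[LHS]/(_ * _); ring.
have fi a0 : mu.-integrable setT (EFin \o f a0).
  apply: (@integrable_normal_mul (fun t => cos (a0 * t + b)) 1) => [|t].
    exact: measurable_cos_affine.
  exact: cos_max.
have d1 a0 t : partial1of2 f a0 t = - (t * phi t) * sin (a0 * t + b).
  by rewrite partial1of2E; have [_ ->] := df a0 t.
have dom a0 t : `|partial1of2 f a0 t| <= `|t * phi t|.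
  by rewrite d1 normrM normrN ler_piMr// sin_max.
have memI (a0 : R) : `]a0 - 1, a0 + 1[%classic a0.
  by rewrite /= in_itv/= ltrBlDr ltrDl ltr01 andbb.
have dI (a0 : R) : is_derive a0 1 I (- a0 * I a0).
  have H1 := @derivable_under_integral _ _ _ mu f setT measurableT a0 _ _ (memI a0)
    (fun x _ => fi x) (fun x y _ _ => ltac:(by have [] := df x y)) (fun t => `|t * phi t|)
    (fun t => normr_ge0 _) integrable_id_normal (fun x y _ _ => dom x y).
  have H2 := @differentiation_under_integral _ _ _ mu f setT measurableT a0 _ _ (memI a0)
    (fun x _ => fi x) (fun x y _ _ => ltac:(by have [] := df x y)) (fun t => `|t * phi t|)
    (fun t => normr_ge0 _) integrable_id_normal (fun x y _ _ => dom x y).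
  apply: DeriveDef => //; rewrite -derive1E H2.
  have -> : \int[mu]_(t in setT) partial1of2 f a0 t
      = \int[mu]_(t in setT) (- (t * phi t) * sin (a0 * t + b)).
    by apply: eq_Rintegral => t _; rewrite d1.
  have isn : mu.-integrable setT (EFin \o (fun t => - (t * phi t) * sin (a0 * t + b))).
    apply: (le_integrable measurableT _ _ integrable_id_normal).
      apply/measurable_EFinP; apply: measurable_funM; last exact: measurable_sin_affine.
      apply: measurableT_comp => //; apply: measurable_funM => //.
      exact: measurable_normal_pdf.
    by move=> t _ /=; rewrite lee_fin normr_id normrM normrN ler_piMr// sin_max.
  have iz : mu.-integrable setT (EFin \o (fun t => a0 * f a0 t)).
    exact: (@integrableZl _ _ R mu setT measurableT a0 _ (fi a0)).
  (* Integration by parts is packaged as the vanishing integral of this total derivative. *)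
  have dH (t : R) : is_derive t 1 (fun t => phi t * sin (a0 * t + b))
      (- (t * phi t) * sin (a0 * t + b) + a0 * f a0 t).
    have daff : is_derive t 1 (fun t : R => a0 * t + b) a0.
      have dl := is_deriveM (is_derive_cst a0 t 1) (is_derive_id t (1 : R)).
      have := is_deriveD dl (is_derive_cst b t 1).
      by rewrite scaler0 !addr0 -[_ *: _]/(a0 * 1) mulr1.
    have ds := @is_derive1_comp _ sin (fun t : R => a0 * t + b) t _ _ (is_derive_sin _) daff.
    have := is_deriveM (is_derive_normal_pdf01 t) ds.
    rewrite addrC /=; congr (is_derive _ _ _ _).
    by rewrite -[LHS]/(_ * _ + _ * (_ * _)) /f; ring.
  have [v1 v2] := phi_cvg0 (fun t => sin_max (a0 * t + b)).
  have := @Rintegral_derive_eq0 _ _ dH.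
  rewrite RintegralD// RintegralZl// -/(I a0) => H0.
  apply/eqP; rewrite mulNr -addr_eq0; apply/eqP; apply: H0 => //.
    have cphi (t : R) : phi u @[u --> t] --> phi t by apply: continuous_normal_pdf; rewrite oner_eq0.
    move=> t; apply: cvgD; apply: cvgM.
    - by apply: cvgN; apply: cvgM; [exact: cvg_id|exact: cphi].
    - have -> : (fun t : R => sin (a0 * t + b)) = (fun t => cos (a0 * t + (b - pi / 2))).
        by apply/funext => u; rewrite sin_cos addrA.
      by rewrite sin_cos -addrA; exact: continuous_cos_affine.
    - exact: cvg_cst.
    - by apply: cvgM; [exact: cphi|exact: continuous_cos_affine].
  exact: (@integrableD _ _ _ mu setT measurableT _ _ isn iz).
pose e (a : R) := expR (a ^+ 2 / 2).
have de (a0 : R) : is_derive a0 1 e (a0 * e a0).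
  have dX : is_derive a0 1 (fun t : R => t ^+ 2 / 2) a0.
    have := is_deriveM (is_deriveX 2 (is_derive_id a0 (1 : R))) (is_derive_cst (2^-1 : R) a0 1).
    have E : 2^-1 *: (2%:R * a0 ^+ 1)%:A = a0.
      by rewrite -[LHS]/(2^-1 * (2%:R * a0 ^+ 1 * 1)); field.
    by rewrite scaler0 add0r /= E.
  have := @is_derive1_comp _ expR (fun t : R => t ^+ 2 / 2) a0 _ _ (is_derive_expR _) dX.
  by rewrite [expR _ * _]mulrC.
have /is_derive_0_is_cst Ie : forall x : R, is_derive x 1 (I * e) 0.
  move=> x; have := is_deriveM (dI x) (de x); congr (is_derive _ _ _ _).
  by rewrite -[LHS]/(_ * _ + _ * _); ring.
move: (Ie a 0); rewrite -[(I * e) a]/(I a * e a) -[(I * e) 0]/(I 0 * e 0).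
have -> : e 0 = 1 by rewrite /e expr0n/= mul0r expR0.
have -> : I 0 = cos b.
  rewrite -[RHS]Rintegral_normal_cst; apply: eq_Rintegral => t _.
  by rewrite /f mul0r add0r.
rewrite mulr1 => <-; rewrite -mulrA -expRD subrr expR0 mulr1.
by [].
Qed.

End Gaussian.

(** * Iterated Gaussian integrals *)

Section GaussI.
Context {R : realType}.
Notation mu := (@lebesgue_measure R).
Notation phi := (normal_pdf (0 : R) 1).

Definition scons (t : R) (v : nat -> R) : nat -> R := fun j => if j is j'.+1 then v j' else t.

Lemma gaussIS k (g : (nat -> R) -> R) :
  gaussI k.+1 g = \int[mu]_(t in setT) (phi t * gaussI k (fun v => g (scons t v))).
Proof. by []. Qed.

Lemma Rintegral_normal_sum (A : Type) (r : seq A) (F : A -> R -> R) (c : A -> R) :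
  (forall a, measurable_fun setT (F a)) -> (forall a t, `|F a t| <= c a) ->
  \int[mu]_(t in setT) (phi t * (\sum_(a <- r) F a t))
  = \sum_(a <- r) \int[mu]_(t in setT) (phi t * F a t).
Proof.
move=> mF Fc; elim: r => [|a r IH].
  by rewrite big_nil -[RHS](Rintegral_normal_cst (0 : R)); apply: eq_Rintegral => t _; rewrite big_nil.
rewrite big_cons -IH -RintegralD//.
- by apply: eq_Rintegral => t _; rewrite big_cons mulrDr.
- exact: integrable_normal_mul (mF a) (Fc a).
apply: (@integrable_normal_mul _ (fun t => \sum_(a <- r) F a t) (\sum_(a <- r) c a)).
  exact: measurable_sum.
by move=> t; apply: le_trans (ler_norm_sum _ _ _) _; exact: ler_sum.
Qed.

(** Induction on the dimension: fixing the first variable at [s] moves [t a 0 * s] into the phase,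
    and integrating the other variables first returns a factor in the coefficient; hence phases and
    coefficients are general in the statement. *)
Lemma gaussI_cos (A : Type) (r : seq A) (k : nat) (c b : A -> R) (t : A -> nat -> R) :
  gaussI k (fun v => \sum_(a <- r) c a * cos (\sum_(j < k) t a j * v j + b a))
  = \sum_(a <- r) c a * (cos (b a) * expR (- ((\sum_(j < k) t a j ^+ 2) / 2))).
Proof.
elim: k c b t => [|k IH] c b t.
  rewrite /=; apply: eq_bigr => a _.
  by rewrite !big_ord0 mul0r oppr0 expR0 mulr1 add0r.
rewrite gaussIS.
pose E a := expR (- ((\sum_(j < k) t a j.+1 ^+ 2) / 2)).
have -> : \int[mu]_(s in setT) (phi s * gaussI k (fun v =>
     \sum_(a <- r) c a * cos (\sum_(j < k.+1) t a j * scons s v j + b a)))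
  = \int[mu]_(s in setT) (phi s * \sum_(a <- r) (c a * E a) * cos (t a 0 * s + b a)).
  apply: eq_Rintegral => s _; congr (_ * _).
  transitivity (gaussI k (fun v => \sum_(a <- r) c a *
      cos (\sum_(j < k) t a j.+1 * v j + (t a 0 * s + b a)))).
    congr gaussI; apply/funext => v; apply: eq_bigr => a _; congr (_ * cos _).
    by rewrite big_ord_recl /= [in RHS]addrCA addrA.
  rewrite (IH c (fun a => t a 0 * s + b a) (fun a j => t a j.+1)).
  by apply: eq_bigr => a _; rewrite mulrA mulrAC.
rewrite (@Rintegral_normal_sum _ _ _ (fun a => `|c a * E a|)).
- apply: eq_bigr => a _.
  have -> : \int[mu]_(s in setT) (phi s * (c a * E a * cos (t a 0 * s + b a)))
     = (c a * E a) * \int[mu]_(s in setT) (phi s * cos (t a 0 * s + b a)).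
    rewrite -RintegralZl//.
      by apply: eq_Rintegral => s _; rewrite mulrCA.
    apply: (integrable_normal_mul _ (fun s => cos_max _)).
    exact: measurable_cos_affine.
  rewrite gauss_cos big_ord_recl mulrDl opprD expRD /E /=.
  by rewrite -!mulrA; congr (_ * _); rewrite mulrCA; congr (_ * _); rewrite mulrC.
- by move=> a; apply: measurable_funM => //; exact: measurable_cos_affine.
- by move=> a s; rewrite normrM ler_piMr// cos_max.
Qed.

(** Sequential continuity for coordinatewise convergence: it passes to the sections [g (scons t v)]
    and is all that dominated convergence requires. *)
Definition seqcont (g : (nat -> R) -> R) := forall (u : nat -> nat -> R) v,
  (forall j, (fun n => u n j) @ \oo --> v j) -> (fun n => g (u n)) @ \oo --> g v.

Lemma seqcont_scons g t : seqcont g -> seqcont (fun v => g (scons t v)).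
Proof.
move=> cg u v uv; apply: cg => -[|j]; last exact: uv.
exact: cvg_cst.
Qed.

Lemma seq_continuous (h : R -> R) :
  (forall (u : nat -> R) x, u @ \oo --> x -> (fun n => h (u n)) @ \oo --> h x) -> continuous h.
Proof. by move=> H x; apply/(@cvg_nbhsP _ R^o) => u ux; exact: H. Qed.

(** Bound and limit are proved in one induction: the inner integral is measurable in the outer
    variable because it is continuous there, which is the limit statement one dimension lower, and
    its domination is the bound one dimension lower. *)
Lemma gaussI_bounded_cvg k : (forall (g : (nat -> R) -> R) M, seqcont g ->
    (forall v, `|g v| <= M) -> `|gaussI k g| <= M) /\
  (forall (g_ : nat -> (nat -> R) -> R) g M, (forall n, seqcont (g_ n)) -> seqcont g ->
    (forall n v, `|g_ n v| <= M) -> (forall v, (fun n => g_ n v) @ \oo --> g v) ->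
    (fun n => gaussI k (g_ n)) @ \oo --> gaussI k g).
Proof.
elim: k => [|k [IHb IHc]]; first by split => [g M _ gM|g_ g M _ _ _ h] /=.
have mI g M : seqcont g -> (forall v, `|g v| <= M) ->
    measurable_fun setT (fun t => gaussI k (fun v => g (scons t v))).
  move=> cg gM; apply: continuous_measurable_fun; apply: seq_continuous => u x ux.
  apply: (IHc (fun n v => g (scons (u n) v)) _ M) => [n||n v|v].
  - exact: seqcont_scons.
  - exact: seqcont_scons.
  - exact: gM.
  - by apply: cg => -[|j] //; exact: cvg_cst.
split => [g M cg gM|g_ g M cg_ cg gM gg].
  have b t : `|gaussI k (fun v => g (scons t v))| <= M.
    by apply: IHb => [|v]; [exact: seqcont_scons|exact: gM].
  rewrite gaussIS; apply: le_trans (le_normr_Rintegral _ _) _ => //.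
    exact: integrable_normal_mul (mI _ _ cg gM) b.
  rewrite -[leRHS](Rintegral_normal_cst M); apply: le_Rintegral => //.
  - by apply/integrable_norm; exact: integrable_normal_mul (mI _ _ cg gM) b.
  - exact: (@integrable_normal_mul _ (cst M) `|M|).
  - by move=> t _; rewrite normrM ger0_norm ?normal_pdf_ge0// ler_wpM2l ?normal_pdf_ge0.
have gM' v : `|g v| <= M.
  have c : (fun n => `|g_ n v|) @ \oo --> `|g v| by apply: cvg_norm; exact: gg.
  rewrite -(cvg_lim (@Rhausdorff R) c); apply: limr_le; first exact: cvgP c.
  by apply: nearW => n; exact: gM.
have M0 : 0 <= M by apply: le_trans (gM' (fun=> 0)).
rewrite gaussIS; under eq_fun do rewrite gaussIS.
apply: (@Rintegral_dominated_cvg _ _ _ mu setT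
  (fun n t => phi t * gaussI k (fun v => g_ n (scons t v)))
  (fun t => phi t * gaussI k (fun v => g (scons t v))) (fun t => phi t * M)) => //.
- move=> n; apply: measurable_funM; first exact: measurable_normal_pdf.
  by apply: mI; [exact: cg_|exact: gM].
- apply: measurable_funM; first exact: measurable_normal_pdf.
  exact: mI gM'.
- move=> t _; apply: cvgM; first exact: cvg_cst.
  apply: (IHc _ _ M) => [n||n v|v]; rewrite ?gg//; exact: seqcont_scons.
- by apply: (@integrable_normal_mul _ (cst M) M) => // t; rewrite /= ger0_norm.
- move=> n t _; rewrite normrM ger0_norm ?normal_pdf_ge0// ler_wpM2l ?normal_pdf_ge0//.
  by apply: IHb => [|v]; [exact: seqcont_scons|exact: gM].
Qed.

Lemma seqcont_col m (f : 'cV[R]_m -> R) : continuous f ->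
  seqcont (fun v => f (\col_(i < m) v (nat_of_ord i))).
Proof.
move=> cf u v uv; apply: (cvg_comp _ f _ (cf _)).
apply/cvg_ballP => e e0.
have H : \forall n \near \oo, forall i : 'I_m, ball (v i) e (u n i).
  by apply: filter_forall => i; move/cvg_ballP: (uv i); exact.
by apply: filterS H => n H; split => // i j; rewrite !mxE.
Qed.

Lemma gaussE_cvg m (f_ : nat -> 'cV[R]_m -> R) f M :
  (forall n, continuous (f_ n)) -> continuous f -> (forall n v, `|f_ n v| <= M) ->
  (forall v, (fun n => f_ n v) @ \oo --> f v) ->
  (fun n => gaussE (f_ n)) @ \oo --> gaussE f.
Proof.
move=> cf_ cf fM ff; have [_ H] := gaussI_bounded_cvg m.
by apply: (H _ _ M) => // [n|]; exact: seqcont_col.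
Qed.

End GaussI.

(** * Trigonometric polynomials *)

Section TrigPoly.
Context {R : realType} {m : nat}.
Implicit Types (g h : 'cV[R]_m -> R) (x y : 'cV[R]_m).

Definition tdot (t x : 'cV[R]_m) : R := \sum_j t j 0 * x j 0.

Lemma tdotDl s t x : tdot (s + t) x = tdot s x + tdot t x.
Proof. by rewrite -big_split; apply: eq_bigr => j _; rewrite mxE mulrDl. Qed.

Lemma tdotNl t x : tdot (- t) x = - tdot t x.
Proof. by rewrite -sumrN; apply: eq_bigr => j _; rewrite mxE mulNr. Qed.

Definition tval (s : seq (R * 'cV[R]_m * R)) x : R :=
  \sum_(a <- s) a.1.1 * cos (tdot a.1.2 x + a.2).

Definition trigpoly g := exists s, g =1 tval s.

Lemma trigpolyD g h : trigpoly g -> trigpoly h -> trigpoly (fun x => g x + h x).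
Proof.
by move=> [s gs] [r hr]; exists (s ++ r) => x; rewrite gs hr /tval big_cat.
Qed.

Lemma trigpoly_cos c t b : trigpoly (fun x => c * cos (tdot t x + b)).
Proof. by exists [:: (c, t, b)] => x; rewrite /tval big_seq1. Qed.

Lemma trigpoly_cst c : trigpoly (fun=> c).
Proof.
exists [:: (c, 0, 0)] => x; rewrite /tval big_seq1 /= /tdot big1 ?addr0 ?cos0 ?mulr1//.
by move=> j _; rewrite mxE mul0r.
Qed.

Lemma trigpoly_sum (A : Type) (r : seq A) (g : A -> 'cV[R]_m -> R) :
  (forall a, trigpoly (g a)) -> trigpoly (fun x => \sum_(a <- r) g a x).
Proof.
move=> tg; elim: r => [|a r [s IH]].
  by have [s h] := trigpoly_cst 0; exists s => x; rewrite big_nil -h.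
by have [s' h] := trigpolyD (tg a) (ex_intro _ s IH); exists s' => x; rewrite big_cons -h.
Qed.

Let cosM (a b : R) : cos a * cos b = 2^-1 * cos (a + b) + 2^-1 * cos (a - b).
Proof. by rewrite cosD cosB; field. Qed.

Lemma trigpolyM g h : trigpoly g -> trigpoly h -> trigpoly (fun x => g x * h x).
Proof.
move=> [s gs] [r hr].
have [q hq] : trigpoly (fun x => \sum_(a <- s) \sum_(a' <- r)
    (a.1.1 * a'.1.1 / 2 * cos (tdot (a.1.2 + a'.1.2) x + (a.2 + a'.2))
   + a.1.1 * a'.1.1 / 2 * cos (tdot (a.1.2 - a'.1.2) x + (a.2 - a'.2)))).
  apply: trigpoly_sum => a; apply: trigpoly_sum => a'.
  by apply: trigpolyD; exact: trigpoly_cos.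
exists q => x; rewrite -hq gs hr /tval big_distrlr /=.
apply: eq_bigr => a _; apply: eq_bigr => a' _.
have E (c1 c2 u v : R) : c1 * cos u * (c2 * cos v) =
    c1 * c2 / 2 * cos (u + v) + c1 * c2 / 2 * cos (u - v).
  by rewrite mulrACA cosM; field.
by rewrite E !tdotDl tdotNl; congr (_ * cos _ + _ * cos _); ring.
Qed.

Lemma continuous_tdot t : continuous (tdot t).
Proof.
move=> x; rewrite /tdot.
apply: (@cvg_big R _ +%R 0 _ _ _ (nbhs x)) => [|j _]; first exact: add_continuous.
by apply: cvgM; [exact: cvg_cst|exact: coord_continuous].
Qed.

Lemma continuous_trigpoly g : trigpoly g -> continuous g.
Proof.
move=> [s gs]; have -> : g = tval s by exact/funext.
move=> x; rewrite /tval; apply: (@cvg_big R _ +%R 0 _ _ _ (nbhs x)) => [|a _]; first exact: add_continuous.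
apply: cvgM; first exact: cvg_cst.
apply: (cvg_comp (fun x => tdot a.1.2 x + a.2) cos); last exact: continuous_cos.
by apply: cvgD; [exact: continuous_tdot|exact: cvg_cst].
Qed.

Lemma gaussE_tval s : gaussE (tval s) =
  \sum_(a <- s) a.1.1 * (cos a.2 * expR (- ((\sum_j a.1.2 j 0 ^+ 2) / 2))).
Proof.
pose ext (t : 'cV[R]_m) (j : nat) : R := if insub j is Some i then t i 0 else 0.
have extE t (i : 'I_m) : ext t i = t i 0 by rewrite /ext valK.
transitivity (gaussI m (fun v => \sum_(a <- s) a.1.1 *
    cos (\sum_(j < m) ext a.1.2 j * v j + a.2))).
  congr gaussI; apply/funext => v; apply: eq_bigr => a _.
  by congr (_ * cos (_ + _)); apply: eq_bigr => j _; rewrite extE mxE.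
rewrite (gaussI_cos s m (fun a => a.1.1) (fun a => a.2) (fun a => ext a.1.2)).
apply: eq_bigr => a _.
by rewrite (eq_bigr (fun j : 'I_m => a.1.2 j 0 ^+ 2)) // => j _; rewrite extE.
Qed.

End TrigPoly.

(** * Bernstein operators and uniform continuity on boxes *)

Section Bernstein.
Context {R : realType} {m : nat}.

(** Expectation of [F] after independent trials, one per entry [j] of [js], each raising the count
    [k j] with probability [u j]. As a function of [u] it is a multivariate Bernstein polynomial. *)
Fixpoint bern (u : 'I_m -> R) (js : seq 'I_m) (k : 'I_m -> nat) (F : ('I_m -> nat) -> R) : R :=
  if js is j :: js' then
    u j * bern u js' (fun i => k i + (i == j))%N F + (1 - u j) * bern u js' k F
  else F k.

Section Positive.
Variable u : 'I_m -> R.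
Hypothesis u01 : forall j, 0 <= u j <= 1.
Implicit Types (js : seq 'I_m) (k : 'I_m -> nat) (F G : ('I_m -> nat) -> R).

Lemma bern_le js k F G : (forall k, F k <= G k) -> bern u js k F <= bern u js k G.
Proof.
move=> FG; elim: js k => //= j js IH k; have /andP[u0 u1] := u01 j.
by apply: lerD; apply: ler_wpM2l; rewrite ?subr_ge0.
Qed.

Lemma bernD js k F G : bern u js k (fun k => F k + G k) = bern u js k F + bern u js k G.
Proof. by elim: js k => //= j js IH k; rewrite !IH; ring. Qed.

Lemma bernZ js k c F : bern u js k (fun k => c * F k) = c * bern u js k F.
Proof. by elim: js k => //= j js IH k; rewrite !IH; ring. Qed.

Lemma bern_cst js k c : bern u js k (fun=> c) = c.
Proof. by elim: js k => //= j js IH k; rewrite !IH; ring. Qed.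

Lemma bern_sum (A : Type) (r : seq A) (F : A -> ('I_m -> nat) -> R) js k :
  bern u js k (fun k => \sum_(a <- r) F a k) = \sum_(a <- r) bern u js k (F a).
Proof.
elim: r => [|a r IH].
  rewrite big_nil -[RHS](bern_cst js k 0); congr bern; apply/funext => k'.
  by rewrite big_nil.
rewrite big_cons -IH -bernD; congr bern; apply/funext => k'.
by rewrite big_cons.
Qed.

Lemma bern_norm js k F : `|bern u js k F| <= bern u js k (fun k => `|F k|).
Proof.
rewrite ler_norml; apply/andP; split; last by apply: bern_le => k'; exact: ler_norm.
rewrite -mulN1r -bernZ; apply: bern_le => k'.
by rewrite mulN1r lerNl -normrN ler_norm.
Qed.

(** Squared bias plus binomial variance, for [count_mem i js] trials started from the count
    [k i]. *)
Lemma bern_variance js k i c :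
  bern u js k (fun k => ((k i)%:R - c) ^+ 2) =
  ((k i)%:R + (count_mem i js)%:R * u i - c) ^+ 2 + (count_mem i js)%:R * (u i * (1 - u i)).
Proof.
elim: js k => [|j js IH] k /=; first by rewrite !mul0r !addr0.
rewrite !IH !natrD [j == i]eq_sym; case: eqVneq => [<-|_] /=; last by rewrite !(mul0r, add0r, addr0); ring.
by ring.
Qed.

End Positive.

Lemma trigpoly_bern (u : 'cV[R]_m -> 'I_m -> R) js k F :
  (forall j, trigpoly (u ^~ j)) -> trigpoly (fun x => bern (u x) js k F).
Proof.
move=> tu; elim: js k => [|j js IH] k /=; first exact: trigpoly_cst.
apply: trigpolyD; apply: trigpolyM => //.
have [s hs] := trigpolyD (trigpoly_cst 1) (trigpolyM (trigpoly_cst (-1)) (tu j)).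
by exists s => x; rewrite -hs mulN1r.
Qed.

Lemma uniformly_continuous_box (f : 'cV[R]_m -> R) (K e : R) : continuous f -> 0 < e ->
  exists2 dlt, 0 < dlt & forall x y : 'cV[R]_m, (forall j, `|x j 0| <= K) ->
    (forall j, `|y j 0 - x j 0| < dlt) -> `|f y - f x| <= e.
Proof.
move=> cf e0.
pose box : set 'rV[R]_m := [set v | forall j, `[- K, K]%classic (v ord0 j)].
have /compact_near_coveringP cbox : compact box.
  by apply: (@rV_compact R m (fun=> `[- K, K]%classic)) => j; exact: segment_compact.
pose Pr (dlt : R) (v : 'rV[R]_m) := forall y : 'cV[R]_m,
  (forall j, `|y j 0 - v 0 j| < dlt) -> `|f y - f v^T| <= e.
have H (v : 'rV[R]_m) : box v -> \forall w \near v & dlt \near 0^'+, Pr dlt w.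
  move=> _; have /cvgrPdist_le/(_ (e / 2)) := cf v^T.
  rewrite divr_gt0// => /(_ isT) /nbhs_ballP[r /= r0 br].
  have r20 : 0 < r / 2 by rewrite divr_gt0.
  exists (ball v (r / 2), [set dlt : R | 0 < dlt < r / 2]).
    split; first exact: nbhsx_ballx.
    by apply: filterS2 (nbhs_right_gt 0) (nbhs_right_lt r20) => dlt d0 dr /=; exact/andP.
  move=> [w dlt] /= [vw /andP[dlt0 dltr]] y yw.
  have bw : ball v^T r w^T.
    split => // i j; rewrite !mxE; case: vw => _ /(_ j i); rewrite /ball/= => h.
    by apply: lt_trans h _; lra.
  have byw : ball v^T r y.
    split => // i j; rewrite !mxE (ord1 j) /ball/=.
    case: vw => _ /(_ 0 i); rewrite /ball/= => h.
    have := yw i; rewrite distrC => h2.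
    rewrite -[v _ _](subrK (w 0 i)) -addrA; apply: le_lt_trans (ler_normD _ _) _.
    by lra.
  have := br _ bw; have := br _ byw; rewrite /= [`|f v^T - f y|]distrC => h1 h2.
  rewrite -[f y](subrK (f v^T)) -addrA; apply: le_trans (ler_normD _ _) _; lra.
have /= := cbox R (0^'+) Pr _ H => hn.
have [dlt [dlt0 hd]] : exists dlt : R, 0 < dlt /\ box `<=` Pr dlt.
  near (0 : R)^'+ => dlt; exists dlt; split; near: dlt; last exact: hn.
  exact: nbhs_right_gt.
exists dlt => // x y xK yx.
rewrite -[x]trmxK; apply: hd => [j|j]; rewrite /= ?mxE//.
by rewrite in_itv/= -ler_norml.
Unshelve. all: by end_near. Qed.

End Bernstein.

(** * Approximation of bounded continuous functions by trigonometric polynomials *)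

Section Approximation.
Context {R : realType} {m : nat}.

(** [cos 1] is the least slope of the sine on [[-1, 1]] and [sin 1] the end of its range there; on
    this interval the inverse of the sine has Lipschitz constant [1 / cos 1]. *)
Let c1 : R := cos 1.
Let s1 : R := sin 1.

Lemma cos_ge_cos1 (c : R) : `|c| <= 1 -> c1 <= cos c.
Proof.
move=> h; have pi1 : 1 <= pi :> R by apply: le_trans (pi_ge2 R); rewrite ler1n.
have m1 : 1 \in `[0, pi : R] by rewrite in_itv/= ler01.
have mc : `|c| \in `[0, pi : R] by rewrite in_itv/= normr_ge0 (le_trans h).
by rewrite /c1 -[cos c]cos_norm leNgt ltr_cos// -leNgt.
Qed.

Lemma sin_expanding (a b : R) : `|a| <= 1 -> `|b| <= 1 -> c1 * `|a - b| <= `|sin a - sin b|.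
Proof.
wlog ba : a b / b <= a => [H a1 b1|].
  have [/H h|/ltW/H h] := leP b a; first exact: h.
  by rewrite distrC [leRHS]distrC; exact: h.
move=> a1 b1.
have cs : {within `[b, a], continuous (@sin R)}.
  by apply: continuous_subspaceT; exact: continuous_sin.
have [c] := MVT_segment ba (fun x _ => is_derive_sin x) cs.
rewrite in_itv/= => /andP[bc ca] ->; rewrite normrM ler_wpM2r//.
have cc : `|c| <= 1.
  move: a1 b1; rewrite !ler_norml => /andP[_ a1] /andP[b1 _].
  by rewrite (le_trans b1 bc) (le_trans ca a1).
exact: le_trans (cos_ge_cos1 cc) (ler_norm _).
Qed.

(** Projection onto [[- sin 1, sin 1]]. It does not increase distances to points of that interval,
    and it forces the inverse sine into [[-1, 1]], where [sin_expanding] applies. *)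
Let clip (s : R) : R := Num.max (- s1) (Num.min s1 s).

Let s1_01 : 0 < s1 < 1.
Proof.
rewrite /s1 sin2_gt0 ?ltr01 ?ltr1n//= lt_neqAle sin_le1 andbT.
apply/eqP => h; have := cos1_gt0 R.
by rewrite sin1cos0 ?ltxx// h normr1.
Qed.

Let sin_le_s1 (a : R) : `|a| <= 1 -> `|sin a| <= s1.
Proof.
rewrite ler_norml => /andP[al au]; have p1 := pihalf_ge1 R.
have m1 : 1 \in `[ - (pi / 2), pi / 2 : R] by rewrite in_itv/=; apply/andP; split; lra.
have mN1 : - 1 \in `[ - (pi / 2), pi / 2 : R] by rewrite in_itv/=; apply/andP; split; lra.
have ma : a \in `[ - (pi / 2), pi / 2 : R] by rewrite in_itv/=; apply/andP; split; lra.
rewrite ler_norml /s1 -sinN; apply/andP; split.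
  by rewrite leNgt ltr_sin// -leNgt.
by rewrite leNgt ltr_sin// -leNgt.
Qed.

Let clip_bound s : - s1 <= clip s <= s1.
Proof.
rewrite /clip; have /andP[s0 _] := s1_01.
by rewrite le_max lexx /= ge_max ge_min lexx /= andbT ge0_cp ?ltW.
Qed.

Let asin_clip s : `|asin (clip s)| <= 1 /\ sin (asin (clip s)) = clip s.
Proof.
have /andP[s0 s11] := s1_01; have /andP[cl cu] := clip_bound s.
have cI : -1 <= clip s <= 1 by apply/andP; split; lra.
have [/andP[al au] sc] := asin_def cI.
split => //; have p1 := pihalf_ge1 R.
have m1 : 1 \in `[ - (pi / 2), pi / 2 : R] by rewrite in_itv/=; apply/andP; split; lra.
have mN1 : - 1 \in `[ - (pi / 2), pi / 2 : R] by rewrite in_itv/=; apply/andP; split; lra.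
have ma : asin (clip s) \in `[ - (pi / 2), pi / 2 : R] by rewrite in_itv/=; apply/andP.
have up : asin (clip s) <= 1 by rewrite leNgt -ltr_sin// sc -leNgt.
have dn : - 1 <= asin (clip s) by rewrite leNgt -ltr_sin// sc sinN -leNgt.
by rewrite ler_norml dn.
Qed.

Let clip_lip (a s : R) : `|a| <= s1 -> `|a - clip s| <= `|a - s|.
Proof.
rewrite ler_norml /clip => /andP[al au].
have /andP[s0 _] := s1_01.
have [h1|h1] := leP s1 s; have [h2|h2] := leP (- s1) _; rewrite ler_norml;
  have [h3|h3] := ger0P (a - s); apply/andP; split; lra.
Qed.

(* Bernstein polynomials in the variables [(1 + sin(x_j / L)) / 2], which recover [x_j]
   on a large box. *)
Lemma trigpoly_approx (f : 'cV[R]_m -> R) (M L e : R) :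
  continuous f -> (forall v, `|f v| <= M) -> 1 <= L -> 0 < e ->
  exists g, [/\ trigpoly g, (forall v, `|g v| <= M) &
    forall x, `|f x - g x| <= e + 2 * M / L ^+ 2 * (\sum_j x j 0 ^+ 2)].
Proof.
move=> cf fM L1 e0.
have L0 : 0 < L by exact: lt_le_trans L1.
have M0 : 0 <= M by apply: le_trans (fM 0).
have [dlt dlt0 hd] := uniformly_continuous_box L cf (divr_gt0 e0 (ltr0n _ 2)).
have c10 : 0 < c1 by exact: cos1_gt0.
(* A deviation below [d2] in [u] is one below [2 d2] in the sine, below [dlt / L] after division by
   [cos 1], and below [dlt] after scaling by [L]. *)
pose d2 := dlt * c1 / (2 * L).
have d20 : 0 < d2 by rewrite divr_gt0 ?mulr_gt0.
(* Chebyshev: the far nodes will contribute at most [2 M m / (d2^2 N)], which has to be at most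
   [e / 2]. *)
have [N' hN'] : exists N : nat, 4 * M * m%:R / (d2 ^+ 2 * e) < N%:R.
  have q0 : 0 <= 4 * M * m%:R / (d2 ^+ 2 * e).
    by apply: divr_ge0; apply: mulr_ge0; [apply: mulr_ge0| |exact: sqr_ge0|exact: ltW].
  by exists (Num.bound (4 * M * m%:R / (d2 ^+ 2 * e))); exact: archi_boundP.
pose N := N'.+1.
have hN : 4 * M * m%:R / (d2 ^+ 2 * e) < N%:R.
  by apply: lt_trans hN' _; rewrite ltr_nat.
have [Ln0 d2n0 en0] : [/\ L != 0, d2 != 0 & e != 0] by split; exact: lt0r_neq0.
have Nn0 : N%:R != 0 :> R by rewrite pnatr_eq0.
pose u (x : 'cV[R]_m) j := (1 + sin (x j 0 / L)) / 2.
have u01 x j : 0 <= u x j <= 1.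
  rewrite /u; have := sin_geN1 (x j 0 / L); have := sin_le1 (x j 0 / L) => h1 h2.
  by apply/andP; split; lra.
pose js := flatten (nseq N (enum 'I_m)).
have cjs j : count_mem j js = N.
  rewrite /js; elim: (N) => //= k IH; rewrite count_cat IH.
  by rewrite count_uniq_mem ?enum_uniq// mem_enum.
pose node (k : 'I_m -> nat) : 'cV[R]_m := \col_j (L * asin (clip (2 * ((k j)%:R / N%:R) - 1))).
pose g x := bern (u x) js (fun=> 0%N) (fun k => f (node k)).
exists g; split.
- apply: trigpoly_bern => j.
  have [s hs] := trigpolyD (trigpoly_cst (2^-1))
    (trigpoly_cos 2^-1 (L^-1 *: delta_mx j 0 : 'cV[R]_m) (- (pi / 2))).
  exists s => x; rewrite -hs /u mulrDl mul1r; congr (_ + _); rewrite mulrC cosBpihalf.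
  congr (_ * sin _); rewrite /tdot (bigD1 j)//= big1 => [|i ij]; last first.
    by rewrite !mxE (negbTE ij) mulr0 mul0r.
  by rewrite !mxE !eqxx mulr1 addr0 mulrC.
- move=> x; apply: le_trans (bern_norm (u01 x) _ _ _) _.
  by rewrite -[leRHS](bern_cst (u x) js (fun=> 0%N)); apply: bern_le.
move=> x; have sq0 : 0 <= \sum_j x j 0 ^+ 2 by apply: sumr_ge0 => j _; exact: sqr_ge0.
(* Outside the box some [|x j|] exceeds [L], and the quadratic term alone covers the trivial bound
   [2 M]. *)
have [/forallP xL|] := boolP [forall j, `|x j 0| <= L]; last first.
  rewrite negb_forall => /existsP[j]; rewrite -ltNge => xj.
  have gM : `|g x| <= M.
    apply: le_trans (bern_norm (u01 x) _ _ _) _.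
    by rewrite -[leRHS](bern_cst (u x) js (fun=> 0%N)); apply: bern_le.
  apply: le_trans (ler_normB _ _) _; apply: le_trans (lerD (fM x) gM) _.
  apply: le_trans (_ : _ <= 2 * M / L ^+ 2 * (\sum_j x j 0 ^+ 2)) _; last first.
    by rewrite lerDr ltW.
  rewrite -mulr2n -[leLHS]mulr_natl [leRHS]mulrAC -[leRHS]mulrA ler_peMr ?mulr_ge0// ler_pdivlMr ?exprn_gt0//.
  rewrite mul1r (bigD1 j)//=; apply: le_trans (_ : x j 0 ^+ 2 <= _).
    by rewrite -[leRHS]real_normK ?num_real// ler_pXn2r ?nnegrE ?normr_ge0 ?(ltW L0)// ltW.
  by rewrite lerDl; apply: sumr_ge0 => i _; exact: sqr_ge0.
apply: le_trans (_ : _ <= e) _; last by rewrite lerDl mulr_ge0// divr_ge0 ?sqr_ge0 ?mulr_ge0.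
have -> : f x - g x = bern (u x) js (fun=> 0%N) (fun k => f x + (-1) * f (node k)).
  by rewrite bernD bernZ bern_cst mulN1r.
apply: le_trans (bern_norm (u01 x) _ _ _) _.
pose c := 2 * M / (N%:R * d2) ^+ 2.
(* Pointwise in the counts: a node within [d2] in every coordinate gives [e / 2] by uniform
   continuity, and for any other the sum of squares weighted by [c] exceeds [2 M]. *)
apply: (@le_trans _ _ (bern (u x) js (fun=> 0%N)
  (fun k => e / 2 + c * (\sum_j ((k j)%:R - N%:R * u x j) ^+ 2)))).
  apply: bern_le => // k; rewrite mulN1r.
  have c0 : 0 <= c by rewrite divr_ge0 ?sqr_ge0 ?mulr_ge0.
  have S0 : 0 <= \sum_j ((k j)%:R - N%:R * u x j) ^+ 2.
    by apply: sumr_ge0 => j _; exact: sqr_ge0.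
  have [/forallP near|] := boolP [forall j, `|u x j - (k j)%:R / N%:R| < d2].
    apply: (@le_trans _ _ (e / 2)); last by rewrite lerDl mulr_ge0.
    rewrite distrC; apply: hd => [j|j]; first exact: xL.
    rewrite mxE; set b := asin _.
    have [b1 sb] := asin_clip (2 * ((k j)%:R / N%:R) - 1).
    have a1 : `|x j 0 / L| <= 1 by rewrite normrM normfV (gtr0_norm L0) ler_pdivrMr// mul1r xL.
    have key : c1 * `|x j 0 / L - b| < c1 * (dlt / L).
      apply: le_lt_trans (sin_expanding a1 b1) _; rewrite sb.
      apply: le_lt_trans (clip_lip _ (sin_le_s1 a1)) _.
      have -> : sin (x j 0 / L) - (2 * ((k j)%:R / N%:R) - 1) = 2 * (u x j - (k j)%:R / N%:R).
        by rewrite /u; field.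
      rewrite normrM ger0_norm//; have -> : c1 * (dlt / L) = 2 * d2.
        by rewrite /d2; field; rewrite ?Ln0 ?Nn0 ?d2n0 ?en0.
      by rewrite ltr_pM2l//; exact: near.
    rewrite (_ : L * b - x j 0 = - (L * (x j 0 / L - b))); last by field; rewrite ?Ln0 ?Nn0 ?d2n0 ?en0.
    rewrite normrN normrM (gtr0_norm L0) mulrC -ltr_pdivlMr//.
    by rewrite -(ltr_pM2l c10).
  rewrite negb_forall => /existsP[j]; rewrite -leNgt => far.
  apply: (@le_trans _ _ (2 * M)).
    by apply: le_trans (ler_normB _ _) _; rewrite mulr_natl mulr2n lerD.
  apply: (@le_trans _ _ (c * ((k j)%:R - N%:R * u x j) ^+ 2)); last first.
    rewrite -[leLHS]add0r lerD ?divr_ge0 ?(ltW e0)// ler_wpM2l// (bigD1 j)//= lerDl.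
    by apply: sumr_ge0 => i _; exact: sqr_ge0.
  have D0 : 0 < (N%:R * d2) ^+ 2 by rewrite exprn_gt0// mulr_gt0// ltr0n.
  rewrite /c mulrAC ler_pdivlMr//; apply: ler_wpM2l; first exact: mulr_ge0.
  rewrite -[leRHS]real_normK ?num_real// ler_pXn2r ?nnegrE ?normr_ge0 ?(mulr_ge0 _ (ltW d20))//.
  rewrite (_ : _ - _ = - (N%:R * (u x j - (k j)%:R / N%:R))); last by field; rewrite ?Ln0 ?Nn0 ?d2n0 ?en0.
  by rewrite normrN normrM ger0_norm// ler_wpM2l.
have -> : bern (u x) js (fun=> 0%N)
    (fun k => e / 2 + c * (\sum_j ((k j)%:R - N%:R * u x j) ^+ 2)) =
  e / 2 + c * (\sum_j bern (u x) js (fun=> 0%N) (fun k => ((k j)%:R - N%:R * u x j) ^+ 2)).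
  by rewrite -bern_sum -bernZ -[X in X + _](bern_cst (u x) js (fun=> 0%N)) -bernD.
have c0 : 0 <= c by rewrite divr_ge0 ?sqr_ge0 ?mulr_ge0.
apply: (@le_trans _ _ (e / 2 + c * (\sum_(j < m) N%:R))).
  rewrite lerD2l ler_wpM2l//; apply: ler_sum => j _.
  rewrite bern_variance cjs add0r subrr expr0n/= add0r ler_piMr//.
  by have /andP[u0 u1] := u01 x j; rewrite mulr_ile1 ?subr_ge0// lerBlDr lerDl.
rewrite sumr_const card_ord -[N%:R *+ m]mulr_natl.
have h2 : c * (m%:R * N%:R) <= e / 2; last by lra.
rewrite (_ : c * _ = 2 * M * m%:R / d2 ^+ 2 / N%:R); last first.
  by rewrite /c; field; rewrite ?Ln0 ?Nn0 ?d2n0 ?en0.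
rewrite ler_pdivrMr ?ltr0n// -ler_pdivrMl ?divr_gt0//.
apply: le_trans (ltW hN); rewrite le_eqVlt; apply/orP; left; apply/eqP.
by field; rewrite ?Ln0 ?Nn0 ?d2n0 ?en0.
Qed.

End Approximation.

(** * Convergence in law from cosine moments *)

Section Levy.
Context {R : realType} d (Om : measurableType d) (P : probability Om R).
Variables (m : nat) (X : nat -> Om -> 'cV[R]_m) (K : R).
Hypothesis fX : forall n, finval (X n).
Hypothesis EX2 : \forall n \near \oo, EP P (fun w => \sum_j X n w j 0 ^+ 2) <= K.
Hypothesis EXcos : forall t b,
  (fun n => EP P (fun w => cos (tdot t (X n w) + b))) @ \oo -->
  cos b * expR (- ((\sum_j t j 0 ^+ 2) / 2)).

Lemma EP_trigpoly_cvg g : trigpoly g -> (fun n => EP P (fun w => g (X n w))) @ \oo --> gaussE g.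
Proof.
move=> [s gs]; have -> : g = tval s by exact/funext.
rewrite gaussE_tval.
have -> : (fun n => EP P (fun w => tval s (X n w))) =
    fun n => \sum_(a <- s) a.1.1 * EP P (fun w => cos (tdot a.1.2 (X n w) + a.2)).
  apply/funext => n; rewrite /tval EP_sum => [|a].
    apply: eq_bigr => a _; rewrite EP_Z//.
    exact: (finval_comp (fun x => cos (tdot a.1.2 x + a.2))).
  exact: (finval_comp (fun x => a.1.1 * cos (tdot a.1.2 x + a.2))).
apply: (@cvg_big R _ +%R 0) => [|a _]; first exact: add_continuous.
by apply: cvgM; [exact: cvg_cst|exact: EXcos].
Qed.

(** The second moment bound replaces tightness: the error in approximating [f] by a trigonometric
    polynomial grows at most quadratically, so its mean under [X n] is small uniformly in large
    [n]. *)
Lemma cvgd_of_cos : cvgd_stdnormal P X.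
Proof.
move=> f cf [M fM].
have M0 : 0 <= M by apply: le_trans (fM 0).
have /choice[g hg] : forall n : nat, exists g, [/\ trigpoly g, (forall v, `|g v| <= M) &
    forall x, `|f x - g x| <= (1 + 2 * M * (\sum_j x j 0 ^+ 2)) * harmonic n].
  (* Box size [n + 1] and tolerance [1 / (n + 1)]: both error terms are then at most a multiple of
     [harmonic n]. *)
  move=> n; have [||g [tg gM h]] := @trigpoly_approx R m f M n.+1%:R n.+1%:R^-1 cf fM.
  - by rewrite ler1n.
  - by rewrite invr_gt0.
  exists g; split => // x; apply: le_trans (h x) _.
  rewrite [leRHS]mulrDl mul1r /harmonic /= lerD2l mulrAC ler_wpM2l//.
    by rewrite mulr_ge0 ?mulr_ge0// sumr_ge0// => j _; exact: sqr_ge0.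
  by rewrite lef_pV2 ?posrE ?exprn_gt0// expr2 ler_peMl// ler1n.
have hc (c : R) : (fun n => c * harmonic n) @ \oo --> (0 : R).
  by rewrite -(mulr0 c); apply: cvgM; [exact: cvg_cst|exact: cvg_harmonic].
have cg : (fun n => gaussE (g n)) @ \oo --> gaussE f.
  apply: (@gaussE_cvg _ _ _ _ M) => //.
  - by move=> n; have [/continuous_trigpoly] := hg n.
  - by move=> n v; have [_ ->] := hg n.
  move=> v; apply/cvgrPdist_le => e e0.
  have /cvgrPdist_le/(_ e e0) := hc (1 + 2 * M * (\sum_j v j 0 ^+ 2)).
  apply: filterS => n; rewrite sub0r normrN => h.
  have [_ _ /(_ v) h2] := hg n; apply: le_trans h2 _.
  exact: le_trans (ler_norm _) h.
apply/cvgrPdist_le => e e0.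
have e30 : 0 < e / 3 by rewrite divr_gt0.
near \oo => n0.
have h1 : `|gaussE f - gaussE (g n0)| <= e / 3.
  by near: n0; move/cvgrPdist_le: cg; exact.
have h2 : (1 + 2 * M * K) * harmonic n0 <= e / 3.
  near: n0; move/cvgrPdist_le: (hc (1 + 2 * M * K)) => /(_ _ e30).
  by apply: filterS => n; rewrite sub0r normrN; apply: le_trans (ler_norm _).
have [tg gM hfg] := hg n0.
near=> n.
have h3 : `|gaussE (g n0) - EP P (fun w => g n0 (X n w))| <= e / 3.
  by near: n; move/cvgrPdist_le: (EP_trigpoly_cvg tg); exact.
have h4 : EP P (fun w => \sum_j X n w j 0 ^+ 2) <= K by near: n.
have ff h : finval (fun w => h (X n w) : R) by exact: finval_comp.
have h5 : `|EP P (fun w => f (X n w)) - EP P (fun w => g n0 (X n w))| <= e / 3.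
  rewrite -EP_B//; apply: le_trans (EP_norm _ _) _.
    exact: (ff (fun x => f x - g n0 x)).
  apply: le_trans h2; rewrite mulrC.
  apply: (@le_trans _ _ (EP P (fun w => harmonic n0 * (1 + 2 * M * (\sum_j X n w j 0 ^+ 2))))).
    apply: EP_le => [||w]; last by rewrite mulrC.
      exact: (ff (fun x => `|f x - g n0 x|)).
    exact: (ff (fun x => harmonic n0 * (1 + 2 * M * (\sum_j x j 0 ^+ 2)))).
  rewrite EP_Z; last exact: (ff (fun x => 1 + 2 * M * (\sum_j x j 0 ^+ 2))).
  rewrite ler_wpM2l ?harmonic_ge0// EP_D ?EP_cst; last 2 first.
  - exact: finval_cst.
  - exact: (ff (fun x => 2 * M * (\sum_j x j 0 ^+ 2))).
  rewrite lerD2l EP_Z; last exact: (ff (fun x => \sum_j x j 0 ^+ 2)).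
  by rewrite ler_wpM2l ?mulr_ge0.
rewrite -/(EP P (fun w => f (X n w))).
rewrite (_ : _ - _ = (gaussE f - gaussE (g n0)) + (gaussE (g n0) - EP P (fun w => g n0 (X n w)))
  - (EP P (fun w => f (X n w)) - EP P (fun w => g n0 (X n w)))); last by ring.
apply: le_trans (ler_normB _ _) _; apply: le_trans (lerD (ler_normD _ _) (lexx _)) _.
lra.
Unshelve. all: by end_near. Qed.

End Levy.

(** * Tail adversarial stability *)

Lemma nneseries_tail_bound (R : realType) (u : nat -> R) (e : R) : (forall k, 0 <= u k) ->
  (\sum_(0 <= k <oo) (u k)%:E < +oo)%E -> 0 < e ->
  exists m, forall M, \sum_(m <= k < M) u k <= e.
Proof.
move=> u0 s e0.
have /fine_cvg/cvgrPdist_le/(_ _ e0) := nneseries_tail_cvg s (fun k _ => u0 k).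
case=> m _ /(_ m (leqnn m)); rewrite /= sub0r normrN => h; exists m => M.
have fs : (\sum_(m <= k <oo) (u k)%:E)%E \is a fin_num.
  rewrite ge0_fin_numE; last by apply: nneseries_ge0 => k _ _; rewrite lee_fin.
  apply: le_lt_trans s; rewrite [leRHS](nneseries_split 0 m) => [|k _].
    by rewrite add0n leeDr// sume_ge0// => k _; rewrite lee_fin.
  by rewrite lee_fin.
apply: le_trans (le_trans (ler_norm _) h); rewrite -lee_fin fineK// -sumEFin.
by apply: nneseries_lim_ge => k _ _; rewrite lee_fin.
Qed.

Section Tail.
Context {R : realType} d (Om : measurableType d) (P : probability Om R).

Lemma measurable_le (X : Om -> R) (r : R) : measurable_fun setT X -> measurable [set w | X w <= r].
Proof.
move=> mX; rewrite (_ : [set _ | _] = setT `&` X @^-1` [set` `]-oo, r]]).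
  by apply: mX => //; exact: measurable_itv.
by rewrite setTI; apply/seteqP; split => w /=; rewrite in_itv.
Qed.

Lemma measurable_gt (X : Om -> R) (r : R) : measurable_fun setT X -> measurable [set w | r < X w].
Proof.
move=> mX; rewrite (_ : [set _ | _] = ~` [set w | X w <= r]).
  exact/measurableC/measurable_le.
by apply/seteqP; split => w /=; rewrite ltNge => /negP.
Qed.

Lemma measurable_gte (X : Om -> R) (q : \bar R) : measurable_fun setT X ->
  measurable [set w | (q < (X w)%:E)%E].
Proof.
move=> mX; case: q => [r||].
- by rewrite (_ : [set _ | _] = [set w | r < X w]); [exact: measurable_gt|
    apply/seteqP; split => w /=; rewrite lte_fin].
- by rewrite (_ : [set _ | _] = set0)//; apply/seteqP; split => w //=; rewrite ltNge leey.
- by rewrite (_ : [set _ | _] = setT)//; apply/seteqP; split => w //= _; rewrite ltNyr.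
Qed.

Lemma prob_compl A : measurable A -> prob P (~` A) = 1 - prob P A.
Proof.
move=> mA; have mC := measurableC mA.
by apply/EFin_inj; rewrite EFinB !probE// probability_setC.
Qed.

(* The quantile need not be attained: cover the event by [r < X <= 0], [r] rational. *)
Lemma quant_null (X : Om -> R) (t : R) : measurable_fun setT X -> Defs.cdf P X 0 = t ->
  prob P [set w | (quant (Defs.cdf P X) t < (X w)%:E <= 0)%E] = 0.
Proof.
move=> mX X0; pose F := Defs.cdf P X.
pose N k := if unpickle k is Some r then
   (if t <= F (ratr (r : rat)) then [set w | ratr r < X w <= 0] else set0) else set0.
have F_le u v : u <= v -> F u <= F v.
  by move=> uv; apply: prob_le => [||w /= /le_trans]; [exact: measurable_le..|exact].
have mN r : measurable [set w | r < X w <= 0].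
  rewrite (_ : [set _ | _] = [set w | r < X w] `&` [set w | X w <= 0]).
    by apply: measurableI; [exact: measurable_gt|exact: measurable_le].
  by apply/seteqP; split => w /= /andP.
have : P.-negligible (\bigcup_k N k).
  apply: negligible_bigcup => k; rewrite /N; case: unpickle => [r|]; last exact: negligible_set0.
  case: ifPn => [tr|_]; last exact: negligible_set0.
  exists [set w | ratr r < X w <= 0]; split => //.
  have [r0|r0] := leP (ratr r : R) 0; last first.
    rewrite (_ : [set _ | _] = set0) ?measure0//.
    by apply/seteqP; split => w //= /andP[h1 h2]; have := lt_le_trans h1 h2; rewrite ltNge (ltW r0).
  (* Since [t = F 0 <= F r], additivity leaves no mass between [r] and 0. *)
  rewrite -[LHS]/(P _) -probE//; congr (_%:E); apply/eqP; rewrite eq_le prob_ge0 andbT.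
  rewrite -(lerD2l (F (ratr r))) addr0; apply: le_trans tr; rewrite -X0 /F /Defs.cdf -lee_fin EFinD.
  have m1 := measurable_le (ratr r) mX.
  rewrite !probE ?measurable_le//; last exact: measurable_le.
  rewrite -measureU//; last first.
    by apply/seteqP; split => w //= [h] /andP[]; rewrite ltNge h.
  apply: le_measure; rewrite ?inE; [exact: measurableU|exact: measurable_le|].
  by move=> w /= [h|/andP[]//]; exact: le_trans h r0.
move=> /negligibleP.
have sub : [set w | (quant F t < (X w)%:E <= 0)%E] `<=` \bigcup_k N k.
  move=> w /= /andP[/ereal_inf_lt[_ [u /= tu <-]]]; rewrite lte_fin => uX X0'.
  have [r] := rat_in_itvoo uX; rewrite in_itv/= => /andP[ur rX].
  have tF : t <= F (ratr r) by apply: le_trans tu _; apply: F_le; exact: ltW.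
  exists (pickle r); first exact: I.
  by rewrite /N pickleK tF /mkset rX -lee_fin.
have mset : measurable [set w | (quant F t < (X w)%:E <= 0)%E].
  rewrite (_ : [set _ | _] = [set w | (quant F t < (X w)%:E)%E] `&` [set w | X w <= 0]).
    by apply: measurableI; [exact: measurable_gte|exact: measurable_le].
  by apply/seteqP; split => w /=; [move=> /andP[]|move=> [] ? ?; apply/andP].
have mNk k : measurable (N k) by rewrite /N; case: unpickle => [r|]//; case: ifP.
move=> /(_ (bigcup_measurable (fun k _ => mNk k))) h0.
apply/eqP; rewrite eq_le prob_ge0 andbT.
have -> : 0 = prob P (\bigcup_k N k) by rewrite /prob h0.
by apply: prob_le => //; exact: bigcup_measurable.
Qed.

(** The quantile at level [1 - al] is nonpositive, and by [quant_null] exceeding it is the same as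
    being positive up to a null set. The conditional probability bounds only one direction of the
    switch; the other is equally likely because [X > 0] and [Y > 0] have the same probability,
    whence the factor 2. *)
Lemma switch_prob (X Y : Om -> R) (F : R -> R) (al th : R) :
  measurable_fun setT X -> measurable_fun setT Y -> Defs.cdf P X = F -> Defs.cdf P Y = F ->
  F 0 = 1 - al -> 0 < al ->
  cprob P [set w | ((Y w)%:E <= quant F (1 - al))%E]
          [set w | (quant F (1 - al) < (X w)%:E)%E] <= th ->
  prob P [set w | ~ (0 < X w <-> 0 < Y w)] <= 2 * th * al.
Proof.
move=> mX mY XF YF F0 al0 hth.
have q0 : (quant F (1 - al) <= 0)%E by apply: ereal_inf_lbound; exists 0 => //=; rewrite F0.
set q := quant F (1 - al) in hth q0 *.
have nX : prob P [set w | (q < (X w)%:E <= 0)%E] = 0 by rewrite /q -XF quant_null ?XF.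
have nY : prob P [set w | (q < (Y w)%:E <= 0)%E] = 0 by rewrite /q -YF quant_null ?YF.
have m2 (Z : Om -> R) : measurable_fun setT Z -> measurable [set w | (q < (Z w)%:E <= 0)%E].
  move=> mZ; rewrite (_ : [set _ | _] = [set w | (q < (Z w)%:E)%E] `&` [set w | Z w <= 0]).
    by apply: measurableI; [exact: measurable_gte|exact: measurable_le].
  by apply/seteqP; split => w /=; [move=> /andP[]|move=> [] ? ?; apply/andP].
have pos (Z : Om -> R) : measurable_fun setT Z -> Defs.cdf P Z = F -> prob P [set w | 0 < Z w] = al.
  move=> mZ ZF; rewrite (_ : [set _ | _] = ~` [set w | Z w <= 0]).
    rewrite prob_compl; last exact: measurable_le.
    by rewrite -[prob _ _]/(Defs.cdf P Z 0) ZF F0; ring.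
  by apply/seteqP; split => w /=; rewrite ltNge => /negP.
have mq := measurable_gte q mX; have mqY := measurable_gte q mY.
have leY : [set w | ((Y w)%:E <= q)%E] = ~` [set w | (q < (Y w)%:E)%E].
  by apply/seteqP; split => w /=; rewrite leNgt => /negP.
have mleY : measurable [set w | ((Y w)%:E <= q)%E] by rewrite leY; exact: measurableC.
have qal : prob P [set w | (q < (X w)%:E)%E] = al.
  apply/eqP; rewrite eq_le -(pos X mX XF); apply/andP; split.
    rewrite -[leRHS]addr0 -[Z in _ <= _ + Z]nX.
    apply: prob_leU => //; [exact: measurable_gt|exact: m2|].
    move=> w /= h; have [X0|X0] := ltP 0 (X w); [by left|right].
    by rewrite h lee_fin.
  apply: prob_le => // [|w /= h]; first exact: measurable_gt.
  by apply: le_lt_trans q0 _; rewrite lte_fin.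
have hXY : prob P ([set w | 0 < X w] `&` [set w | Y w <= 0]) <= th * al.
  move: hth; rewrite /cprob qal ler_pdivrMr// => hth.
  rewrite -[leRHS]addr0 -[Z in _ <= _ + Z]nY; apply: le_trans (lerD hth (lexx _)).
  apply: prob_leU.
  - by apply: measurableI; [exact: measurable_gt|exact: measurable_le].
  - exact: measurableI.
  - exact: m2.
  move=> w /= [X0 Y0]; have [Yq|Yq] := leP (Y w)%:E q; [left; split => //|right].
    by apply: le_lt_trans q0 _; rewrite lte_fin.
  by rewrite lee_fin.
have mpX := measurable_gt 0 mX; have mpY := measurable_gt 0 mY.
have mnX := measurable_le 0 mX; have mnY := measurable_le 0 mY.
have part (U V : Om -> R) : measurable_fun setT U -> measurable_fun setT V ->
    prob P [set w | 0 < U w] = prob P ([set w | 0 < U w] `&` [set w | V w <= 0])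
      + prob P ([set w | 0 < U w] `&` [set w | 0 < V w]).
  move=> mU mV; have mpU := measurable_gt 0 mU; have mpV := measurable_gt 0 mV.
  have mnV := measurable_le 0 mV.
  apply/EFin_inj; rewrite EFinD !probE//; try exact: measurableI.
  rewrite -measureU; try exact: measurableI.
    congr (P _); apply/seteqP; split => w /=; last by move=> [[]|[]].
    by move=> U0; have [V0|V0] := ltP 0 (V w); [right|left].
  by apply/seteqP; split => w //= -[[_ h] [_]]; rewrite ltNge h.
have hYX : prob P ([set w | 0 < Y w] `&` [set w | X w <= 0]) <= th * al.
  have := part _ _ mX mY; have := part _ _ mY mX; rewrite !pos//.
  by rewrite [[set w | 0 < Y w] `&` [set w | 0 < X w]]setIC => h1 h2; lra.
rewrite (_ : 2 * th * al = th * al + th * al); last by ring.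
apply: le_trans (lerD hXY hYX); apply: prob_leU.
- by apply: measurable_xor.
- exact: measurableI.
- exact: measurableI.
move=> w /= h; have [X0|X0] := ltP 0 (X w); have [Y0|Y0] := ltP 0 (Y w).
- by exfalso; apply: h.
- by left.
- by right.
- by exfalso; apply: h; rewrite !ltNge X0 Y0; split.
Qed.

Section Theta.
Variables (e es : nat -> int -> Om -> R) (F : nat -> R -> R).
Hypothesis me : forall n i, measurable_fun setT (e n i).
Hypothesis mes : forall n i, measurable_fun setT (es n i).

Lemma cprob01 N k (q : \bar R) :
  0 <= cprob P [set w | ((es N k w)%:E <= q)%E] [set w | (q < (e N k w)%:E)%E] <= 1.
Proof.
have m1 := measurable_gte q (@me N k).
have m2 : measurable [set w | ((es N k w)%:E <= q)%E].
  rewrite (_ : [set _ | _] = ~` [set w | (q < (es N k w)%:E)%E]).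
    exact/measurableC/measurable_gte.
  by apply/seteqP; split => w /=; rewrite leNgt => /negP.
rewrite /cprob divr_ge0 ?prob_ge0//=.
have [->|h0] := eqVneq (prob P [set w | (q < (e N k w)%:E)%E]) 0; first by rewrite invr0 mulr0.
rewrite ler_pdivrMr ?lt_def ?h0 ?prob_ge0// mul1r; by apply: prob_le => //; exact: measurableI.
Qed.

(** Conditional probabilities are at most one, so the supremum is finite and [fine] returns its true
    value. *)
Lemma theta_ge n a k b N : 0 < b <= a -> (n <= N)%N ->
  cprob P [set w | ((es N k%:Z w)%:E <= quant (F N) (1 - b))%E]
          [set w | (quant (F N) (1 - b) < (e N k%:Z w)%:E)%E] <= theta P e es F n a k <= 1.
Proof.
move=> ba nN; rewrite /theta; set S := (Z in ereal_sup Z); set c := cprob _ _ _.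
have Sc : S c%:E by exists b, N.
have s1 : (ereal_sup S <= 1)%E.
  by apply: ge_ereal_sup => _ [b' [N' [_ [_ ->]]]]; rewrite lee_fin; have /andP[] := cprob01 N' k (quant (F N') (1 - b')).
have cs : (c%:E <= ereal_sup S)%E by exact: ereal_sup_ubound.
have fS : ereal_sup S \is a fin_num.
  rewrite fin_real//; apply/andP; split; first exact: lt_le_trans (ltNyr c) cs.
  exact: le_lt_trans s1 (ltry 1).
by rewrite -!lee_fin fineK// cs s1.
Qed.

(** By contradiction: if every such series diverges, the inner limits are constantly [+oo] and so is
    the outer one. In this direction the limits are computed rather than assumed to exist. *)
Lemma TAS_summable q : TAS P q e es F -> exists a n, 0 < a /\
  (\sum_(0 <= k <oo) ((theta P e es F n a k) `^ q^-1)%:E < +oo)%E.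
Proof.
move=> h; apply: contrapT => hN; move: h; rewrite /TAS.
have inf a n : 0 < a -> (\sum_(0 <= k <oo) ((theta P e es F n a k) `^ q^-1)%:E = +oo)%E.
  move=> a0; apply/eqP; rewrite -leye_eq leNgt; apply/negP => h; apply: hN; exists a, n; split=> //.
rewrite (_ : lim _ = +oo%E) ?ltxx//.
apply: cvg_lim => //; apply: cvg_near_cst; near=> a.
rewrite (_ : (fun n => _) = cst +oo%E); first exact: lim_cst.
by apply/funext => n /=; apply: inf; near: a; exact: nbhs_right_gt.
Unshelve. all: by end_near. Qed.

End Theta.
End Tail.

(** * Switching probabilities for the two pasts *)

Section Switch.
Context {R : realType} d (Om : measurableType d) (P : probability Om R).
Context dE (E : measurableType dE) (eps : int -> Om -> E) (epss : Om -> E).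
Local Notation xi := (fam eps epss).
Hypothesis iid_xi : iid P xi.

Lemma traj_same_law io io' y y' B : injective io -> injective io' ->
  (forall j, io j != y) -> (forall j, io' j != y') -> scyl B ->
  prob P (traj xi io @^-1` B) = prob P (traj xi io' @^-1` B).
Proof.
move=> i1 i2 n1 n2 sB; have := traj_law iid_xi i1 i2 n1 n2 sB measurableT.
rewrite preimage_setT prob_setT mulr1 => <-; congr (prob P _).
by apply/seteqP; split => w //= -[].
Qed.

Lemma past_same_law i j B : scyl B -> prob P (past eps i @^-1` B) = prob P (past eps j @^-1` B).
Proof.
move=> sB; have := traj_same_law (@io_past_inj i) (@io_past_inj j)
  (io_past_neq i) (io_past_neq j) sB.
have F k : traj xi (io_past k) @^-1` B = past eps k @^-1` B.
  by apply/seteqP; split => w /=; rewrite traj_past.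
by rewrite !F.
Qed.

Lemma star_same_law i j B : scyl B ->
  prob P (pastS eps epss i @^-1` B) = prob P (past eps j @^-1` B).
Proof.
move=> sB; have := traj_same_law (@io_star_inj i) (@io_past_inj j)
  (io_star_neq i) (io_past_neq j) sB.
rewrite (_ : traj xi (io_past j) @^-1` B = past eps j @^-1` B); last first.
  by apply/seteqP; split => w /=; rewrite traj_past.
rewrite (_ : traj xi (io_star i) @^-1` B = pastS eps epss i @^-1` B)//.
by apply/seteqP; split => w /=; rewrite traj_star.
Qed.

Variable G : nat -> (nat -> E) -> R.
Hypothesis mG : forall n, seq_measurable_fun (G n).

Lemma measurable_Gpast n i : measurable_fun setT (fun w => G n (past eps i w)).
Proof.
move=> _ B mB; rewrite setTI.
have -> : (fun w => G n (past eps i w)) @^-1` B = traj xi (io_past i) @^-1` (G n @^-1` B).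
  by apply/seteqP; split => w /=; rewrite traj_past.
by apply: (measurable_traj iid_xi); exact: mG.
Qed.

Lemma measurable_Gstar n i : measurable_fun setT (fun w => G n (pastS eps epss i w)).
Proof.
move=> _ B mB; rewrite setTI.
have -> : (fun w => G n (pastS eps epss i w)) @^-1` B = traj xi (io_star i) @^-1` (G n @^-1` B).
  by apply/seteqP; split => w /=; rewrite traj_star.
by apply: (measurable_traj iid_xi); exact: mG.
Qed.

Lemma scyl_pos n : scyl [set s | 0 < G n s].
Proof.
rewrite (_ : [set _ | _] = G n @^-1` [set` `]0, +oo[]); first by apply: mG; exact: measurable_itv.
by apply/seteqP; split => w /=; rewrite in_itv /= andbT.
Qed.

Variable al : nat -> R.
Hypothesis al01 : forall n, 0 < al n < 1.
Hypothesis G0 : forall n, (0 < n)%N -> prob P [set w | G n (past eps 1 w) <= 0] = 1 - al n.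

Lemma prob_Gpos n i : (0 < n)%N -> prob P (past eps i @^-1` [set s | 0 < G n s]) = al n.
Proof.
move=> n0; rewrite (past_same_law i 1 (scyl_pos n)).
rewrite (_ : _ @^-1` _ = ~` [set w | G n (past eps 1 w) <= 0]).
  by rewrite prob_compl ?G0//; [ring|exact/measurable_le/measurable_Gpast].
by apply/seteqP; split => w /=; rewrite ltNge => /negP.
Qed.

Hypothesis al0 : al @ \oo --> 0.

(** The supremum in [theta] runs over all levels up to [a] and all indices from [n0] on; the single
    sequence [s l = sqrt (theta l)] therefore serves every large [n]. *)
Lemma switch_summable q : 2 <= q ->
  TAS P q (fun n i w => G n (past eps i w)) (fun n i w => G n (pastS eps epss i w))
    (fun n => Defs.cdf P (fun w => G n (past eps 1 w))) ->
  exists s : nat -> R, [/\ forall l, 0 <= s l,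
    forall e, 0 < e -> exists m, forall M, \sum_(m <= l < M) s l <= e &
    \forall n \near \oo, forall l : nat,
      prob P [set w | ~ (0 < G n (past eps l%:Z w) <-> 0 < G n (pastS eps epss l%:Z w))]
      <= 2 * s l ^+ 2 * al n].
Proof.
move=> q2 /(TAS_summable)[a [n0 [a0 sum]]].
pose F n := Defs.cdf P (fun w => G n (past eps 1 w)).
have thE := theta_ge P F measurable_Gpast measurable_Gstar.
pose th := theta P (fun n i w => G n (past eps i w)) (fun n i w => G n (pastS eps epss i w)) F n0 a.
have th01 l : 0 <= th l <= 1.
  have aa : 0 < a <= a by rewrite a0 lexx.
  have /andP[h ->] := thE n0 a l a n0 aa (leqnn n0).
  rewrite andbT; apply: le_trans h.
  by have /andP[] := cprob01 P measurable_Gpast measurable_Gstar n0 l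
     (quant (Defs.cdf P (fun w => G n0 (past eps 1 w))) (1 - a)).
exists (fun l => Num.sqrt (th l)); split => [l|e e0|]; first exact: sqrtr_ge0.
- have [m hm] := nneseries_tail_bound (fun k => powR_ge0 _ _) sum e0.
  exists m => M; apply: le_trans (hm M); apply: ler_sum => l _.
  have /andP[t0 t1] := th01 l.
  (* [theta^(1/2) <= theta^(1/q)], since [theta <= 1] and [q >= 2]. Base zero is treated apart
     because the comparison goes through the logarithm. *)
  rewrite -powR12_sqrt// -[theta _ _ _ _ _ _ _]/(th l); move: t0; rewrite le_eqVlt => /predU1P[<-|t0].
    by rewrite !powR0 ?invr_neq0//; apply/eqP => q0; lra.
  rewrite /powR gt_eqF// ler_expR ler_wnM2r//; first exact: ln_le0.
  by rewrite lef_pV2 ?posrE//; lra.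
near=> n => l.
have alna : 0 < al n <= a.
  have /andP[-> _] /= := al01 n.
  near: n; move: al0 => /cvgrPdist_le/(_ _ a0); apply: filterS => k.
  by rewrite sub0r normrN; apply: le_trans; exact: ler_norm.
have np : (0 < n)%N by near: n; exact: nbhs_infty_gt.
have nn : (n0 <= n)%N by near: n; exact: nbhs_infty_ge.
have /andP[h _] := thE n0 a l (al n) n alna nn.
have /andP[t0 _] := th01 l.
rewrite sqr_sqrtr//; have /andP[al_gt0 _] := alna.
have cdfE (Y : Om -> nat -> E) : (forall B, scyl B -> prob P (Y @^-1` B) = prob P (past eps 1 @^-1` B)) ->
   Defs.cdf P (fun w => G n (Y w)) = Defs.cdf P (fun w => G n (past eps 1 w)).
  move=> hY; apply/funext => u; apply: (hY (G n @^-1` [set` `]-oo, u]])).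
  by apply: mG; exact: measurable_itv.
apply: (switch_prob (measurable_Gpast n l%:Z) (measurable_Gstar n l%:Z) _ _ _ al_gt0 h).
- by apply: cdfE => B sB; exact: past_same_law.
- by apply: cdfE => B sB; exact: star_same_law.
- exact: G0.
Unshelve. all: by end_near. Qed.

End Switch.

(** * Asymptotics of the linear form *)

Section VectorAlgebra.
Context {R : realType}.

Lemma tdotE m (s t : 'cV[R]_m) : tdot s t = (s^T *m t) 0 0.
Proof. by rewrite mxE; apply: eq_bigr => j _; rewrite mxE. Qed.

Lemma tdotC m (s t : 'cV[R]_m) : tdot s t = tdot t s.
Proof. by apply: eq_bigr => j _; rewrite mulrC. Qed.

Lemma tdot_mulmx m k (A : 'M[R]_(m, k)) s t : tdot s (A *m t) = tdot (A^T *m s) t.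
Proof. by rewrite !tdotE trmx_mul trmxK mulmxA. Qed.

Lemma tdot_ge0 m (s : 'cV[R]_m) : 0 <= tdot s s.
Proof. by apply: sumr_ge0 => j _; rewrite -expr2 sqr_ge0. Qed.

Lemma vnorm_sqr m (s : 'cV[R]_m) : vnorm s ^+ 2 = tdot s s.
Proof.
rewrite sqr_sqrtr; last by apply: sumr_ge0 => j _; exact: sqr_ge0.
by apply: eq_bigr => j _; rewrite expr2.
Qed.

Lemma tdot_CS m (s t : 'cV[R]_m) : tdot s t ^+ 2 <= tdot s s * tdot t t.
Proof.
have E (F : 'I_m -> R) : \sum_i F i = fexp (fun=> 1) F.
  by apply: eq_bigr => i _; rewrite mul1r.
rewrite /tdot !E; apply: le_trans (fexp_CS _ _ _) _; first by move=> x; exact: ler01.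
by rewrite le_eqVlt; apply/orP; left; apply/eqP; congr (_ * _); apply: eq_fexp => i; rewrite expr2.
Qed.

Lemma sum_mxvec m k (F : 'I_(m * k) -> R) : \sum_j F j = \sum_i \sum_j F (mxvec_index i j).
Proof.
rewrite pair_bigA (reindex _ (curry_mxvec_bij _ _)) /=.
by apply: eq_bigr => -[i j].
Qed.

Lemma tdot_kron m k (u : 'cV[R]_(m * k)) (a : 'cV[R]_m) (b : 'cV[R]_k) :
  tdot u (kron a b) = \sum_i a i 0 * (vec_mx u^T *m b) i 0.
Proof.
rewrite /tdot sum_mxvec.
apply: eq_bigr => i _; rewrite mxE mulr_sumr; apply: eq_bigr => j _.
by rewrite /kron [(mxvec _)^T _ _]mxE mxvecE mxE big_ord1 !mxE; ring.
Qed.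

Lemma vec_mx_mul_le m k (u : 'cV[R]_(m * k)) (b : 'cV[R]_k) i :
  (vec_mx u^T *m b) i 0 ^+ 2 <= tdot u u * tdot b b.
Proof.
have -> : (vec_mx u^T *m b) i 0 = tdot (row i (vec_mx u^T))^T b.
  by rewrite mxE; apply: eq_bigr => j _; rewrite !mxE.
apply: le_trans (tdot_CS _ _) _; apply: ler_wpM2r; first exact: tdot_ge0.
rewrite [leRHS]sum_mxvec
 (bigD1 i) //= -[leLHS]addr0; apply: lerD; last first.
  by do 2![apply: sumr_ge0 => ? _]; rewrite -expr2 sqr_ge0.
by apply: ler_sum => j _; rewrite !mxE.
Qed.

Lemma vnorm_le_maxi n p (z : 'I_n -> 'cV[R]_p) i : vnorm (z i) <= maxi (fun i => vnorm (z i)).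
Proof. by rewrite /maxi (bigD1 i) //= le_max lexx. Qed.

Section Design.
Variables (p : nat) (x : forall n, 'I_n -> 'cV[R]_p) (n : nat).
Hypothesis n0 : (0 < n)%N.
Hypothesis uS : Sigma x n \in unitmx.

Lemma Sigma_quadratic (v : 'cV_p) : (v^T *m Sigma x n *m v) 0 0 = n%:R^-1 * \sum_(i < n) tdot (x i) v ^+ 2.
Proof.
rewrite -mulmxA /Sigma -scalemxAl -scalemxAr mxE mulmx_suml mulmx_sumr summxE; congr (_ * _).
apply: eq_bigr => i _; by rewrite -mulmxA [v^T *m _]mulmxA mxE big_ord1 -!tdotE [tdot v _]tdotC expr2.
Qed.

(** A vanishing quadratic form makes every [x i] orthogonal to [v]; then [Sigma] kills [v], and
    invertibility concludes. *)
Lemma posdef_Sigma : posdef (Sigma x n).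
Proof.
have nV : 0 < n%:R^-1 :> R by rewrite invr_gt0 ltr0n.
split.
  rewrite /Sigma linearZ /= raddf_sum /=; congr (_ *: _); apply: eq_bigr => i _.
  by rewrite trmx_mul trmxK.
move=> v v0; rewrite Sigma_quadratic lt_def; apply/andP; split; last first.
  by apply: mulr_ge0; [exact: ltW|apply: sumr_ge0 => i _; exact: sqr_ge0].
apply: contra v0; rewrite mulf_eq0 gt_eqF//= psumr_eq0 => [/allP h|i _]; last exact: sqr_ge0.
suff Sv : Sigma x n *m v = 0 by rewrite -[v](mulKmx uS) Sv mulmx0.
rewrite /Sigma -scalemxAl mulmx_suml big1 ?scaler0// => i _.
have /= := h i (mem_index_enum _); rewrite sqrf_eq0 => /eqP xv.
rewrite -mulmxA (_ : (x i)^T *m v = 0) ?mulmx0//.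
by apply/matrixP => a b; rewrite !ord1 -tdotE xv mxE.
Qed.

(** Trace of the conjugate of [Sigma] by its inverse square root, which is the identity. *)
Lemma sum_vnorm_zz : n%:R^-1 * \sum_(i < n) vnorm (zz x i) ^+ 2 = p%:R.
Proof.
have [[sS _] _] := invsqrtmxP posdef_Sigma.
have := invsqrtmx_conj posdef_Sigma.
rewrite {2}/Sigma -scalemxAr -scalemxAl mulmx_sumr mulmx_suml => /(congr1 (@mxtrace _ _)).
rewrite mxtrace1 linearZ /= raddf_sum /= => <-; congr (_ * _); apply: eq_bigr => i _.
rewrite vnorm_sqr tdotE /zz trmx_mul sS.
rewrite (_ : (_ *m _) 0 0 = \tr ((x i)^T *m invsqrtmx (Sigma x n) *m (invsqrtmx (Sigma x n) *m x i))).
  by rewrite mxtrace_mulC !mulmxA.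
by rewrite /mxtrace big_ord1.
Qed.

End Design.

End VectorAlgebra.

Section SecondMoment.
Context {R : realType} d (Om : measurableType d) (P : probability Om R).
Variables (m : nat) (T : Om -> 'cV[R]_m).
Hypothesis fT : finval T.

Lemma Emx_tr : (Emx P T)^T = Emx P T.
Proof.
apply/matrixP => r s; rewrite !mxE; congr (Rintegral _ _ _).
by apply/funext => w; rewrite mulrC.
Qed.

Lemma Emx_quadratic v : (v^T *m Emx P T *m v) 0 0 = EP P (fun w => tdot v (T w) ^+ 2).
Proof.
rewrite (_ : (fun w => _) = fun w => \sum_s \sum_r (v r 0 * v s 0) * (T w r 0 * T w s 0)).
  rewrite EP_sum => [|s]; last first.
    exact: (finval_comp (fun x : 'cV[R]_m => \sum_r (v r 0 * v s 0) * (x r 0 * x s 0))).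
  rewrite mxE; apply: eq_bigr => s _; rewrite EP_sum => [|r]; last first.
    exact: (finval_comp (fun x : 'cV[R]_m => (v r 0 * v s 0) * (x r 0 * x s 0))).
  rewrite mxE mulr_suml; apply: eq_bigr => r _; rewrite EP_Z; last first.
    exact: (finval_comp (fun x : 'cV[R]_m => x r 0 * x s 0)).
  by rewrite !mxE /EP; ring.
apply/funext => w; rewrite expr2 /tdot mulr_suml exchange_big /=.
apply: eq_bigr => r _; rewrite mulr_sumr; apply: eq_bigr => s _; ring.
Qed.

Lemma Emx_psd : psd (Emx P T).
Proof.
split; first exact: Emx_tr.
by move=> v; rewrite Emx_quadratic; apply: Rintegral_ge0 => w _; exact: sqr_ge0.
Qed.

Lemma Emx_eigenvalue_le C a : (forall v, EP P (fun w => tdot v (T w) ^+ 2) <= C * tdot v v) ->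
  eigenvalue (Emx P T) a -> `|a| <= C.
Proof.
move=> h /eigenvalueP[u uE u0].
have uT0 : u^T != 0 by rewrite trmx_eq0.
have := dot_gt0 uT0; rewrite -tdotE => u_gt0.
have E : a * tdot u^T u^T = EP P (fun w => tdot u^T (T w) ^+ 2).
  by rewrite -Emx_quadratic trmxK uE -scalemxAl mxE tdotE trmxK.
have [_ /(_ u^T)] := Emx_psd; rewrite Emx_quadratic -E pmulr_lge0// => a0.
by rewrite ger0_norm// -(ler_pM2r u_gt0) E.
Qed.

End SecondMoment.

(** * The linear form of the quantile scores *)

Section QuantileScores.
Context {R : realType} (p : nat) d (Om : measurableType d) (P : probability Om R).
Context dE (E : measurableType dE) (eps : int -> Om -> E) (epss : Om -> E).
Variables (x : forall n, 'I_n -> 'cV[R]_p) (alpha : 'I_2 -> nat -> R).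
Variables (gam : 'I_2 -> forall n, 'I_n -> R) (G : 'I_2 -> nat -> (nat -> E) -> R).
Hypothesis iid_xi : iid P (fam eps epss).
Hypothesis mG : forall k n, seq_measurable_fun (G k n).
Hypothesis al01 : forall k n, 0 < alpha k n < 1.
Hypothesis gam_gt0 : forall k n (i : 'I_n), 0 < gam k i.
Hypothesis G0 : forall k n, (0 < n)%N ->
  prob P [set w | G k n (past eps 1 w) <= 0] = 1 - alpha k n.

Definition score n (i : 'I_n) w : 'cV[R]_2 :=
  \col_(k < 2) ((Num.sqrt (alpha k n * (1 - alpha k n)))^-1 *
    ((1 - alpha k n) - (if gam k i * G k n (past eps (i.+1)%:Z w) <= 0 then 1 else 0))).
Definition score_sum n w : 'cV[R]_(2 * p) :=
  (Num.sqrt n%:R)^-1 *: \sum_(i < n) kron (score i w) (zz x i).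
Local Notation T := score_sum.
Local Notation Gam n := (Emx P (T n)).

Let pos n k : set (nat -> E) := [set s | 0 < G k n s].
Let sd k n := Num.sqrt (alpha k n * (1 - alpha k n)).
Definition coef n (u : 'cV[R]_(2 * p)) (i : 'I_n) k : R :=
  (Num.sqrt n%:R)^-1 * (sd k n)^-1 * (vec_mx u^T *m zz x i) k 0.

Lemma scoreE n (i : 'I_n) w k : score i w k 0 =
  (sd k n)^-1 * ((`[< pos n k (past eps (i.+1)%:Z w) >])%:R - alpha k n).
Proof.
rewrite mxE; congr (_ * _); rewrite pmulr_rle0//.
have [le0|gt0] := leP; last by rewrite asboolT// subr0.
by rewrite asboolF ?mulr0n; [ring|rewrite /pos /= ltNge le0].
Qed.

Lemma tdot_T n u w : tdot u (T n w) = wsum eps (pos n) (@coef n u) (alpha^~ n) w.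
Proof.
rewrite /score_sum tdotE -scalemxAr mxE mulmx_sumr summxE mulr_sumr; apply: eq_bigr => i _.
rewrite -tdotE tdot_kron mulr_sumr; apply: eq_bigr => k _.
by rewrite scoreE /coef; ring.
Qed.

Lemma finval_T n : finval (T n).
Proof.
pose h (q : {ffun 'I_n * 'I_2 -> bool}) : 'cV[R]_(2 * p) := (Num.sqrt n%:R)^-1 *: \sum_(i < n)
  kron (\col_(k < 2) ((sd k n)^-1 * ((q (i, k))%:R - alpha k n))) (zz x i).
rewrite (_ : T n = fun w => h [ffun ik : 'I_n * 'I_2 =>
    `[< pos n ik.2 (past eps ((ik.1 : 'I_n).+1)%:Z w) >]]).
  apply: (finval_comp h); apply: (finval_ffun false) => -[i k].
  apply: finval_asbool; rewrite /= [Z in measurable Z](_ : _ =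
      traj (fam eps epss) (io_past (i.+1)%:Z) @^-1` pos n k).
    by apply: (measurable_traj iid_xi); exact: (scyl_pos (mG k)).
  by apply/seteqP; split => w /=; rewrite traj_past.
apply/funext => w; rewrite /score_sum /h; congr (_ *: _); apply: eq_bigr => i _; congr kron.
by apply/colP => k; rewrite scoreE mxE ffunE.
Qed.

Section Level.
Variables (n : nat) (s : 'I_2 -> nat -> R).
Hypothesis n0 : (0 < n)%N.
Hypothesis uS : Sigma x n \in unitmx.
Hypothesis al_half : forall k, alpha k n <= 2^-1.
Hypothesis s_ge0 : forall k l, 0 <= s k l.
Hypothesis switch : forall k (l : nat), prob P
  [set w | ~ (0 < G k n (past eps l%:Z w) <-> 0 < G k n (pastS eps epss l%:Z w))]
  <= 2 * s k l ^+ 2 * alpha k n.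
Variable eta : R.
Hypothesis etaP : forall k (i : 'I_n),
  (Num.sqrt n%:R)^-1 * (sd k n)^-1 * vnorm (zz x i) <= eta.
Variables (m : nat) (D Dm : R).
(** [3^2] exceeds [8 = 2 * 2 * 2]: two levels, the factor 2 in [switch], and [(1 - alpha)^-1 <= 2].
    A single square has to dominate the sum over both levels. *)
Let delta l : R := 3 * \sum_k s k l.
Hypothesis sumD : forall M, \sum_(l < M) delta l <= D.
Hypothesis sumDm : forall M, \sum_(m <= l < M) delta l <= Dm.

Let sn_gt0 : 0 < (Num.sqrt n%:R)^-1 :> R.
Proof. by rewrite invr_gt0 sqrtr_gt0 ltr0n. Qed.

Let sd_gt0 k : 0 < sd k n.
Proof. by have /andP[a0 a1] := al01 k n; rewrite sqrtr_gt0 mulr_gt0// subr_gt0. Qed.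

Lemma score_clt (u : 'cV[R]_(2 * p)) (c0 : R) : let B2 := vnorm u * Num.sqrt p%:R in
  EP P (fun w => tdot u (T n w) ^+ 2) <= (B2 * D) ^+ 2 /\
  `|EP P (fun w => cos (tdot u (T n w) + c0))
    - cos c0 * expR (- (EP P (fun w => tdot u (T n w) ^+ 2) / 2))|
  <= B2 * Dm + 2 * B2 ^+ 2 * D * Dm + (20 * m ^ 2)%:R * (2 * vnorm u * eta) * (B2 * D) ^+ 2.
Proof.
move=> B2; pose b (i : 'I_n) : R := (Num.sqrt n%:R)^-1 * vnorm u * vnorm (zz x i).
have vn0 q (v : 'cV[R]_q) : 0 <= vnorm v by exact: sqrtr_ge0.
have b0 i : 0 <= b i.
  by apply: mulr_ge0 => //; apply: mulr_ge0 => //; exact: ltW.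
have snsd k : 0 <= (Num.sqrt n%:R)^-1 * (sd k n)^-1.
  by apply: mulr_ge0; apply: ltW => //; rewrite invr_gt0.
have delta0 l : 0 <= delta l by rewrite /delta mulr_ge0// sumr_ge0.
(* By [sum_vnorm_zz] the squared weights [b i] add up to [|u|^2 p], whatever the design. *)
have B2E : Num.sqrt (\sum_i b i ^+ 2) = B2.
  rewrite (_ : \sum_i _ = B2 ^+ 2) ?sqrtr_sqr ?ger0_norm ?mulr_ge0 ?sqrtr_ge0//.
  rewrite /B2 exprMn [Num.sqrt p%:R ^+ 2]sqr_sqrtr// -(sum_vnorm_zz n0 uS) mulrA mulr_sumr; apply: eq_bigr => i _.
  by rewrite /b !exprMn exprVn [Num.sqrt n%:R ^+ 2]sqr_sqrtr//; ring.
have al1 k : prob P (past eps 0 @^-1` pos n k) = alpha k n.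
  exact: (prob_Gpos iid_xi (mG k) (@G0 k)).
have cle k (i : 'I_n) : `|coef u i k| <= (Num.sqrt n%:R)^-1 * (sd k n)^-1 * (vnorm u * vnorm (zz x i)).
  rewrite /coef normrM (ger0_norm (snsd k)); apply: ler_wpM2l => //.
  rewrite -(@ler_pXn2r _ 2)// ?nnegrE ?mulr_ge0// real_normK ?num_real// exprMn !vnorm_sqr.
  exact: vec_mx_mul_le.
have ab (i : 'I_n) l : \sum_k 2 * coef u i k ^+ 2 * (2 * s k l ^+ 2 * alpha k n) <= (b i * delta l) ^+ 2.
  have h k : 2 * coef u i k ^+ 2 * (2 * s k l ^+ 2 * alpha k n) <= (b i) ^+ 2 * (8 * s k l ^+ 2).
    have c2 : coef u i k ^+ 2 <= b i ^+ 2 * (sd k n)^-1 ^+ 2.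
      rewrite -exprMn -[coef u i k ^+ 2]real_normK ?num_real// ler_pXn2r ?nnegrE//.
        by apply: le_trans (cle k i) _; rewrite /b le_eqVlt; apply/orP; left; apply/eqP; ring.
      by rewrite mulr_ge0// invr_ge0 ltW.
    have /andP[a0 a1] := al01 k n.
    have sdE : (sd k n)^-1 ^+ 2 = (alpha k n)^-1 * (1 - alpha k n)^-1.
      by rewrite exprVn sqr_sqrtr ?invfM// mulr_ge0 ?subr_ge0 ?ltW.
    rewrite [leLHS](_ : _ = coef u i k ^+ 2 * (4 * s k l ^+ 2 * alpha k n)); last by ring.
    apply: le_trans (ler_wpM2r _ c2) _.
      by apply: mulr_ge0; [apply: mulr_ge0 => //; exact: sqr_ge0|exact: ltW].
    rewrite sdE -[leLHS]mulrA; apply: ler_wpM2l; first exact: sqr_ge0.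
    rewrite [leLHS](_ : _ = (1 - alpha k n)^-1 * (4 * s k l ^+ 2)); last first.
      have an0 : alpha k n != 0 by rewrite gt_eqF.
      by move: (1 - alpha k n)^-1 => V; field.
    rewrite (_ : 8 * _ = 2 * (4 * s k l ^+ 2)); last by ring.
    apply: ler_wpM2r; first by apply: mulr_ge0 => //; exact: sqr_ge0.
    rewrite invf_ple ?posrE ?subr_gt0//; have := al_half k; lra.
  apply: le_trans (ler_sum _ (fun k _ => h k)) _.
  rewrite -mulr_sumr [leRHS]exprMn; apply: ler_wpM2l; first exact: sqr_ge0.
  rewrite /delta !big_ord_recl !big_ord0 !addr0.
  move: (s_ge0 ord0 l) (s_ge0 (lift ord0 ord0) l).
  move: (s _ _) (s _ _) => s0 s1 h0 h1.
  have : 0 <= s0 * s1 by exact: mulr_ge0.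
  have := sqr_ge0 s0; have := sqr_ge0 s1; nra.
have aeta (i : 'I_n) : \sum_k `|coef u i k| <= 2 * vnorm u * eta.
  have h k : `|coef u i k| <= vnorm u * eta.
    apply: le_trans (cle k i) _; rewrite mulrCA; apply: ler_wpM2l => //.
  apply: le_trans (ler_sum _ (fun k _ => h k)) _.
  by rewrite sumr_const card_ord -mulrA mulr_natl.
have [h1 h2] := wsum_clt iid_xi (fun k => scyl_pos (mG k) n) al1 switch b0 delta0 ab aeta
  sumD sumDm c0.
rewrite B2E in h1 h2; split.
  by rewrite (_ : (fun w => _) = fun w => wsum eps (pos n) (@coef n u) (alpha^~ n) w ^+ 2)//;
    apply/funext => w; rewrite tdot_T.
have E1 : (fun w => tdot u (T n w)) = wsum eps (pos n) (@coef n u) (alpha^~ n).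
  by apply/funext => w; rewrite tdot_T.
have E2 (F : R -> R) : (fun w => F (tdot u (T n w))) =
    (fun w => F (wsum eps (pos n) (@coef n u) (alpha^~ n) w)).
  by apply/funext => w; rewrite tdot_T.
by rewrite (E2 (fun y => cos (y + c0))) (E2 (fun y => y ^+ 2)).
Qed.

End Level.

Section Asymptotics.
Variable s : 'I_2 -> nat -> R.
Hypothesis s_ge0 : forall k l, 0 <= s k l.
Hypothesis s_tail : forall k e, 0 < e -> exists m, forall M, \sum_(m <= l < M) s k l <= e.
Hypothesis switch : forall k, \forall n \near \oo, forall l : nat, prob P
  [set w | ~ (0 < G k n (past eps l%:Z w) <-> 0 < G k n (pastS eps epss l%:Z w))]
  <= 2 * s k l ^+ 2 * alpha k n.
Hypothesis uS : \forall n \near \oo, Sigma x n \in unitmx.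
Hypothesis al_cvg0 : forall k, alpha k @ \oo --> 0.
Hypothesis zmax_o : forall k, is_o (fun n => maxi (fun i : 'I_n => vnorm (zz x i)))
  (fun n => Num.sqrt (n%:R * alpha k n)).

Let delta l : R := 3 * \sum_k s k l.

Lemma delta_tail e : 0 < e -> exists m, forall M, \sum_(m <= l < M) delta l <= e.
Proof.
(* The 6 is the factor 3 of [delta] times the two levels. *)
move=> e0; have /choice[mm hm] : forall k, exists m, forall M, \sum_(m <= l < M) s k l <= e / 6.
  by move=> k; apply: s_tail; rewrite divr_gt0.
exists (\max_k mm k)%N => M.
have h k : \sum_(\max_k mm k <= l < M) s k l <= e / 6.
  apply: le_trans (hm k M); have mk : (mm k <= \max_k mm k)%N by exact: leq_bigmax.
  have [mM|Mm] := leqP (\max_k mm k)%N M; last first.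
    by rewrite big_geq ?(ltnW Mm)//; apply: sumr_ge0.
  by rewrite [leRHS](big_cat_nat mk mM) /= lerDr; apply: sumr_ge0.
rewrite /delta -mulr_sumr exchange_big /= big_ord_recl big_ord_recl big_ord0 addr0.
have := h ord0; have := h (lift ord0 ord0); lra.
Qed.

Lemma delta_bounded : exists D, forall M, \sum_(l < M) delta l <= D.
Proof.
have [m hm] := delta_tail ltr01.
have d0 l : 0 <= delta l by rewrite /delta mulr_ge0// sumr_ge0.
exists (\sum_(0 <= l < m) delta l + 1) => M.
rewrite -(big_mkord xpredT) /=; have [mM|Mm] := leqP m M.
  by rewrite (big_cat_nat (leq0n m) mM) /= lerD2l.
rewrite [leRHS](_ : _ = \sum_(0 <= l < M) delta l + (\sum_(M <= l < m) delta l + 1)).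
  by rewrite lerDl addr_ge0// sumr_ge0.
by rewrite addrA -(big_cat_nat (leq0n M) (ltnW Mm)).
Qed.

Lemma near_level_half k : \forall n \near \oo, alpha k n <= 2^-1.
Proof.
have h0 : 0 < 2^-1 :> R by rewrite invr_gt0.
have := al_cvg0 k => /cvgrPdist_le/(_ _ h0).
by apply: filterS => n; rewrite sub0r normrN; apply: le_trans; exact: ler_norm.
Qed.

Lemma near_eta eta : 0 < eta -> \forall n \near \oo, forall k (i : 'I_n),
  (Num.sqrt n%:R)^-1 * (sd k n)^-1 * vnorm (zz x i) <= eta.
Proof.
move=> eta0; apply: filter_forall => k.
have alh := near_level_half k.
(* [sqrt alpha <= 2 sd] once [alpha <= 1/2], so bounding [z] with half of [eta] suffices. *)
have eta20 : 0 < eta / 2 by rewrite divr_gt0.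
near=> n => i.
have np : (0 < n)%N by near: n; exact: nbhs_infty_gt.
have /andP[a0 a1] := al01 k n.
have ah : alpha k n <= 2^-1 by near: n.
have nR : 0 < n%:R :> R by rewrite ltr0n.
have zi : vnorm (zz x i) <= eta / 2 * Num.sqrt (n%:R * alpha k n).
  apply: le_trans (vnorm_le_maxi (fun i => zz x i) i) _; apply: le_trans (ler_norm _) _.
  by rewrite -[Num.sqrt _]ger0_norm ?sqrtr_ge0//; near: n; exact: zmax_o.
have sq0 : 0 < Num.sqrt n%:R * sd k n.
  by rewrite mulr_gt0 ?sqrtr_gt0// mulr_gt0// subr_gt0.
rewrite -invfM mulrC ler_pdivrMr//; apply: le_trans zi _.
rewrite -mulrA ler_pM2l// mulrC ler_pdivrMr// -sqrtrM ?ler0n//.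
rewrite -[leLHS]ger0_norm ?sqrtr_ge0// -(@ler_pXn2r _ 2)// ?nnegrE ?mulr_ge0 ?sqrtr_ge0//.
rewrite exprMn ger0_norm ?sqrtr_ge0// !sqr_sqrtr; last 2 first.
- by apply: mulr_ge0; [exact: ltW|apply: mulr_ge0; [exact: ltW|rewrite subr_ge0; exact: ltW]].
- by apply: mulr_ge0; exact: ltW.
rewrite -mulrA ler_pM2l// -mulrA ler_peMr//; first exact: ltW.
lra.
Unshelve. all: by end_near. Qed.

Let good n := [/\ (0 < n)%N, Sigma x n \in unitmx, forall k, alpha k n <= 2^-1 &
  forall k (l : nat), prob P
  [set w | ~ (0 < G k n (past eps l%:Z w) <-> 0 < G k n (pastS eps epss l%:Z w))]
  <= 2 * s k l ^+ 2 * alpha k n].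

Lemma near_good : \forall n \near \oo, good n.
Proof.
near=> n; split.
- by near: n; exact: nbhs_infty_gt.
- by near: n.
- by near: n; apply: filter_forall => k; exact: near_level_half.
- by near: n; apply: filter_forall => k; exact: switch.
Unshelve. all: by end_near. Qed.

Lemma score_second_moment : exists C, \forall n \near \oo, forall u,
  EP P (fun w => tdot u (T n w) ^+ 2) <= C * tdot u u.
Proof.
have [D hD] := delta_bounded.
exists (p%:R * D ^+ 2); near=> n => u.
have [n0 uSn alh sw] : good n by near: n; exact: near_good.
have et : forall k (i : 'I_n), (Num.sqrt n%:R)^-1 * (sd k n)^-1 * vnorm (zz x i) <= 1.
  by near: n; exact: near_eta.
have D' M : \sum_(0 <= l < M) delta l <= D by rewrite big_mkord.
have [h _] := score_clt n0 uSn alh s_ge0 sw et hD D' u 0.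
apply: le_trans h _; rewrite !exprMn vnorm_sqr [Num.sqrt p%:R ^+ 2]sqr_sqrtr//.
by rewrite le_eqVlt; apply/orP; left; apply/eqP; ring.
Unshelve. all: by end_near. Qed.

(** The direction [u n] is allowed to move with [n], as it does for [Gam^(-1/2) t]; its bounded norm
    makes the error uniform, and the constant variance identifies the limit. *)
Lemma score_cos_cvg (u : forall n, 'cV[R]_(2 * p)) (V sg b : R) : 0 <= V ->
  (\forall n \near \oo, vnorm (u n) <= V) ->
  (\forall n \near \oo, EP P (fun w => tdot (u n) (T n w) ^+ 2) = sg) ->
  (fun n => EP P (fun w => cos (tdot (u n) (T n w) + b))) @ \oo --> cos b * expR (- (sg / 2)).
Proof.
move=> V0 uV usg; have [D hD] := delta_bounded.
have D0 : 0 <= D by have := hD 0; rewrite big_ord0.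
pose K := V * Num.sqrt p%:R; have K0 : 0 <= K by rewrite mulr_ge0// sqrtr_ge0.
have C0 : 0 <= K + 2 * K ^+ 2 * D.
  by apply: addr_ge0 => //; apply: mulr_ge0 => //; apply: mulr_ge0 => //; exact: sqr_ge0.
apply/cvgrPdist_le => e e0.
(* [Dm] pays for the truncation and fixes [m]; only then can [eta], which is multiplied by [m^2], be
   chosen. The added 1 keeps the denominators positive. *)
pose Dm := e / 2 / (K + 2 * K ^+ 2 * D + 1).
have Dm0 : 0 < Dm by rewrite /Dm !divr_gt0// ltr_wpDl.
have [m hm] := delta_tail Dm0.
pose c := (20 * m ^ 2)%:R * (2 * V) * (K * D) ^+ 2.
have c0 : 0 <= c.
  by apply: mulr_ge0; [apply: mulr_ge0; [exact: ler0n|exact: mulr_ge0]|exact: sqr_ge0].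
pose eta := e / 2 / (c + 1).
have eta0 : 0 < eta by rewrite /eta !divr_gt0// ltr_wpDl.
near=> n.
have [n0 uSn alh sw] : good n by near: n; exact: near_good.
have et : forall k (i : 'I_n), (Num.sqrt n%:R)^-1 * (sd k n)^-1 * vnorm (zz x i) <= eta.
  by near: n; exact: near_eta.
have un : vnorm (u n) <= V by near: n.
have sgn : EP P (fun w => tdot (u n) (T n w) ^+ 2) = sg by near: n.
have [_] := score_clt n0 uSn alh s_ge0 sw et hD hm (u n) b.
rewrite sgn distrC => h; apply: le_trans h _.
have vn0 : 0 <= vnorm (u n) by exact: sqrtr_ge0.
set B := vnorm (u n) * _.
have B0 : 0 <= B by rewrite mulr_ge0// sqrtr_ge0.
have BK : B <= K by rewrite ler_wpM2r// sqrtr_ge0.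
have B2K : B ^+ 2 <= K ^+ 2 by rewrite ler_pXn2r ?nnegrE.
have h1 : B * Dm + 2 * B ^+ 2 * D * Dm <= e / 2.
  apply: (@le_trans _ _ ((K + 2 * K ^+ 2 * D) * Dm)).
    rewrite [leRHS]mulrDl; apply: lerD; apply: ler_wpM2r => //; try exact: ltW.
    by apply: ler_wpM2r => //; apply: ler_wpM2l.
  rewrite /Dm mulrA ler_pdivrMr ?ltr_wpDl// mulrC ler_wpM2l//; first by rewrite divr_ge0// ltW.
  by rewrite lerDl.
have h2 : (20 * m ^ 2)%:R * (2 * vnorm (u n) * eta) * (B * D) ^+ 2 <= e / 2.
  apply: (@le_trans _ _ (c * eta)).
    rewrite /c [leRHS]mulrAC; apply: ler_pM.
    - by apply: mulr_ge0; [exact: ler0n|apply: mulr_ge0; [exact: mulr_ge0|exact: ltW]].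
    - exact: sqr_ge0.
    - rewrite -[leRHS]mulrA; apply: ler_wpM2l; first exact: ler0n.
      by apply: ler_wpM2r; [exact: ltW|apply: ler_wpM2l].
    - by rewrite ler_pXn2r ?nnegrE ?mulr_ge0// ler_wpM2r.
  rewrite /eta mulrA ler_pdivrMr ?ltr_wpDl// mulrC ler_wpM2l//; first by rewrite divr_ge0// ltW.
  by rewrite lerDl.
by rewrite [leRHS](splitr e); exact: lerD.
Unshelve. all: by end_near. Qed.

Lemma score_cvgd : (exists c : R, 0 < c /\ \forall n \near \oo, forall a : R,
    eigenvalue (Gam n) a -> c <= a) ->
  cvgd_stdnormal P (fun n w => invsqrtmx (Gam n) *m T n w).
Proof.
move=> [c [c0 hc]].
have quad n u : (u^T *m Gam n *m u) 0 0 = EP P (fun w => tdot u (T n w) ^+ 2).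
  exact/Emx_quadratic/finval_T.
have lb n : (forall a, eigenvalue (Gam n) a -> c <= a) -> forall u : 'cV_(2 * p),
    c * tdot u u <= (u^T *m Gam n *m u) 0 0.
  move=> h u; rewrite tdotE; apply: eigenvalue_lower_bound => //; exact: Emx_tr.
have pd : \forall n \near \oo, posdef (Gam n).
  apply: filterS hc => n /lb h; split; first exact: Emx_tr.
  by move=> v v0; apply: lt_le_trans (h v); rewrite mulr_gt0// tdotE dot_gt0.
pose Sn n := invsqrtmx (Gam n).
have conj n t : posdef (Gam n) ->
    EP P (fun w => tdot (Sn n *m t) (T n w) ^+ 2) = tdot t t.
  move=> pG; have [[sS _] _] := invsqrtmxP pG.
  rewrite -quad trmx_mul sS tdotE mulmxA (_ : t^T *m Sn n *m Gam n *m Sn n = t^T)//.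
  by rewrite -!mulmxA [Sn n *m (_ *m _)]mulmxA invsqrtmx_conj// mulmx1.
have move_S n t w : posdef (Gam n) -> tdot t (Sn n *m T n w) = tdot (Sn n *m t) (T n w).
  by move=> pG; have [[sS _] _] := invsqrtmxP pG; rewrite tdot_mulmx sS.
have fX n : finval (fun w => Sn n *m T n w).
  exact: (finval_comp (mulmx (Sn n)) (finval_T n)).
(* [2 p] is the second moment of the normalized vector, each coordinate contributing one. *)
apply: (cvgd_of_cos (K := (2 * p)%:R) fX) => [|t b].
  apply: filterS pd => n pG; rewrite EP_sum => [|j]; last first.
    exact: (finval_comp (fun y : 'cV[R]_(2 * p) => y j 0 ^+ 2) (fX n)).
  rewrite (eq_bigr (fun=> 1)) => [|j _]; first by rewrite sumr_const card_ord.
  have coord (v : 'cV[R]_(2 * p)) : tdot (delta_mx j 0) v = v j 0.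
    rewrite /tdot (bigD1 j)//= big1 => [|i ij]; first by rewrite mxE !eqxx mul1r addr0.
    by rewrite mxE (negPf ij) mul0r.
  rewrite (_ : (fun w => _) = fun w => tdot (Sn n *m delta_mx j 0) (T n w) ^+ 2).
    by rewrite conj// coord mxE !eqxx.
  by apply/funext => w; rewrite -move_S// coord.
have -> : \sum_j t j 0 ^+ 2 = tdot t t by apply: eq_bigr => j _; rewrite expr2.
(* The norm bound [sqrt (|t|^2 / c)] comes from [c |u|^2 <= u^T Gam u = |t|^2]. *)
have := @score_cos_cvg (fun n => Sn n *m t) (Num.sqrt (tdot t t / c)) (tdot t t) b (sqrtr_ge0 _).
move=> h; apply: cvg_trans (h _ _).
- apply: near_eq_cvg; apply: filterS pd => n pG; congr (Rintegral _ _ _).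
  by apply/funext => w; rewrite /= move_S.
- apply: filterS2 pd hc => n pG /lb /(_ (Sn n *m t)); rewrite quad conj// => h1.
  rewrite -(@ler_pXn2r _ 2)// ?nnegrE ?sqrtr_ge0// vnorm_sqr sqr_sqrtr.
    by rewrite ler_pdivlMr// mulrC.
  by rewrite divr_ge0 ?tdot_ge0// ltW.
- by apply: filterS pd => n pG; rewrite conj.
Qed.

Lemma score_cov_psd n : psd (Gam n).
Proof. exact/Emx_psd/finval_T. Qed.

Lemma score_cov_bounded : exists C, \forall n \near \oo, forall a, eigenvalue (Gam n) a -> `|a| <= C.
Proof.
have [C hC] := score_second_moment; exists C; apply: filterS hC => n h a.
by apply: Emx_eigenvalue_le h; exact: finval_T.
Qed.

End Asymptotics.
End QuantileScores.

Theorem theorem2 (R : realType) (p : nat)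
  (d : measure_display) (Om : measurableType d) (P : probability Om R)
  (dE : measure_display) (E : measurableType dE)
  (eps : int -> Om -> E) (epss : Om -> E)
  (x : forall n, 'I_n -> 'cV[R]_p) (y : forall n, 'I_n -> Om -> R)
  (alpha : 'I_2 -> nat -> R) (beta : 'I_2 -> nat -> 'cV[R]_p)
  (gam : 'I_2 -> forall n, 'I_n -> R)
  (G : 'I_2 -> nat -> (nat -> E) -> R) (f : 'I_2 -> nat -> R -> R) :
  let e k n (i : int) (w : Om) := G k n (past eps i w) in
  let es k n (i : int) (w : Om) := G k n (pastS eps epss i w) in
  (* innovations (eps_j)_j together with the independent copy eps_0^* are i.i.d. *)
  iid P (fam eps epss) ->
  (forall k n, seq_measurable_fun (G k n)) ->
  (forall k n, 0 < alpha k n < 1) ->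
  (forall k n (i : 'I_n), 0 < gam k n i) ->
  (forall k n, (0 < n)%N -> n%:R^-1 * \sum_(i < n) gam k n i = 1) ->
  (* the two quantile regression models, i = 1..n *)
  (forall k n (i : 'I_n) w,
     y n i w = ((x n i)^T *m beta k n) 0 0 + gam k n i * e k n (i.+1)%:Z w) ->
  (forall k n (i : 'I_n), prob P [set w | e k n (i.+1)%:Z w <= 0] = 1 - alpha k n) ->
  (* hypotheses of Lemma 3 for each level *)
  (forall k, lemma3_hyps P x (alpha k) (gam k) (e k) (es k) (f k)) ->
  let zeta n (i : 'I_n) w : 'cV[R]_2 :=
    \col_(k < 2) ((Num.sqrt (alpha k n * (1 - alpha k n)))^-1 *
       ((1 - alpha k n) - (if gam k n i * e k n (i.+1)%:Z w <= 0 then 1 else 0))) in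
  let T n w : 'cV[R]_(2 * p) :=
    (Num.sqrt n%:R)^-1 *: \sum_(i < n) kron (zeta n i w) (zz x i) in
  let Gam n := Emx P (T n) in
  (\forall n \near \oo, psd (Gam n)) /\
  (exists C : R, \forall n \near \oo, forall a : R, eigenvalue (Gam n) a -> `|a| <= C) /\
  ((exists c : R, 0 < c /\ \forall n \near \oo, forall a : R, eigenvalue (Gam n) a -> c <= a) ->
   cvgd_stdnormal P (fun n w => invsqrtmx (Gam n) *m T n w)).
Proof.
move=> e es iid_xi mG al01 gam0 _ _ e_le0 hyps zeta T Gam.
have G0 k n : (0 < n)%N -> prob P [set w | G k n (past eps 1 w) <= 0] = 1 - alpha k n.
  (* The ordinal 0 stands for the first observation, whose time is 1. *)
  by move=> n0; exact: (e_le0 k n (Ordinal n0)).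
have uS : \forall n \near \oo, Sigma x n \in unitmx by have [_ []] := hyps ord0.
have zo k : is_o (fun n => maxi (fun i : 'I_n => vnorm (zz x i)))
    (fun n => Num.sqrt (n%:R * alpha k n)).
  by have [_ [_ [_ [_ []]]]] := hyps k.
have al0 k : alpha k @ \oo --> 0 by have [_ [_ [_ [_ [_ [_ []]]]]]] := hyps k.
have /choice[s hs] : forall k, exists s : nat -> R, [/\ forall l, 0 <= s l,
    forall r, 0 < r -> exists m, forall M, \sum_(m <= l < M) s l <= r &
    \forall n \near \oo, forall l : nat, prob P [set w |
      ~ (0 < G k n (past eps l%:Z w) <-> 0 < G k n (pastS eps epss l%:Z w))]
      <= 2 * s l ^+ 2 * alpha k n].
  move=> k; have [_ [_ [[q [q2 tas]] _]]] := hyps k.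
  exact: (switch_summable iid_xi (mG k) (al01 k) (G0 k) (al0 k) q2 tas).
have s0 k : forall l, 0 <= s k l by have [] := hs k.
have st k : forall r, 0 < r -> exists m, forall M, \sum_(m <= l < M) s k l <= r by have [] := hs k.
have sw k : \forall n \near \oo, forall l : nat, prob P [set w |
      ~ (0 < G k n (past eps l%:Z w) <-> 0 < G k n (pastS eps epss l%:Z w))]
      <= 2 * s k l ^+ 2 * alpha k n by have [] := hs k.
split; last split.
- by apply: nearW => n; exact: (score_cov_psd x alpha iid_xi mG gam0 n).
- exact: (score_cov_bounded iid_xi mG al01 gam0 G0 s0 st sw uS al0 zo).
- exact: (score_cvgd iid_xi mG al01 gam0 G0 s0 st sw uS al0 zo).
Qed.
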